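(* Let $\mathfrak A=\overline{\bigcup_{n\in\mathbb N}\mathfrak A_n}^{\|\cdot\|_{\mathfrak A}}$ be a unital AF algebra (so $(\mathfrak A_n)_n$ is a non-decreasing sequence of unital finite-dimensional C*-subalgebras with $\mathfrak A_0=\mathbb C1_{\mathfrak A}$), and denote $\mathcal U=(\mathfrak A_n)_{n\in\mathbb N}$. Let $(\beta(j))_{j\in\mathbb N}\subset(0,\infty)$ be summable. For each $n\in\mathbb N$, let $E_{n+1,n}:\mathfrak A_{n+1}\to\mathfrak A_n$ be a conditional expectation onto $\mathfrak A_n$; for $n>m\ge0$ put $E_{n,m}=E_{m+1,m}\circ\cdots\circ E_{n,n-1}:\mathfrak A_n\to\mathfrak A_m$, and $E_{n,n}=\mathrm{id}_{\mathfrak A_n}$. For each $n\in\mathbb N\setminus\{0\}$ define, for all $a\in\mathfrak A_n$, $$\mathsf L^\beta_{\mathfrak A_n,E}(a):=\max_{m\in\{0,\dots,n-1\}}\left\{\frac{\|a-E_{n,m}(a)\|_{\mathfrak A}}{\beta(m)}\right\},$$ and let $\mathsf L^\beta_{\mathfrak A_0,E}$ be the $0$-seminorm on $\mathfrak A_0$. Then: (1) for each $n\in\mathbb N$, $(\mathfrak A_n,\mathsf L^\beta_{\mathfrak A_n,E})$ is a $(2,0)$-quasi-Leibniz compact quantum metric space such that $\mathrm{diam}(\mathfrak A_n,\mathsf L^\beta_{\mathfrak A_n,E})\le2\beta(0)$; (2) $\mathfrak A$ is $((\mathfrak A_n,\mathsf L^\beta_{\mathfrak A_n,E}))_{n\in\mathbb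 N}$-propinquity approximable with respect to $(\beta(j))_{j\in\mathbb N}$; and (3) the limit Lip-norm $\mathsf L^\beta_{\mathcal U,E}$ on $\mathfrak A$ associated (as described in the context) to the approximable sequence in (2), which is a $(2,0)$-quasi-Leibniz Lip-norm, satisfies $\mathfrak{sa}(\bigcup_{n\in\mathbb N}\mathfrak A_n)\subseteq\operatorname{dom}(\mathsf L^\beta_{\mathcal U,E})$, $$\lim_{n\to\infty}\mathsf\Lambda^\ast\big((\mathfrak A_n,\mathsf L^\beta_{\mathfrak A_n,E}),(\mathfrak A,\mathsf L^\beta_{\mathcal U,E})\big)=0,$$ $$\mathsf\Lambda^\ast\big((\mathfrak A_n,\mathsf L^\beta_{\mathfrak A_n,E}),(\mathfrak A,\mathsf L^\beta_{\mathcal U,E})\big)\le4\sum_{j=n}^\infty\beta(j)\quad\text{for each }n\in\mathbb N,$$ and for each $n\in\mathbb N$, $$\mathsf L^\beta_{\mathcal U,E}(a)\le\max\{1,2\beta(0)/\beta(n-1)\}\cdot\mathsf L^\beta_{\mathfrak A_n,E}(a)\quad\text{for all }a\in\mathfrak{sa}(\mathfrak A_n),$$ where $\beta(-1):=\infty$ with the convention $1/\infty=0$. In particular, every unital AF algebra $\mathfrak A$ is propinquity approximable, and $\mathfrak A$ is propinquity approximable by any increasing sequence $(\mathfrak A_n)_{n\in\mathbb N}$ of finite-dimensional unital C*-subalgebras such that $\mathfrak A_0=\mathbb C1_{\mathfrak A}$ and $\mathfrak A=\overline{\bigcup_{n\in\mathbb N}\mathfrak A_n}^{\|\cdot\|_{\mathfrak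 A}}$ (that is, with respect to some choice of Lip-norms on the $\mathfrak A_n$ and some summable sequence $\beta$), and, if $k\in(1,\infty)$, then for each $j\in\mathbb N$ we may choose $\beta(j)\le1/\dim(\mathfrak A_j)^k$.
   Context: $\mathbb N=\{0,1,2,\dots\}$; $\mathfrak{sa}(\cdot)$ denotes self-adjoint elements and $\mathscr S(\mathfrak A)$ the state space of a unital C*-algebra $\mathfrak A$. A conditional expectation $E:\mathfrak A\to\mathfrak B$ onto a unital C*-subalgebra is a surjective linear contractive completely positive map with $E(b)=b$ and $E(bxb')=bE(x)b'$ for $b,b'\in\mathfrak B$, $x\in\mathfrak A$. (Conditional expectations $\mathfrak A_{n+1}\to\mathfrak A_n$ always exist for finite-dimensional C*-algebras.) Compact quantum metric spaces. A compact quantum metric space $(\mathfrak A,\mathsf L)$ is a unital C*-algebra $\mathfrak A$ with a $[0,\infty]$-valued seminorm $\mathsf L$ (over $\mathbb R$) on $\mathfrak{sa}(\mathfrak A)$ (called a Lip-norm), whose domain $\operatorname{dom}(\mathsf L)=\{a\in\mathfrak{sa}(\mathfrak A):\mathsf L(a)<\infty\}$ is a unital dense real subspace of $\mathfrak{sa}(\mathfrak A)$, such that $\{a:\mathsf L(a)=0\}=\mathbb R1_{\mathfrak A}$; the Monge–Kantorovich metric $\mathsf{mk}_{\mathsf L}(\varphi,\psi)=\sup\{|\varphi(a)-\psi(a)|:a\in\operatorname{dom}(\mathsf L),\mathsf L(a)\le1\}$ metrizes the weak* topology of $\mathscr S(\mathfrak A)$; and $\mathsf L$ is lower semi-continuous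 for $\|\cdot\|_{\mathfrak A}$. $\mathrm{diam}(\mathfrak A,\mathsf L)$ is the diameter of $(\mathscr S(\mathfrak A),\mathsf{mk}_{\mathsf L})$. A seminorm given on all of $\mathfrak A$ is regarded as a Lip-norm via its restriction to $\mathfrak{sa}(\mathfrak A)$. It is $(C,D)$-quasi-Leibniz ($C\ge1,D\ge0$) if for all $a,b\in\operatorname{dom}(\mathsf L)$, $\max\{\mathsf L(\frac{ab+ba}2),\mathsf L(\frac{ab-ba}{2i})\}\le C(\|a\|\mathsf L(b)+\|b\|\mathsf L(a))+D\,\mathsf L(a)\mathsf L(b)$. Dual propinquity. A $(C,D)$-tunnel from $(\mathfrak A_1,\mathsf L_1)$ to $(\mathfrak A_2,\mathsf L_2)$ is $(\mathfrak D,\mathsf L_{\mathfrak D},\pi_1,\pi_2)$ with $(\mathfrak D,\mathsf L_{\mathfrak D})$ a $(C,D)$-quasi-Leibniz compact quantum metric space and $\pi_j:\mathfrak D\to\mathfrak A_j$ unital *-epimorphisms with $\mathsf L_j(a)=\inf\{\mathsf L_{\mathfrak D}(d):d\in\mathfrak{sa}(\mathfrak D),\pi_j(d)=a\}$ for all $a\in\mathfrak{sa}(\mathfrak A_j)$. Its extent is $\max_{j=1,2}\mathrm{Haus}_{\mathsf{mk}_{\mathsf L_{\mathfrak D}}}(\mathscr S(\mathfrak D),\{\varphi\circ\pi_j:\varphi\in\mathscr S(\mathfrak A_j)\})$ (Hausdorff distance). The dual Gromov–Hausdorff propinquity $\mathsf\Lambda^\ast$ between two $(C,D)$-quasi-Leibniz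 compact quantum metric spaces is the infimum of the extents of all $(C,D)$-tunnels between them (here $(C,D)=(2,0)$). Approximability. Let $(\mathfrak A_n)_n$ be a non-decreasing sequence of unital C*-subalgebras of a unital C*-algebra $\mathfrak A$ with dense union. $\mathfrak A$ is $((\mathfrak A_n,\mathsf L_{\mathfrak A_n}))_n$-propinquity approximable with respect to $(\beta(j))_j\subset(0,\infty)$, $\sum_j\beta(j)<\infty$, if for every $n$: (i) $\mathsf L_{\mathfrak A_n}$ is a $(C,D)$-quasi-Leibniz Lip-norm defined on all of $\mathfrak A_n$ (with values in $[0,\infty]$) and $\{a\in\mathfrak A_n:\mathsf L_{\mathfrak A_n}(a)<\infty\}$ is a dense *-subalgebra of $\mathfrak A_n$; (ii) $\mathsf L_{\mathfrak A_{n+1}}(a)\le\mathsf L_{\mathfrak A_n}(a)$ for $a\in\mathfrak A_n$; (iii) the length of the evident bridge from $\mathfrak A_n$ to $\mathfrak A_{n+1}$ is at most $\beta(n)$, i.e. the maximum of $\sup_a\inf_b\|a-b\|_{\mathfrak A}$ and $\sup_b\inf_a\|a-b\|_{\mathfrak A}$ is $\le\beta(n)$, where $a$ ranges over $a\in\mathfrak{sa}(\mathfrak A_n)$, $\mathsf L_{\mathfrak A_n}(a)\le1$ and $b$ over $b\in\mathfrak{sa}(\mathfrak A_{n+1})$, $\mathsf L_{\mathfrak A_{n+1}}(b)\le1$. Limit Lip-norm of an approximable sequence. With these data let $\mathfrak D_n=\mathfrak A_n\oplus\mathfrak A_{n+1}$, $\mathsf L^n(a,b)=\max\{\mathsf L_{\mathfrak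 A_n}(a),\mathsf L_{\mathfrak A_{n+1}}(b),\frac{\|a-b\|_{\mathfrak A}}{2\beta(n)}\}$, $\pi_n(a,b)=a$, $\omega_n(a,b)=b$. Let $\mathfrak D=\prod_n\mathfrak D_n$ (bounded sequences), $S_0((d_n)_n)=\sup_n\mathsf L^n(d_n)$ on $\mathfrak{sa}(\mathfrak D)$, $\mathfrak K_0=\{d\in\mathfrak{sa}(\mathfrak D):\pi_{n+1}(d_{n+1})=\omega_n(d_n)\ \forall n\}$, $\mathfrak L_0=\{d\in\mathfrak K_0:S_0(d)<\infty\}$, $\mathfrak S_0=\{d\in\mathfrak D:\frac{d+d^*}2,\frac{d-d^*}{2i}\in\mathfrak L_0\}$, $\mathfrak G_0=\overline{\mathfrak S_0}^{\|\cdot\|_{\mathfrak D}}$ (a unital C*-subalgebra), $\mathfrak I_0=\{d\in\mathfrak G_0:\lim_n\|d_n\|=0\}$ (a closed two-sided ideal), $\mathfrak F^\tau=\mathfrak G_0/\mathfrak I_0$ with quotient map $q$, and $\mathsf L_\tau(a)=\inf\{S_0(d):d\in\mathfrak{sa}(\mathfrak G_0),q(d)=a\}$ for $a\in\mathfrak{sa}(\mathfrak F^\tau)$. Let $\psi_0(a)=((a,a))_{n\in\mathbb N}$ for $a\in\mathfrak A_0$ and, for $n\ge1$, $a\in\mathfrak A_n$, $\psi_n(a)=((0,0),\dots,(0,0),(0,a),(a,a),(a,a),\dots)$ with $(0,a)\in\mathfrak D_{n-1}$; these take values in $\mathfrak G_0$. Put $\psi^{(n)}=q\circ\psi_n$.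 There is a unique unital *-isomorphism $\psi:\mathfrak A\to\mathfrak F^\tau$ with $\psi|_{\mathfrak A_n}=\psi^{(n)}$ for all $n$, and the limit Lip-norm on $\mathfrak A$ is $\mathsf L_\tau\circ\psi$. For the sequence $((\mathfrak A_n,\mathsf L^\beta_{\mathfrak A_n,E}))_n$ and $\beta$ it is denoted $\mathsf L^\beta_{\mathcal U,E}$. *)

(* Defs.v *)
From HB Require Import structures.
From mathcomp Require Import all_boot all_order all_algebra.
From mathcomp Require Import complex.
From mathcomp Require Import all_classical all_reals all_analysis.

Set Implicit Arguments.
Unset Strict Implicit.
Unset Printing Implicit Defensive.

Import Order.TTheory GRing.Theory Num.Theory.
Import numFieldNormedType.Exports ComplexField.Normc.

Local Open Scope classical_set_scope.
Local Open Scope ring_scope.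
Local Open Scope complex_scope.

(* An [algType] satisfies 1 != 0, so the zero algebra is excluded. *)
HB.mixin Record Algebra_isCStar (R : realType) A of GRing.Algebra R[i] A := {
  star : A -> A;
  starK : involutive star;
  starD : {morph star : a b / a + b};
  starZ : forall (c : R[i]) (a : A), star (c *: a) = conjc c *: star a;
  starM : forall a b : A, star (a * b) = star b * star a;
  cnorm : A -> R;
  cnormD : forall a b : A, cnorm (a + b) <= cnorm a + cnorm b;
  cnormZ : forall (c : R[i]) (a : A), cnorm (c *: a) = normc c * cnorm a;
  cnorm0_eq0 : forall a : A, cnorm a = 0 -> a = 0;
  cnormM : forall a b : A, cnorm (a * b) <= cnorm a * cnorm b;
  cnorm_star : forall a : A, cnorm (star a * a) = cnorm a ^+ 2;
  cnorm_complete : forall u : nat -> A,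
    (forall e : R, 0 < e -> exists N, forall m n, (N <= m)%N -> (N <= n)%N ->
       cnorm (u m - u n) < e) ->
    exists l, forall e : R, 0 < e -> exists N, forall n, (N <= n)%N ->
       cnorm (u n - l) < e
}.

#[short(type="cstarType")]
HB.structure Definition CStar (R : realType) :=
  {A of Algebra_isCStar R A & GRing.Algebra R[i] A}.

(* Hierarchy-Builder admits no structure joining [NormedModule R[i]] and
   [GRing.Algebra R[i]]; the norm topology lives on this alias. *)
Definition normed (R : realType) (A : cstarType R) : Type := A.

Section Normed.
Variables (R : realType) (A : cstarType R).
HB.instance Definition _ := GRing.Lmodule.on (normed A).
Let nrm (a : normed A) : R[i] := (cnorm (a : A))%:C.
Let nrmD x y : nrm (x + y) <= nrm x + nrm y.
Proof. by rewrite /nrm -rmorphD /= lecR cnormD. Qed.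
Let nrmZ (l : R[i]) x : nrm (l *: x) = `|l| * nrm x.
Proof. by rewrite /nrm cnormZ rmorphM. Qed.
Let nrm0 x : nrm x = 0 -> x = 0.
Proof. by move=> [] /cnorm0_eq0. Qed.
HB.instance Definition _ := Lmodule_isNormed.Build R[i] (normed A) nrmD nrmZ nrm0.

Lemma nbhs_normedP (x : normed A) (U : set (normed A)) :
  nbhs x U <-> exists2 e : R, 0 < e & forall y : A, cnorm (y - x) < e -> U y.
Proof.
split.
  move=> /(@nbhs_normP R[i] (normed A))[[e e'] /= e0 eU].
  move: e0; rewrite ltcE /= => /andP[/eqP e'0 e0]; subst e'.
  exists e => // y yx; apply: eU => /=.
  rewrite -normrN opprB /= -[X in _ < X]complexr0.
  by rewrite [X in X < _](_ : _ = (cnorm (y - x : A))%:C) // ltcR.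
move=> [e e0 eU]; apply/(@nbhs_normP R[i] (normed A)); exists e%:C => /=; first by rewrite ltcR.
move=> y /=; rewrite -normrN opprB => yx; apply: eU.
by rewrite -ltcR.
Qed.
End Normed.

Section SubCStar.
Variables (R : realType) (A : cstarType R).

Record subcstar := SubCStar {
  subcstar_set :> A -> Prop;
  subcstar_closed : closed [set a : normed A | subcstar_set a];
  subcstar1 : subcstar_set 1;
  subcstarD : forall a b, subcstar_set a -> subcstar_set b -> subcstar_set (a + b);
  subcstarZ : forall (c : R[i]) a, subcstar_set a -> subcstar_set (c *: a);
  subcstarM : forall a b, subcstar_set a -> subcstar_set b -> subcstar_set (a * b);
  subcstar_star : forall a, subcstar_set a -> subcstar_set (star a)
}.

Variable B : subcstar.

Definition subcstar_pred : pred A := [pred x | `[< B x >]].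

Lemma subcstar_subsemialg : GRing.subsemialg_closed subcstar_pred.
Proof.
split.
- exact/asboolP/subcstar1.
- split; last by move=> a b /asboolP Ba /asboolP Bb; exact/asboolP/subcstarD.
  by apply/asboolP; rewrite -(scale0r (1 : A)); exact/subcstarZ/subcstar1.
- by move=> c a /asboolP Ba; exact/asboolP/subcstarZ.
- by move=> a b /asboolP Ba /asboolP Bb; exact/asboolP/subcstarM.
Qed.

HB.instance Definition _ :=
  GRing.isSubalgClosed.Build R[i] A subcstar_pred subcstar_subsemialg.

Record subcstar_type := SubElt { elt :> A; _ : subcstar_pred elt }.
HB.instance Definition _ := [isSub for elt].
HB.instance Definition _ := [Choice of subcstar_type by <:].
HB.instance Definition _ := [SubChoice_isSubAlgebra of subcstar_type by <:].

Lemma eltP (x : subcstar_type) : B (elt x).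
Proof. by case: x => x /= /asboolP. Qed.

Definition mkelt (a : A) (Ba : B a) : subcstar_type := SubElt (asboolT Ba).

Let sstar (x : subcstar_type) := mkelt (subcstar_star (eltP x)).
Let snorm (x : subcstar_type) := cnorm (elt x).

Let sstarK : involutive sstar.
Proof. by move=> x; apply: val_inj; exact: starK. Qed.
Let sstarD : {morph sstar : a b / a + b}.
Proof. by move=> x y; apply: val_inj; exact: starD. Qed.
Let sstarZ (c : R[i]) a : sstar (c *: a) = conjc c *: sstar a.
Proof. by apply: val_inj; exact: starZ. Qed.
Let sstarM a b : sstar (a * b) = sstar b * sstar a.
Proof. by apply: val_inj; exact: starM. Qed.
Let snormD a b : snorm (a + b) <= snorm a + snorm b.
Proof. exact: cnormD. Qed.
Let snormZ (c : R[i]) a : snorm (c *: a) = normc c * snorm a.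
Proof. exact: cnormZ. Qed.
Let snorm0_eq0 a : snorm a = 0 -> a = 0.
Proof. by move=> /cnorm0_eq0 a0; exact: val_inj. Qed.
Let snormM a b : snorm (a * b) <= snorm a * snorm b.
Proof. exact: cnormM. Qed.
Let snorm_star a : snorm (sstar a * a) = snorm a ^+ 2.
Proof. exact: cnorm_star. Qed.

Let snorm_complete (u : nat -> subcstar_type) :
  (forall e : R, 0 < e -> exists N, forall m n, (N <= m)%N -> (N <= n)%N ->
     snorm (u m - u n) < e) ->
  exists l, forall e : R, 0 < e -> exists N, forall n, (N <= n)%N ->
     snorm (u n - l) < e.
Proof.
move=> /(@cnorm_complete R A (elt \o u))[l ul].
suff Bl : B l by exists (mkelt Bl).
apply: (@subcstar_closed B) => U /nbhs_normedP[e e0 eU].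
have [N uN] := ul _ e0; exists (elt (u N)); split; first exact: eltP.
exact/eU/uN.
Qed.

HB.instance Definition _ := Algebra_isCStar.Build R subcstar_type
  sstarK sstarD sstarZ sstarM snormD snormZ snorm0_eq0 snormM snorm_star
  snorm_complete.

Definition subcstar_cstar : cstarType R := subcstar_type.

End SubCStar.
Coercion subcstar_cstar : subcstar >-> cstarType.

Section Definitions.
Variable R : realType.
Implicit Types A B : cstarType R.

Definition sa A : set A := [set a | star a = a].

Definition jordan_prod A (a b : A) : A := (2 : R[i])^-1 *: (a * b + b * a).
Definition lie_prod A (a b : A) : A := (2 * 'i%C : R[i])^-1 *: (a * b - b * a).

Record star_hom A B (f : A -> B) : Prop := StarHom {
  star_hom_linear : linear f;
  star_hom1 : f 1 = 1;
  star_homM : forall a b, f (a * b) = f a * f b;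
  star_hom_star : forall a, f (star a) = star (f a)
}.

(* As a [set_type] over [{ptws A -> R[i]^o}], [states A] carries the topology
   induced by pointwise convergence, i.e. the weak* topology. *)
Definition states A : set {ptws A -> R[i]^o} :=
  [set phi | [/\ scalar (phi : A -> R[i]),
                 forall a : A, (0 : R[i]) <= phi (star a * a)
               & phi 1 = (1 : R[i])]].
Arguments states : clear implicits.

Section LipNorm.
Variables (A : cstarType R) (L : A -> \bar R).
Local Open Scope ereal_scope.

Definition dom : set A := [set a | sa a /\ L a < +oo].

Definition lip_ball : set A := [set a | sa a /\ L a <= 1].

Definition mk (phi psi : states A) : \bar R :=
  ereal_sup [set (normc (\val phi a - \val psi a)%R)%:E | a in lip_ball].

Definition diam : \bar R :=
  ereal_sup [set mk p.1 p.2 | p in [set: states A * states A]].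

(* [L] is [0, +oo]-valued on [sa A], with 0 * +oo = 0 in [lip_scale].
   Only the values of [L] on [sa A] are constrained. *)
Record is_lip_norm : Prop := IsLipNorm {
  lip_ge0 : forall a, sa a -> 0 <= L a;
  lip_scale : forall (r : R) a, sa a -> L (r%:C *: a)%R = `|r|%:E * L a;
  lip_add : forall a b, sa a -> sa b -> L (a + b)%R <= L a + L b;
  lip_dom1 : dom 1%R;
  lip_dom_dense : forall a, sa a -> closure [set b : normed A | dom b] a;
  lip_ker : forall a, sa a -> (L a = 0 <-> exists r : R, a = (r%:C *: 1)%R);
  lip_mk_fin : forall phi psi, mk phi psi < +oo;
  lip_mk_sep : forall phi psi, mk phi psi = 0 -> phi = psi;
  lip_mk_weak : forall phi : states A,
    nbhs phi = filter_from [set e : R | (0 < e)%R]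
                           (fun e => [set psi | mk phi psi < e%:E]);
  lip_lsc : lower_semicontinuous
    (L : subspace [set a : normed A | sa a] -> \bar R)
}.

Definition quasi_leibniz (C D : R) : Prop := forall a b, dom a -> dom b ->
  maxe (L (jordan_prod a b)) (L (lie_prod a b)) <=
    C%:E * ((cnorm a)%:E * L b + (cnorm b)%:E * L a) + D%:E * (L a * L b).

(* Over the complex scalars, on all of [A]. *)
Record seminorm : Prop := Seminorm {
  seminorm_ge0 : forall a, 0 <= L a;
  seminorm_scale : forall (c : R[i]) a, L (c *: a)%R = (normc c)%:E * L a;
  seminorm_add : forall a b, L (a + b)%R <= L a + L b
}.

End LipNorm.

Definition hausdorff (T : Type) (d : T -> T -> \bar R) (X Y : set T) : \bar R :=
  maxe (ereal_sup [set ereal_inf [set d x y | y in Y] | x in X])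
       (ereal_sup [set ereal_inf [set d x y | x in X] | y in Y]).

Record tunnel (C D : R) A1 (L1 : A1 -> \bar R) A2 (L2 : A2 -> \bar R) := Tunnel {
  tun_alg :> cstarType R;
  tun_lip : tun_alg -> \bar R;
  tun_pi1 : tun_alg -> A1;
  tun_pi2 : tun_alg -> A2;
  tun_lip_norm : is_lip_norm tun_lip;
  tun_leibniz : quasi_leibniz tun_lip C D;
  tun_pi1_hom : star_hom tun_pi1;
  tun_pi2_hom : star_hom tun_pi2;
  tun_pi1_surj : forall a, exists d, tun_pi1 d = a;
  tun_pi2_surj : forall a, exists d, tun_pi2 d = a;
  tun_quotient1 : forall a, sa a ->
    L1 a = ereal_inf [set tun_lip d | d in [set d | sa d /\ tun_pi1 d = a]];
  tun_quotient2 : forall a, sa a ->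
    L2 a = ereal_inf [set tun_lip d | d in [set d | sa d /\ tun_pi2 d = a]]
}.

Definition pulled_states A B (f : B -> A) : set (states B) :=
  [set psi | exists phi : states A, forall b, \val psi b = \val phi (f b)].

Definition extent C D A1 (L1 : A1 -> \bar R) A2 (L2 : A2 -> \bar R)
    (t : tunnel C D L1 L2) : \bar R :=
  let d := mk (@tun_lip _ _ _ _ _ _ t) in
  maxe (hausdorff d setT (pulled_states (@tun_pi1 _ _ _ _ _ _ t)))
       (hausdorff d setT (pulled_states (@tun_pi2 _ _ _ _ _ _ t))).

Definition propinquity C D A1 (L1 : A1 -> \bar R) A2 (L2 : A2 -> \bar R) : \bar R :=
  ereal_inf [set x | exists t : tunnel C D L1 L2, x = extent t].

Definition mxstar A k (X : 'M[A]_k) : 'M[A]_k := (map_mx star X)^T.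

(* The positive elements of the C*-algebra of k x k matrices are the products
   mxstar X *m X. *)
Definition completely_positive A B (f : A -> B) : Prop :=
  forall k (X : 'M[A]_k), exists Y : 'M[B]_k,
    map_mx f (mxstar X *m X) = mxstar Y *m Y.

Record cond_exp A B (iota : B -> A) (E : A -> B) : Prop := CondExp {
  cond_exp_surj : forall b, exists a, E a = b;
  cond_exp_linear : linear E;
  cond_exp_contractive : forall a, cnorm (E a) <= cnorm a;
  cond_exp_cp : completely_positive E;
  cond_exp_id : forall b, E (iota b) = b;
  cond_exp_bimod : forall b b' a, E (iota b * a * iota b') = b * E a * b'
}.

Record filtration A := Filtration {
  stage :> nat -> subcstar A;
  stage_incr : forall n a, stage n a -> stage n.+1 a;
  stage_dense : forall a : A, closure [set b : normed A | exists n, stage n b] a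
}.

Lemma stage_le A (U : filtration A) m n (a : A) : (m <= n)%N -> U m a -> U n a.
Proof.
move=> /subnK <-; elim: (n - m)%N => [//|k IHk] Ua.
by rewrite addSn; exact/stage_incr/IHk.
Qed.

Definition stage_inclusion A (U : filtration A) n (a : U n) : U n.+1 :=
  mkelt (stage_incr (eltP a)).

Definition has_dim (V : lmodType R[i]) (d : nat) : Prop :=
  exists2 f : V -> 'rV[R[i]]_d, linear f & bijective f.

Definition fin_dim_filtration A (U : filtration A) : Prop :=
  forall n, exists d, has_dim (U n) d.

Definition af_filtration A (U : filtration A) : Prop :=
  fin_dim_filtration U /\ forall a, U 0%N a <-> exists c : R[i], a = c *: 1.

Definition unital_AF A : Prop := exists U : filtration A, fin_dim_filtration U.

Section Approximable.
Variables (A : cstarType R) (U : filtration A).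
Variables (L : forall n, U n -> \bar R) (beta : nat -> R).
Local Open Scope ereal_scope.

Definition bridge_length n : \bar R :=
  hausdorff (fun a b : A => (cnorm (a - b)%R)%:E)
    [set elt a | a in lip_ball (@L n)] [set elt b | b in lip_ball (@L n.+1)].

Record approximable (C D : R) : Prop := Approximable {
  approx_beta_gt0 : forall n, (0 < beta n)%R;
  approx_beta_summable : cvgn (series beta);
  approx_seminorm : forall n, seminorm (@L n);
  approx_lip_norm : forall n, is_lip_norm (@L n);
  approx_leibniz : forall n, quasi_leibniz (@L n) C D;
  approx_finite_dense : forall n (a : U n),
    closure [set b : normed (U n) | L b < +oo] a;
  approx_finite_lin : forall n (c : R[i]) (a b : U n),
    L a < +oo -> L b < +oo -> L (c *: a + b)%R < +oo;
  approx_finite_mul : forall n (a b : U n),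
    L a < +oo -> L b < +oo -> L (a * b)%R < +oo;
  approx_finite_star : forall n (a : U n), L a < +oo -> L (star a) < +oo;
  approx_decr : forall n (a : U n), L (stage_inclusion a) <= L a;
  approx_length : forall n, bridge_length n <= (beta n)%:E
}.

(* An element of [dseq] is an arbitrary sequence of the product of the direct
   sums of consecutive stages; boundedness is imposed by [dbounded], and the
   algebra operations are pointwise. *)
Definition dseq : Type := forall n, U n * U n.+1.

Definition dnorm n (p : U n * U n.+1) : R := Num.max (cnorm p.1) (cnorm p.2).
Definition dstar n (p : U n * U n.+1) : U n * U n.+1 := (star p.1, star p.2).

Definition dbounded : set dseq := [set d | exists M : R, forall n, (dnorm (d n) <= M)%R].
Definition dsa : set dseq := [set d | dbounded d /\ forall n, dstar (d n) = d n].

Definition supnorm (d : dseq) : R := sup (range (fun n => dnorm (d n))).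

Definition lip_pair n (p : U n * U n.+1) : \bar R :=
  maxe (maxe (L p.1) (L p.2)) (cnorm (elt p.1 - elt p.2)%R / (2 * beta n))%:E.

Definition S0 (d : dseq) : \bar R := ereal_sup (range (fun n => lip_pair (d n))).

Definition K0 : set dseq := [set d | dsa d /\ forall n, (d n.+1).1 = (d n).2].
Definition L0 : set dseq := [set d | K0 d /\ S0 d < +oo].
Definition Sfrak0 : set dseq := [set d | dbounded d /\
  L0 (fun n => (2 : R[i])^-1 *: (d n + dstar (d n)))%R /\
  L0 (fun n => (2 * 'i%C : R[i])^-1 *: (d n - dstar (d n)))%R].
Definition G0 : set dseq := [set d | dbounded d /\ forall e : R, (0 < e)%R ->
  exists2 s, Sfrak0 s & (supnorm (fun n => d n - s n) < e)%R].
Definition I0 : set dseq :=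
  [set d | G0 d /\ (fun n => dnorm (d n)) @ \oo --> (0%R : R)].

(* [F] with [q] is the quotient C*-algebra [G0 / I0], quotient norm included.
   The values of [q] outside [G0] are junk. *)
Record quotient_map (F : cstarType R) (q : dseq -> F) : Prop := QuotientMap {
  quo_linear : forall (c : R[i]) d d', G0 d -> G0 d' ->
    q (fun n => c *: d n + d' n)%R = (c *: q d + q d')%R;
  quo1 : q (fun n => 1%R) = 1%R;
  quoM : forall d d', G0 d -> G0 d' -> q (fun n => d n * d' n)%R = (q d * q d')%R;
  quo_star : forall d, G0 d -> q (fun n => dstar (d n)) = star (q d);
  quo_surj : forall x, exists2 d, G0 d & q d = x;
  quo_ker : forall d, G0 d -> (q d = 0%R <-> I0 d);
  quo_norm : forall d, G0 d ->
    cnorm (q d) = inf [set supnorm (fun n => d n + i n)%R | i in I0]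
}.

Definition L_tau (F : cstarType R) (q : dseq -> F) (x : F) : \bar R :=
  ereal_inf [set S0 d | d in [set d | G0 d /\ dsa d /\ q d = x]].

(* [a] viewed in [U k] if [n <= k], and 0 otherwise, even when [a] happens to
   belong to an earlier stage. *)
Definition emb n k (a : U n) : U k :=
  match @idP (n <= k)%N with
  | ReflectT le_nk => mkelt (stage_le le_nk (eltP a))
  | ReflectF _ => 0%R
  end.

Definition psi_seq n (a : U n) : dseq := fun k => (emb k a, emb k.+1 a).

(* Determines [Linf] on [sa A] only. *)
Definition limit_lip_norm (Linf : A -> \bar R) : Prop :=
  exists (F : cstarType R) (q : dseq -> F) (psi : A -> F),
    [/\ quotient_map q, star_hom psi, bijective psi,
        forall n (a : U n), psi (elt a) = q (psi_seq a)
      & forall a, sa a -> Linf a = L_tau q (psi a)].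

End Approximable.

Definition approximable_by A (U : filtration A) : Prop :=
  exists (L : forall n, U n -> \bar R) (beta : nat -> R),
    approximable L beta 2 0.

Section AF.
Variables (A : cstarType R) (U : filtration A) (beta : nat -> R).
Variable E : forall n, U n.+1 -> U n.

(* E_{n,m} for m <= n, with values viewed in [A]. *)
Fixpoint Ecomp (m n : nat) : U n -> A :=
  match n return U n -> A with
  | 0%N => fun a => elt a
  | n'.+1 => fun a => if (n' < m)%N then elt a else Ecomp m (E a)
  end.

(* The terms are nonnegative, so the default 0 only matters for n = 0. *)
Definition L_beta n (a : U n) : \bar R :=
  (\big[Num.max/0]_(m < n) (cnorm (elt a - Ecomp m a) / beta m))%:E.

End AF.
End Definitions.

Arguments stage_inclusion {R A} U n a.
Arguments L_beta {R A U} beta E n a.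
Arguments cond_exp {R A B} iota E.
Arguments states {R} A.

(* Main.v *)
Require Import Defs.
From HB Require Import structures.
From mathcomp Require Import all_boot all_order all_algebra.
From mathcomp Require Import complex.
From mathcomp Require Import all_classical all_reals all_analysis.
From mathcomp Require Import ring lra.

Set Implicit Arguments.
Unset Strict Implicit.
Unset Printing Implicit Defensive.

Import Order.TTheory GRing.Theory Num.Theory.
Import numFieldNormedType.Exports.

Import Defs.
Import ComplexField.Normc.

Local Open Scope classical_set_scope.
Local Open Scope ring_scope.

(* The conditional expectations extend to contractive projections [P_m] of [A] onto
   the stages, with [P_m \o P_n = P_m] for [m <= n]. The restriction to the [n]-th
   stage of [L a = sup_m cnorm (a - P_m a) / beta m] is [L_beta beta E n], since the
   terms with [m >= n] vanish there, and [L] is also the limit Lip-norm: the sequence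
   [(P_n a)_n] is a lift of [a] of seminorm at most [L a], while a lift
   [(x_n)_n] satisfies [cnorm (x_n - P_m x_n) <= S0 * beta m], and [x_n] tends to [a].
   A supremum of continuous seminorms is lower semicontinuous, and it metrizes the
   weak* topology as soon as its unit ball is totally bounded modulo scalars; for [L]
   this holds because [P_n a] lies in a finite-dimensional ball within [beta n] of [a].
   The direct sum of the [n]-th stage and [A], with the maximum of the two seminorms
   and of [cnorm (a - b) / beta n], is a tunnel of extent at most [beta n].

   The last three claims do not need conditional expectations: the distances to the
   stages satisfy the (2,0)-quasi-Leibniz inequality, because best approximations of
   [a] have norm at most [2 * cnorm a], and dividing them by fast decaying weights
   makes the bridges as short as desired. *)

(** * C*-algebras and states *)

(** The C*-axioms enter the analysis mainly through one device: if [a] is selfadjoint and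
    [cnorm a < 1], then [1 - a] is the square of a selfadjoint element. It bounds states on
    selfadjoint elements and makes star homomorphisms contractive, without spectral theory.
    Contractivity matters because the limit Lip-norm is given through an arbitrary model of the
    quotient: identifying its quotient map with the limit of a sequence needs a continuous
    isomorphism. The maps [P_m] are not multiplicative, and their positivity is visible only on
    [star x * x] with [x] in a stage, where they are finite compositions; states carried along them
    become positive by density. Such a state of [A] is also what keeps the propinquity nonnegative:
    with no states, the Hausdorff distances would be suprema of empty sets, equal to -oo. The
    constant 2 of the Leibniz rule comes from a product formula in which [a - P_m a] occurs twice
    and [b - P_m b] once. *)

Section CStarBasics.
Variables (R : realType) (A : cstarType R).
Implicit Types (a b c x y : A) (r : R).

Lemma normc_real r : normc r%:C%C = `|r|.
Proof. by rewrite /= expr0n /= addr0 sqrtr_sqr. Qed.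

Lemma cnorm0 : cnorm (0 : A) = 0.
Proof. by rewrite -(scale0r (0 : A)) cnormZ normc0 mul0r. Qed.

Lemma cnormN a : cnorm (- a) = cnorm a.
Proof. by rewrite -scaleN1r cnormZ normcN normc1 mul1r. Qed.

Lemma cnormZr r a : cnorm (r%:C%C *: a) = `|r| * cnorm a.
Proof. by rewrite cnormZ normc_real. Qed.

Lemma cnorm_ge0 a : 0 <= cnorm a.
Proof.
have := cnormD a (- a); rewrite subrr cnorm0 cnormN; lra.
Qed.
Hint Resolve cnorm_ge0 : core.

Lemma cnormB a b : cnorm (a - b) <= cnorm a + cnorm b.
Proof. by rewrite -(cnormN b) cnormD. Qed.

Lemma cnorm_distC a b : cnorm (a - b) = cnorm (b - a).
Proof. by rewrite -cnormN opprB. Qed.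

Lemma cnorm_dist_trans b a c : cnorm (a - c) <= cnorm (a - b) + cnorm (b - c).
Proof. by rewrite -[a - c](subrKA b) cnormD. Qed.

Lemma cnorm_split a b : cnorm a <= cnorm (a - b) + cnorm b.
Proof. by rewrite -{1}(subrK b a) cnormD. Qed.

Lemma star0 : star (0 : A) = 0.
Proof. by apply: (addrI (star 0)); rewrite -starD !addr0. Qed.

Lemma starN a : star (- a) = - star a.
Proof. by apply/eqP; rewrite -addr_eq0 -starD addNr star0. Qed.

Lemma starB a b : star (a - b) = star a - star b.
Proof. by rewrite starD starN. Qed.

Lemma star1 : star (1 : A) = 1.
Proof. by rewrite -[LHS]mulr1 -{2}(starK 1) -starM mulr1 starK. Qed.

Lemma starZr r a : star (r%:C%C *: a) = r%:C%C *: star a.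
Proof. by rewrite starZ conjc_real. Qed.

Lemma cnorm1 : cnorm (1 : A) = 1.
Proof.
have := cnorm_star (1 : A); rewrite star1 mulr1 => n1.
have n0 : cnorm (1 : A) != 0.
  by apply/eqP => /cnorm0_eq0/eqP; rewrite oner_eq0.
by apply: (mulIf n0); rewrite mul1r -expr2 -n1.
Qed.

Lemma cnorm_starE a : cnorm (star a) = cnorm a.
Proof.
suff le b : cnorm b <= cnorm (star b).
  by apply/eqP; rewrite eq_le le andbT -{2}(starK a) le.
have [->|b0] := eqVneq b 0; first by rewrite star0.
have nb : 0 < cnorm b.
  by rewrite lt_neqAle cnorm_ge0 andbT eq_sym; apply: contra_neq b0; exact: cnorm0_eq0.
by rewrite -(ler_pM2r nb) -expr2 -cnorm_star cnormM.
Qed.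

Lemma cnorm_le0 a : (forall e, 0 < e -> cnorm a <= e) -> a = 0.
Proof.
move=> ae; apply: cnorm0_eq0; apply/eqP; rewrite eq_le cnorm_ge0 andbT.
by apply/ler_addgt0Pr => e e0; rewrite add0r ae.
Qed.

(** The free factor [K] lets an approximation argument end with whatever multiple of [e] it has
    accumulated. *)
Lemma eq_cnorm_le a b K : 0 <= K ->
  (forall e, 0 < e -> cnorm (a - b) <= K * e) -> a = b.
Proof.
move=> K0 abe; apply/eqP; rewrite -subr_eq0; apply/eqP/cnorm_le0 => e e0.
have K1 : 0 < K + 1 by lra.
apply: (le_trans (abe (e / (K + 1)) (divr_gt0 e0 K1))).
by rewrite mulrCA ger_pMr // ler_pdivrMr //; lra.
Qed.

Lemma saD a b : sa a -> sa b -> sa (a + b).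
Proof. by rewrite /sa/= => ha hb; rewrite starD ha hb. Qed.

Lemma saN a : sa a -> sa (- a).
Proof. by rewrite /sa/= => ha; rewrite starN ha. Qed.

Lemma saB a b : sa a -> sa b -> sa (a - b).
Proof. by move=> ha hb; exact/saD/saN. Qed.

Lemma saZ r a : sa a -> sa (r%:C%C *: a).
Proof. by rewrite /sa/= => ha; rewrite starZr ha. Qed.

Lemma sa1 : sa (1 : A). Proof. exact: star1. Qed.
Lemma sa0 : sa (0 : A). Proof. exact: star0. Qed.

Lemma sa_scalar r : sa (r%:C%C *: 1 : A). Proof. exact/saZ/sa1. Qed.

Lemma sa_starM a : sa (star a * a).
Proof. by rewrite /sa/= starM starK. Qed.

Lemma half_add a : (2^-1 : R)%:C%C *: (a + a) = a.
Proof.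
by rewrite scalerDr -scalerDl -rmorphD /= (_ : 2^-1 + 2^-1 = 1 :> R) ?scale1r //; lra.
Qed.

Definition re_part a : A := (2^-1 : R)%:C%C *: (a + star a).

Lemma sa_re_part a : sa (re_part a).
Proof. by rewrite /re_part; apply: saZ; rewrite /sa/= starD starK addrC. Qed.

Lemma re_part_sa a : sa a -> re_part a = a.
Proof. by rewrite /sa/= /re_part => ->; rewrite half_add. Qed.

Lemma re_partB a b : re_part (a - b) = re_part a - re_part b.
Proof. by rewrite /re_part starB addrACA -opprD scalerBr. Qed.

Lemma cnorm_re_part a : cnorm (re_part a) <= cnorm a.
Proof.
rewrite /re_part cnormZr ger0_norm ?invr_ge0 // ler_pdivrMl //.
by apply: (le_trans (cnormD _ _)); rewrite cnorm_starE; lra.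
Qed.

Lemma re_part_dist a b : sa a -> cnorm (a - re_part b) <= cnorm (a - b).
Proof. by move=> ha; rewrite -{1}(re_part_sa ha) -re_partB cnorm_re_part. Qed.

Lemma re_part_scalar (z : R[i]) : re_part (z *: 1) = (complex.Re z)%:C%C *: 1.
Proof.
rewrite /re_part starZ star1 -scalerDl scalerA; congr (_ *: _).
case: z => u v; apply/eqP; rewrite eq_complex /=; apply/andP; split; apply/eqP; lra.
Qed.

Lemma sa_mul a b : sa a -> sa b -> a * b = b * a -> sa (a * b).
Proof. by rewrite /sa/= => ha hb ab; rewrite starM ha hb. Qed.

Lemma cnorm_sq a : sa a -> cnorm (a * a) = cnorm a ^+ 2.
Proof. by move=> ha; rewrite -cnorm_star ha. Qed.

Lemma sa_lim (u : nat -> A) l : (forall n, sa (u n)) ->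
  (forall e : R, 0 < e -> exists N, forall n, (N <= n)%N -> cnorm (u n - l) < e) ->
  sa l.
Proof.
move=> hu ul; apply: (@eq_cnorm_le _ _ 2) => // e e0.
have [N /(_ N (leqnn _)) uN] := ul _ e0.
rewrite (_ : star l - l = - star (u N - l) + (u N - l)); last first.
  by rewrite starB hu opprB addrA subrK.
apply: (le_trans (cnormD _ _)); rewrite cnormN cnorm_starE; lra.
Qed.

End CStarBasics.
(* [Hint Resolve cnorm_ge0] misses the goals whose order comes from another
   structure of [R]. *)
#[export] Hint Extern 0 (is_true (@Order.le _ _ _ (cnorm _))) => solve [apply: cnorm_ge0] : core.

(** * Square roots of elements close to 1 *)

Section SquareRoot.
Variables (R : realType) (A : cstarType R).
Implicit Types (a x y : A).

(* The fixed points of [x |-> (a + x * x) / 2] are the solutions of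
   [(1 - x) * (1 - x) = 1 - a]. *)
Fixpoint sqrt_iter a (n : nat) : A :=
  if n is n'.+1 then (2^-1 : R)%:C%C *: (a + sqrt_iter a n' * sqrt_iter a n') else 0.

(** The map iterated by [sqrt_iter] preserves a ball of radius [r < 1] and contracts it by the
    factor [r], so the iterates converge to a fixed point [l], and [s = 1 - l]. Each iterate is a
    polynomial in [a]; the last clause passes its commutation properties to the limit. *)
Lemma sqrt_one_sub a : sa a -> cnorm a < 1 ->
  exists s, [/\ sa s, s * s = 1 - a & forall c : A, c * a = a * c -> c * s = s * c].
Proof.
(* The inequality [cnorm a + r * r <= 2 * r] makes the ball of radius [r] stable; the midpoint
   between [cnorm a] and 1 satisfies it and stays below 1. *)
move=> ha na; set r := (1 + cnorm a) / 2.
have a0 := cnorm_ge0 a.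
have r0 : 0 < r by rewrite /r; lra.
have r1 : r < 1 by rewrite /r; lra.
have rr : cnorm a + r * r <= 2 * r.
  rewrite /r; have : 0 <= (1 - cnorm a) * (1 + cnorm a) by rewrite mulr_ge0 //; lra.
  by move=> h; nra.
clearbody r; pose u := sqrt_iter a.
have uS n : u n.+1 = (2^-1 : R)%:C%C *: (a + u n * u n) by [].
have ur n : cnorm (u n) <= r.
  elim: n => [|n IH]; first by rewrite cnorm0 ltW.
  rewrite uS cnormZr ger0_norm ?invr_ge0 // ler_pdivrMl //.
  apply: (le_trans (cnormD _ _)).
  have : cnorm (u n * u n) <= r * r by apply: (le_trans (cnormM _ _)); exact: ler_pM.
  lra.
have uk n k : cnorm (u (n + k)%N - u n) <= r ^+ n * r.
  elim: n => [|n IH]; first by rewrite add0n subr0 expr0 mul1r.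
  rewrite addSn !uS -scalerBr opprD addrACA subrr add0r.
  rewrite cnormZr ger0_norm ?invr_ge0 // ler_pdivrMl //.
  set x := u (n + k)%N in IH *; set y := u n in IH *.
  rewrite (_ : x * x - y * y = x * (x - y) + (x - y) * y); last first.
    by rewrite mulrBr mulrBl addrA subrK.
  have xr : cnorm x <= r by exact: ur.
  have yr : cnorm y <= r by exact: ur.
  have h1 : cnorm (x * (x - y)) <= r * (r ^+ n * r).
    by apply: (le_trans (cnormM _ _)); exact: ler_pM.
  have h2 : cnorm ((x - y) * y) <= r * (r ^+ n * r).
    by apply: (le_trans (cnormM _ _)); rewrite mulrC; exact: ler_pM.
  apply: (le_trans (cnormD _ _)); rewrite exprS; lra.
have rn e : 0 < e -> exists N, forall n, (N <= n)%N -> r ^+ n < e.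
  move=> e0.
  have nr : `|r| < 1 by rewrite ger0_norm // ltW.
  have /cvgrPdist_lt/(_ _ e0)[N _ NP] := cvg_expr nr.
  exists N => n /NP /=; rewrite sub0r normrN ger0_norm //.
  by rewrite exprn_ge0 // ltW.
have uc n m N : (N <= n)%N -> (N <= m)%N -> cnorm (u n - u m) <= 2 * r ^+ N.
  move=> /subnKC <- /subnKC <-; apply: (le_trans (cnorm_dist_trans (u N) _ _)).
  rewrite (cnorm_distC (u N)).
  have := uk N (n - N)%N; have := uk N (m - N)%N.
  have : 0 <= r ^+ N by rewrite exprn_ge0 // ltW.
  nra.
have [l ul] : exists l, forall e : R, 0 < e -> exists N, forall n, (N <= n)%N ->
    cnorm (u n - l) < e.
  apply: cnorm_complete => e e0.
  have e2 : 0 < e / 2 by lra.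
  have [N rN] := rn _ e2.
  exists N => m n Nm Nn; apply: le_lt_trans (uc _ _ _ Nm Nn) _.
  by have := rN _ (leqnn N); lra.
have sau n : sa (u n).
  elim: n => [|n IH]; first exact: sa0.
  by rewrite uS; apply/saZ/saD => //; exact: sa_mul.
have sal : sa l := sa_lim sau ul.
have nl : cnorm l <= 1.
  apply/ler_addgt0Pr => e e0.
  have [N /(_ _ (leqnn N)) uN] := ul _ e0.
  have := cnorm_split l (u N); rewrite cnorm_distC.
  have := ur N; lra.
have leq : l = (2^-1 : R)%:C%C *: (a + l * l).
  apply: (@eq_cnorm_le _ _ _ _ 2) => // e e0.
  have [N uN] := ul _ e0.
  have h1 := uN _ (leqnn N); have h2 := uN _ (leqnSn N).
  apply: (le_trans (cnorm_dist_trans (u N.+1) _ _)).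
  rewrite uS -scalerBr opprD addrACA subrr add0r cnormZr ger0_norm ?invr_ge0 // -uS.
  set x := u N.
  rewrite (_ : x * x - l * l = x * (x - l) + (x - l) * l); last first.
    by rewrite mulrBr mulrBl addrA subrK.
  have := cnormD (x * (x - l)) ((x - l) * l).
  have := cnormM x (x - l); have := cnormM (x - l) l.
  have := cnorm_ge0 (x - l); have := ur N; rewrite -/x => xr.
  rewrite (cnorm_distC l).
  have : cnorm x <= 1 by lra.
  rewrite -/x in h1.
  have := cnorm_ge0 x; have := cnorm_ge0 l; nra.
exists (1 - l); split.
- exact/saB/sal/sa1.
- rewrite mulrBl mul1r mulrBr mulr1 opprB addrA.
  have -> : l * l = l + l - a.
    rewrite {3 4}leq -scalerDr half_add addrC addKr //.
  by rewrite addrA addrAC addrA subrK addrK.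
- move=> c ca; rewrite mulrBr mulrBl mulr1 mul1r; congr (_ - _).
  have cu n : c * u n = u n * c.
    elim: n => [|n IH]; first by rewrite mulr0 mul0r.
    rewrite uS -scalerAr -scalerAl mulrDr mulrDl ca; congr (_ *: (_ + _)).
    by rewrite mulrA IH -mulrA IH mulrA.
  apply: (@eq_cnorm_le _ _ _ _ (2 * cnorm c)); first by rewrite mulr_ge0.
  move=> e e0; have [N /(_ _ (leqnn N)) uN] := ul _ e0.
  rewrite (_ : c * l - l * c = c * (l - u N) + (u N - l) * c); last first.
    by rewrite mulrBr mulrBl cu addrA subrK.
  apply: (le_trans (cnormD _ _)).
  have := cnormM c (l - u N); have := cnormM (u N - l) c; rewrite (cnorm_distC l).
  have := cnorm_ge0 c; nra.
Qed.

End SquareRoot.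

Lemma mulii (R : realType) : 'i%C * 'i%C = -1 :> R[i].
Proof. by rewrite -expr2 sqr_i. Qed.

(** * Contractivity of star homomorphisms *)

Section StarHom.
Variables (R : realType) (A B : cstarType R) (f : A -> B).
Hypothesis hf : star_hom f.

Lemma star_homB a b : f (a - b) = f a - f b.
Proof. by rewrite -[a - b]addrC -scaleN1r (star_hom_linear hf) scaleN1r addrC. Qed.

Lemma star_hom0 : f 0 = 0.
Proof. by rewrite -(subrr (0 : A)) star_homB subrr. Qed.

Lemma star_homZ c a : f (c *: a) = c *: f a.
Proof. by rewrite -[c *: a]addr0 (star_hom_linear hf) star_hom0 addr0. Qed.

Lemma star_hom_sa a : sa a -> sa (f a).
Proof. by rewrite /sa/= => ha; rewrite -(star_hom_star hf) ha. Qed.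

(* If [cnorm a < 1] and [s * s = 1 - a * a] with [s] commuting with [a], then
   [f a + 'i f s] is unitary and [f a] is its real part. *)
Lemma star_hom_sa_contractive a : sa a -> cnorm (f a) <= cnorm a.
Proof.
have lt1 x : sa x -> cnorm x < 1 -> cnorm (f x) <= 1.
  move=> hx nx; have x0 := cnorm_ge0 x.
  have nxx : cnorm (x * x) < 1 by rewrite (cnorm_sq hx); nra.
  have [s [hs ss sc]] := sqrt_one_sub (sa_mul hx hx erefl) nxx.
  have xs : x * s = s * x by apply: sc; rewrite mulrA.
  have hfx : star (f x) = f x := star_hom_sa hx.
  have hfs : star (f s) = f s := star_hom_sa hs.
  pose u : B := f x + 'i%C *: f s.
  have su : star u = f x - 'i%C *: f s.
    rewrite /u starD starZ hfx hfs -scaleNr; congr (_ + _ *: _).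
    by apply/eqP; rewrite eq_complex /= oppr0 !eqxx.
  have uu : star u * u = 1.
    rewrite su /u mulrBl !mulrDr -!scalerAl -!scalerAr -!(star_homM hf) xs.
    rewrite scalerA mulii scaleN1r ss star_homB (star_hom1 hf) opprD opprK.
    by rewrite addrA addrK addrC subrK.
  have nu : cnorm u = 1.
    have := cnorm_star u; rewrite uu cnorm1 => /esym/eqP.
    by rewrite sqrf_eq1 => /orP[/eqP//|/eqP h]; have := cnorm_ge0 u; lra.
  have -> : f x = re_part u by rewrite /re_part su /u addrACA subrr addr0 half_add.
  by rewrite -nu cnorm_re_part.
move=> ha; apply/ler_addgt0Pr => e e0.
have t0 : 0 < cnorm a + e by have := cnorm_ge0 a; lra.
set t := cnorm a + e in t0 *.
have nt : `|t^-1| = t^-1 by rewrite ger0_norm // invr_ge0 ltW.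
have tN : cnorm ((t^-1)%:C%C *: a) < 1.
  by rewrite cnormZr nt ltr_pdivrMl // mulr1 /t; lra.
have := lt1 _ (saZ t^-1 ha) tN.
by rewrite star_homZ cnormZr nt ler_pdivrMl // mulr1.
Qed.

(** The C*-identity turns the claim into the selfadjoint case for [star a * a]. *)
Lemma star_hom_contractive a : cnorm (f a) <= cnorm a.
Proof.
rewrite -(ler_pXn2r (n := 2)) ?nnegrE // -!cnorm_star -(star_hom_star hf).
by rewrite -(star_homM hf) star_hom_sa_contractive //; exact: sa_starM.
Qed.

End StarHom.

(** * Norm bounds for states *)

Section States.
Variables (R : realType) (A : cstarType R).
Implicit Types (a b : A) (phi psi : states A).

Definition st phi : A -> R[i] := \val phi.

Lemma stP phi : [/\ scalar (st phi), forall a : A, (0 : R[i]) <= st phi (star a * a)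
  & st phi 1 = (1 : R[i])].
Proof. exact: set_mem (valP phi). Qed.

Definition state_of (f : A -> R[i]) (fl : scalar f)
  (fp : forall a : A, (0 : R[i]) <= f (star a * a)) (f1 : f 1 = 1) : states A :=
  exist _ (f : {ptws A -> R[i]^o}) (mem_set (And3 fl fp f1)).

Lemma st_lin phi c a b : st phi (c *: a + b) = c * st phi a + st phi b.
Proof. by have [-> _ _] := stP phi. Qed.

Lemma st1 phi : st phi 1 = 1. Proof. by have [_ _ ->] := stP phi. Qed.

Lemma st_pos phi a : 0 <= st phi (star a * a). Proof. by have [_ + _] := stP phi. Qed.

Lemma stB phi a b : st phi (a - b) = st phi a - st phi b.
Proof. by rewrite -[a - b]addrC -scaleN1r st_lin mulN1r addrC. Qed.

Lemma st0 phi : st phi 0 = 0.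
Proof. by rewrite -(subrr (0 : A)) stB subrr. Qed.

Lemma stD phi a b : st phi (a + b) = st phi a + st phi b.
Proof. by rewrite -[a]scale1r st_lin mul1r scale1r. Qed.

Lemma stZ phi c a : st phi (c *: a) = c * st phi a.
Proof. by rewrite -[c *: a]addr0 st_lin st0 addr0. Qed.

(** For selfadjoint [x] of norm below 1 the square root writes [1 - x] as [star s * s], so
    positivity gives [st phi x <= 1]. This is applied to [a / t] and [- a / t] with [t] slightly
    above [cnorm a]. The order of [R[i]] compares only numbers with equal imaginary parts, so the
    same inequality shows that [st phi a] is real. *)
Lemma st_sa_bound phi a : sa a -> normc (st phi a) <= cnorm a.
Proof.
have lt1 x : sa x -> cnorm x < 1 -> st phi x <= 1.
  move=> hx nx; have [s [hs ss _]] := sqrt_one_sub hx nx.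
  have := st_pos phi s; rewrite hs ss stB st1 subr_ge0 //.
move=> ha; apply/ler_addgt0Pr => e e0.
have t0 : 0 < cnorm a + e by have := cnorm_ge0 a; lra.
set t := cnorm a + e in t0 *.
have tN : cnorm ((t^-1)%:C%C *: a) < 1.
  by rewrite cnormZr ger0_norm ?invr_ge0 ?ltW // ltr_pdivrMl // mulr1 /t; lra.
have h1 := lt1 _ (saZ t^-1 ha) tN.
have h2 := lt1 _ (saN (saZ t^-1 ha)) (ltac:(by rewrite cnormN)).
move: h1 h2; rewrite -sub0r stB st0 sub0r stZ.
case: (st phi a) => u v; rewrite !lecE /= !(mul0r, subr0, addr0, oppr0).
move=> /andP[/eqP v0 u1] /andP[_ u2].
have {}v0 : v = 0.
  by apply: (mulfI (lt0r_neq0 (_ : 0 < t^-1))); rewrite ?invr_gt0 // -v0 mulr0.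
rewrite v0 expr0n /= addr0 sqrtr_sqr ler_norml; apply/andP; split.
  by move: u2; rewrite -mulrN ler_pdivrMl // mulr1; lra.
by move: u1; rewrite ler_pdivrMl // mulr1.
Qed.

Lemma re_part_decomp a : a = re_part a + 'i%C *: re_part (- 'i%C *: a).
Proof.
have -> : 'i%C *: re_part (- 'i%C *: a) = (2^-1 : R)%:C%C *: (a - star a).
  rewrite /re_part scalerA mulrC -scalerA scalerDr starZ !scalerA.
  have -> : (- 'i)^*%C = 'i%C :> R[i].
    by apply/eqP; rewrite eq_complex /= oppr0 opprK !eqxx.
  by rewrite mulrN mulii opprK scale1r scaleN1r.
by rewrite /re_part -scalerDr addrACA subrr addr0 half_add.
Qed.

Lemma normc_i : normc ('i%C : R[i]) = 1 :> R.
Proof. by rewrite /= expr0n /= add0r expr1n sqrtr1. Qed.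

Lemma normc_Ni : normc (- 'i%C : R[i]) = 1 :> R.
Proof. by rewrite /= oppr0 expr0n /= add0r sqrrN expr1n sqrtr1. Qed.

(** Splitting into real and imaginary parts costs the factor 2; every use below tolerates a fixed
    multiple of the norm. *)
Lemma st_bound phi a : normc (st phi a) <= 2 * cnorm a.
Proof.
rewrite {1}(re_part_decomp a) stD (stZ phi 'i%C); apply: (le_trans (le_normcD _ _)).
rewrite normcM normc_i mul1r.
have := st_sa_bound phi (sa_re_part a); have := cnorm_re_part a.
have := st_sa_bound phi (sa_re_part (- 'i%C *: a)); have := cnorm_re_part (- 'i%C *: a).
rewrite (cnormZ (- 'i%C)) normc_Ni mul1r; lra.
Qed.

Lemma st_scalar phi (z : R[i]) : st phi (z *: 1) = z.
Proof. by rewrite stZ st1 mulr1. Qed.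

Lemma states_eq phi psi : (forall a, st phi a = st psi a) -> phi = psi.
Proof. by move=> h; apply: val_inj; apply/funext => a; exact: h. Qed.

Lemma st_diff_bound phi psi a b : normc (st phi a - st psi a) <=
  normc (st phi b - st psi b) + 4 * cnorm (a - b).
Proof.
rewrite (_ : st phi a - st psi a =
  (st phi b - st psi b) + (st phi (a - b) - st psi (a - b))); last first.
  by rewrite !stB opprB; ring.
apply: (le_trans (le_normcD _ _)); rewrite lerD2l.
apply: (le_trans (le_normcD _ _)); rewrite normcN.
have := st_bound phi (a - b); have := st_bound psi (a - b); lra.
Qed.

End States.

Section PullState.
Variables (R : realType) (A B : cstarType R) (f : B -> A).
Hypothesis hf : star_hom f.
Variable phi : states A.

Let fl : scalar (fun b => st phi (f b)).
Proof. by move=> c a b /=; rewrite (star_hom_linear hf) st_lin. Qed.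
Let fp (b : B) : 0 <= st phi (f (star b * b)).
Proof. by rewrite (star_homM hf) (star_hom_star hf) st_pos. Qed.
Let f1 : st phi (f 1) = 1.
Proof. by rewrite (star_hom1 hf) st1. Qed.

Definition pull_state : states B := state_of fl fp f1.

End PullState.

(** * Total boundedness *)

Section TotallyBounded.
Variables (R : realType) (A : cstarType R).
Implicit Types (a b x y : A) (r M : R) (S T : set A).

(** The points of the net [F] may lie outside [S], so the property passes to subsets at once. *)
Definition totally_bounded S := forall e : R, 0 < e ->
  exists F : seq A, forall a, S a -> exists2 f, f \in F & cnorm (a - f) <= e.

Lemma tb_sub S T : S `<=` T -> totally_bounded T -> totally_bounded S.
Proof.
by move=> ST tT e /tT[F hF]; exists F => a /ST; exact: hF.
Qed.

Lemma tb_near S : (forall e, 0 < e -> exists2 T, totally_bounded T &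
   forall a, S a -> exists2 b, T b & cnorm (a - b) <= e) -> totally_bounded S.
Proof.
move=> h e e0; have e2 : 0 < e / 2 by lra.
have [T tT ST] := h _ e2; have [F hF] := tT _ e2.
exists F => a /ST[b /hF[f fF bf] ab]; exists f => //.
by apply: (le_trans (cnorm_dist_trans b _ _)); lra.
Qed.

Lemma tb_add S T : totally_bounded S -> totally_bounded T ->
  totally_bounded [set x | exists2 a, S a & exists2 b, T b & x = a + b].
Proof.
move=> tS tT e e0; have e2 : 0 < e / 2 by lra.
have [F hF] := tS _ e2; have [G hG] := tT _ e2.
exists [seq f + g | f <- F, g <- G] => x [a /hF[f fF af] [b /hG[g gG bg] ->]].
exists (f + g); first by apply/allpairsP; exists (f, g).
by rewrite opprD addrACA; apply: (le_trans (cnormD _ _)); lra.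
Qed.

Lemma tb_line x M : totally_bounded [set (r%:C%C *: x) | r in [set r : R | `|r| <= M]].
Proof.
move=> e e0; have n0 := cnorm_ge0 x.
(* The step of a grid on the interval from [- M] to [M]; the added 1 guards against [x = 0]. *)
set d := e / (cnorm x + 1); have d0 : 0 < d by rewrite divr_gt0 //; lra.
exists [seq ((i%:R * d - M)%:C%C *: x) | i <- iota 0 (Num.truncn (2 * M / d)).+1].
move=> _ [r /= rM <-]; move: rM; rewrite ler_norml => /andP[Mr rM].
have p0 : 0 <= (r + M) / d by apply: divr_ge0; [lra|exact: ltW].
set i := Num.truncn ((r + M) / d).
exists ((i%:R * d - M)%:C%C *: x).
  rewrite -[X in _ \in X]/(map (fun i => (i%:R * d - M)%:C%C *: x) (iota 0 _.+1)).
  apply/mapP; exists i => //; rewrite mem_iota /= add0n ltnS.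
  by apply: le_truncn; rewrite ler_pM2r ?invr_gt0 //; lra.
have /andP[i1 i2] := truncn_itv p0; rewrite -/i in i1 i2.
rewrite -scalerBl -rmorphB /= cnormZr.
rewrite ler_pdivlMr // in i1; rewrite ltr_pdivrMr // -natr1 mulrDl mul1r in i2.
have dr : `|r - (i%:R * d - M)| <= d.
  by rewrite ler_norml; apply/andP; split; lra.
apply: (le_trans (ler_wpM2r n0 dr)).
by rewrite /d mulrAC ler_pdivrMr; [apply: ler_wpM2l; lra|lra].
Qed.

(** The real span, by recursion on the generators: some multiple of the head leaves a remainder in
    the span of the tail. This is the shape used by the induction in [tb_rspan]. *)
Fixpoint rspan (s : seq A) : set A :=
  if s is e :: s' then [set x | exists r : R, rspan s' (x - r%:C%C *: e)]
  else [set 0].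

Lemma rspanZ s r x : rspan s x -> rspan s (r%:C%C *: x).
Proof.
elim: s x => [|e s IH] x /=; first by move=> ->; rewrite scaler0.
move=> [t /IH h]; exists (r * t); move: h.
by rewrite scalerBr scalerA -rmorphM.
Qed.

Lemma rspanD s x y : rspan s x -> rspan s y -> rspan s (x + y).
Proof.
elim: s x y => [|e s IH] x y /=; first by move=> -> ->; rewrite addr0.
move=> [t h] [u k]; exists (t + u); have := IH _ _ h k.
by rewrite rmorphD /= scalerDl opprD addrACA.
Qed.

Lemma rspan0 s : rspan s 0.
Proof. by elim: s => [//|e s IH] /=; exists 0; rewrite scale0r subr0. Qed.

Lemma rspan_mem s x : x \in s -> rspan s x.
Proof.
elim: s => [//|e s IH]; rewrite inE => /orP[/eqP ->|/IH h] /=.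
  by exists 1; rewrite rmorph1 scale1r subrr; exact: rspan0.
by exists 0; rewrite scale0r subr0.
Qed.

(* By induction: a new generator [e] is either in the closure of the previous
   span, or at a positive distance from it, which bounds its coefficients. *)
Lemma tb_rspan s M : totally_bounded [set x | rspan s x /\ cnorm x <= M].
Proof.
elim: s M => [|e s IH] M.
  move=> r r0; exists [:: 0] => a /= [-> _]; exists 0; first by rewrite inE.
  by rewrite subrr cnorm0 ltW.
have [[d d0 ed]|hd] := pselect (exists2 d : R, 0 < d & forall w, rspan s w -> d <= cnorm (e - w)).
  have n0 := cnorm_ge0 e.
  apply: (tb_sub _ (tb_add (tb_line e (M / d)) (IH (M + M / d * cnorm e)))).
  move=> x /= [[r hr] xM].
  have rM : `|r| <= M / d.
    rewrite ler_pdivlMr //; apply: le_trans xM.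
    have [->|r0] := eqVneq r 0; first by rewrite normr0 mul0r.
    have := ed _ (rspanZ (- r^-1) hr).
    move=> /(ler_wpM2l (normr_ge0 r)) /le_trans; apply.
    rewrite -cnormZr scalerBr scalerA rmorphN mulrN -rmorphM divff // rmorph1.
    by rewrite scaleN1r opprK addrC subrK.
  exists (r%:C%C *: e); first by exists r.
  exists (x - r%:C%C *: e); last by rewrite addrC subrK.
  split=> //; apply: (le_trans (cnormB _ _)); rewrite cnormZr lerD //.
  exact: ler_wpM2r.
have close q : 0 < q -> exists2 w, rspan s w & cnorm (e - w) < q.
  move=> q0; apply: contrapT => h; apply: hd; exists q => // w hw.
  by rewrite leNgt; apply/negP => h'; apply: h; exists w.
(* Here [e] is a limit of elements of the previous span, but the coefficient [r] of [x] is not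
   bounded; the approximant [w] of [e] is therefore chosen after [r], at a distance that absorbs
   it. *)
apply: tb_near => q q0.
exists [set x | rspan s x /\ cnorm x <= M + q]; first exact: IH.
move=> x /= [[r hr] xM].
have r1 : 0 < `|r| + 1 by rewrite ltr_wpDl.
have [w hw ew] := close (q / (`|r| + 1)) (divr_gt0 q0 r1).
have xw : cnorm (x - (x - r%:C%C *: e + r%:C%C *: w)) <= q.
  have -> : x - (x - r%:C%C *: e + r%:C%C *: w) = r%:C%C *: (e - w).
    by rewrite scalerBr opprD opprB addrA addrCA subrr addr0.
  rewrite cnormZr; apply: (le_trans (ler_wpM2l (normr_ge0 r) (ltW ew))).
  rewrite mulrCA ger_pMr // ler_pdivrMr //; lra.
exists (x - r%:C%C *: e + r%:C%C *: w) => //; split; first exact/rspanD/rspanZ.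
have := cnorm_split (x - r%:C%C *: e + r%:C%C *: w) x; rewrite (cnorm_distC _ x); lra.
Qed.

(** Real coefficients require twice as many generators: a complex basis and its multiples by
    ['i%C]. *)
Lemma has_dim_rspan d : has_dim A d -> exists s, forall x, rspan s x.
Proof.
move=> [f fl [g fK gK]].
have gl : linear g.
  by move=> c u v; apply: (can_inj fK); rewrite gK fl !gK.
have gD u v : g (u + v) = g u + g v by rewrite -[u]scale1r gl !scale1r.
have g0 : g 0 = 0 by apply: (addrI (g 0)); rewrite -gD !addr0.
have gZ c u : g (c *: u) = c *: g u by rewrite -[c *: u]addr0 gl g0 addr0.
pose s := [seq g (delta_mx 0 i) | i <- enum 'I_d] ++ [seq 'i%C *: g (delta_mx 0 i) | i <- enum 'I_d].
exists s => x; rewrite -(fK x) (row_sum_delta (f x)).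
elim/big_rec: _ => [|i y _ hy]; first by rewrite g0; exact: rspan0.
rewrite gD; apply: rspanD => //; rewrite gZ.
rewrite (complexE (f x 0 i)) scalerDl mulrC -scalerA; apply: rspanD; apply: rspanZ;
  apply: rspan_mem; rewrite mem_cat; apply/orP; [left|right].
- by apply: map_f; rewrite mem_enum.
- by apply: (map_f (fun i => 'i%C *: g (delta_mx 0 i))); rewrite mem_enum.
Qed.

Lemma tb_ball d M : has_dim A d -> totally_bounded [set x | cnorm x <= M].
Proof.
move=> /has_dim_rspan[s hs]; by apply: tb_sub (tb_rspan s M) => x /= xM; split.
Qed.

End TotallyBounded.

Lemma tb_map (R : realType) (A B : cstarType R) (f : A -> B) (S : set A) :
  (forall x y, cnorm (f x - f y) <= cnorm (x - y)) ->
  totally_bounded S -> totally_bounded (f @` S).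
Proof.
move=> hf tS e /tS[F hF]; exists (map f F) => _ [a /hF[b bF ab] <-].
by exists (f b); [exact: map_f|exact: le_trans (hf _ _) ab].
Qed.

(** * Lip-norms that are suprema of continuous seminorms *)

(** Homogeneity over the complex scalars handles the factor in [lie_prod]; [csn_bound] is the
    continuity from which lower semicontinuity of suprema follows. *)
Record cont_seminorm (R : realType) (A : cstarType R) (p : A -> R) : Prop := ContSeminorm {
  csn_ge0 : forall a, 0 <= p a;
  csn_scale : forall (c : R[i]) a, p (c *: a) = normc c * p a;
  csn_add : forall a b, p (a + b) <= p a + p b;
  csn_bound : exists C : R, forall a, p a <= C * cnorm a
}.

Section ContSeminorm.
Variables (R : realType) (A : cstarType R) (p : A -> R).
Hypothesis hp : cont_seminorm p.

Lemma csnN a : p (- a) = p a.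
Proof. by rewrite -scaleN1r (csn_scale hp) normcN normc1 mul1r. Qed.

Lemma csnB a b : p (a - b) <= p a + p b.
Proof. by rewrite -(csnN b) (csn_add hp). Qed.

Lemma csnZr r a : p (r%:C%C *: a) = `|r| * p a.
Proof. by rewrite (csn_scale hp) normc_real. Qed.

Lemma csn_split a b : p a <= p (a - b) + p b.
Proof. by rewrite -{1}(subrK b a) (csn_add hp). Qed.

End ContSeminorm.

Section HalfC.
Variable R : realType.

Lemma halfC : 2^-1 = (2^-1 : R)%:C%C :> R[i].
Proof. by rewrite fmorphV /= rmorph_nat. Qed.

Lemma half_iC : (2 * 'i%C)^-1 = - 'i%C * (2^-1 : R)%:C%C :> R[i].
Proof.
rewrite invfM halfC mulrC; congr (_ * _).
have i0 : 'i%C != 0 :> R[i] by rewrite eq_complex /= oner_eq0 andbF.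
by apply: (mulfI i0); rewrite divff // mulrN mulii opprK.
Qed.

End HalfC.

Section SupSeminorm.
Variables (R : realType) (A : cstarType R) (I : Type) (i0 : I) (p : I -> A -> R).
Hypothesis hp : forall i, cont_seminorm (p i).
Local Open Scope ereal_scope.

(** The index [i0] of the section excludes an empty family, whose supremum would be -oo. *)
Definition sup_lip (a : A) : \bar R := ereal_sup (range (fun i => (p i a)%:E)).

Lemma sup_lip_leP a (x : \bar R) : sup_lip a <= x <-> forall i, (p i a)%:E <= x.
Proof.
split=> [/ereal_supP h i|h]; first by apply: h; exists i.
by apply/ereal_supP => _ [i _ <-].
Qed.

Lemma sup_lip_ub i a : (p i a)%:E <= sup_lip a.
Proof. by apply: ereal_sup_ubound; exists i. Qed.

Lemma sup_lip_ge0 a : 0 <= sup_lip a.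
Proof. by apply: le_trans (sup_lip_ub i0 a); rewrite lee_fin (csn_ge0 (hp i0)). Qed.

Lemma sup_lipZ (c : R[i]) a : sup_lip (c *: a)%R = (normc c)%:E * sup_lip a.
Proof.
rewrite /sup_lip -ereal_supZl; first last.
- by case: c => u v; rewrite /= sqrtr_ge0.
- by apply/set0P; exists (p i0 a)%:E, i0.
congr ereal_sup; apply/seteqP; split=> [_ [i _ <-]|_ [_ [i _ <-] <-]].
  by exists (p i a)%:E; [exists i|rewrite (csn_scale (hp i)) EFinM].
by exists i => //; rewrite (csn_scale (hp i)) EFinM.
Qed.

Lemma sup_lipD a b : sup_lip (a + b)%R <= sup_lip a + sup_lip b.
Proof.
apply/sup_lip_leP => i; apply: (@le_trans _ _ ((p i a)%:E + (p i b)%:E)).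
  by rewrite -EFinD lee_fin (csn_add (hp i)).
by apply: leeD; exact: sup_lip_ub.
Qed.

Lemma sup_lip_seminorm : seminorm sup_lip.
Proof. split; [exact: sup_lip_ge0|exact: sup_lipZ|exact: sup_lipD]. Qed.

Lemma sup_lip_fin a (M : R) : (forall i, (p i a <= M)%R) -> sup_lip a < +oo.
Proof.
by move=> h; apply: (@le_lt_trans _ _ M%:E); [apply/sup_lip_leP|rewrite ltry].
Qed.

Lemma sup_lip_eq0 a : sup_lip a = 0 <-> forall i, p i a = 0%R.
Proof.
split=> [h i|h].
  apply/eqP; rewrite eq_le (csn_ge0 (hp i)) andbT -lee_fin -[leRHS]h.
  exact: sup_lip_ub.
by apply/eqP; rewrite eq_le sup_lip_ge0 andbT; apply/sup_lip_leP => i; rewrite h.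
Qed.

(** Up to a unimodular factor, each product is half of a sum or difference of [a * b] and [b * a],
    and the bound on [p i] is symmetric in [a] and [b], so the constant 2 survives. Selfadjointness
    of both products is checked first because [L] is tied to [sup_lip] on [sa] only. *)
Lemma sup_lip_leibniz (L : A -> \bar R) :
  (forall a, sa a -> L a = sup_lip a) ->
  (forall i a b, (p i (a * b) <= 2 * (cnorm a * p i b + cnorm b * p i a))%R) ->
  quasi_leibniz L 2 0.
Proof.
move=> hL hpl a b [ha La] [hb Lb].
have saj : sa (jordan_prod a b).
  by rewrite /sa/= /jordan_prod halfC starZr starD !starM ha hb addrC.
have sal : sa (lie_prod a b).
  rewrite /sa/= /lie_prod half_iC starZ starB !starM ha hb -opprB scalerN -scaleNr.
  congr (_ *: _).
  by apply/eqP; rewrite eq_complex /=; apply/andP; split; apply/eqP; lra.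
rewrite mul0e adde0 !hL // ge_max.
have key i : (p i (a * b) + p i (b * a) <= 2 * (2 * (cnorm a * p i b + cnorm b * p i a)))%R.
  by have := hpl i a b; have := hpl i b a; lra.
have bnd i : (2 * (cnorm a * p i b + cnorm b * p i a))%:E <=
   2%:E * ((cnorm a)%:E * sup_lip b + (cnorm b)%:E * sup_lip a).
  rewrite -[leLHS]/(2%:E * ((cnorm a)%:E * (p i b)%:E + (cnorm b)%:E * (p i a)%:E)).
  apply: lee_pmul => //.
    by rewrite adde_ge0 // mule_ge0 ?lee_fin // (csn_ge0 (hp i)).
  by apply: leeD; apply: lee_wpmul2l; rewrite ?lee_fin //; exact: sup_lip_ub.
have n2 : (normc (2^-1 : R[i]) = 2^-1 :> R)%R by rewrite halfC normc_real ger0_norm.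
have n2i : (normc ((2 * 'i%C)^-1 : R[i]) = 2^-1 :> R)%R.
  by rewrite half_iC normcM normc_Ni mul1r normc_real ger0_norm.
apply/andP; split; apply/sup_lip_leP => i; apply: le_trans (bnd i); rewrite lee_fin.
  rewrite /jordan_prod (csn_scale (hp i)) n2 ler_pdivrMl //.
  by apply: le_trans (key i); exact: (csn_add (hp i)).
rewrite /lie_prod (csn_scale (hp i)) n2i ler_pdivrMl //.
by apply: le_trans (key i); exact: (csnB (hp i)).
Qed.

End SupSeminorm.

Section MongeKantorovich.
Variables (R : realType) (A : cstarType R) (L : A -> \bar R).
Implicit Types phi psi : states A.
Local Open Scope ereal_scope.

Lemma mk_leP phi psi (x : \bar R) : mk L phi psi <= x <->
  forall a, lip_ball L a -> (normc (st phi a - st psi a)%R)%:E <= x.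
Proof.
split=> [/ereal_supP h a aL|h]; first by apply: h; exists a.
by apply/ereal_supP => _ [a aL <-]; exact: h.
Qed.

Lemma mk_ub phi psi a : lip_ball L a -> (normc (st phi a - st psi a)%R)%:E <= mk L phi psi.
Proof. by move=> aL; apply: ereal_sup_ubound; exists a. Qed.

Lemma mk_shift phi psi a (r : R) :
  (st phi a - st psi a = st phi (a - r%:C%C *: 1) - st psi (a - r%:C%C *: 1))%R.
Proof. by rewrite !stB !st_scalar opprB addrA subrK. Qed.

(** Two states differ as much on [a] as on [a] minus a scalar, and there each of them is bounded by
    [K]. *)
Lemma diam_bound (K : R) :
  (forall a, lip_ball L a -> exists r : R, (cnorm (a - r%:C%C *: 1) <= K)%R) ->
  diam L <= (2 * K)%:E.
Proof.
move=> h; apply/ereal_supP => _ [[phi psi] _ <-] /=; apply/mk_leP => a aL.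
have [r ar] := h _ aL; have [ha _] := aL.
rewrite (mk_shift _ _ _ r) lee_fin; apply: (le_trans (le_normcD _ _)); rewrite normcN.
have := st_sa_bound phi (saB ha (sa_scalar A r)).
have := st_sa_bound psi (saB ha (sa_scalar A r)); lra.
Qed.

End MongeKantorovich.

Section LipNormCriterion.
Variables (R : realType) (A : cstarType R) (I : Type) (i0 : I) (p : I -> A -> R).
Hypothesis hp : forall i, cont_seminorm (p i).
Variable L : A -> \bar R.
Hypothesis hL : forall a, sa a -> L a = sup_lip p a.
Hypothesis p1 : forall i, p i 1 = 0.
Hypothesis pdense : forall a (e : R), sa a -> 0 < e ->
  exists b, [/\ sa b, cnorm (a - b) < e & exists M : R, forall i, p i b <= M].
Hypothesis pker : forall a, sa a -> (forall i, p i a = 0) -> exists r : R, a = r%:C%C *: 1.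
Variable S : set A.
Hypothesis tbS : totally_bounded S.
Hypothesis ballS : forall a, sa a -> (forall i, p i a <= 1) ->
  exists r : R, S (a - r%:C%C *: 1).

Let ballP a : lip_ball L a <-> sa a /\ forall i, p i a <= 1.
Proof.
split=> -[ha La]; split=> //.
  move=> i; rewrite -lee_fin; apply: le_trans La; rewrite hL //; exact: sup_lip_ub.
by rewrite hL //; apply/sup_lip_leP => i; rewrite lee_fin.
Qed.

(* States differ on a Lipschitz ball as little as on a finite net of [S]. *)
Let net e : 0 < e -> exists F : seq A, forall phi psi : states A, forall a, lip_ball L a ->
  exists2 f, f \in F & normc (st phi a - st psi a) <= normc (st phi f - st psi f) + 4 * e.
Proof.
move=> e0; have [F hF] := tbS e0; exists F => phi psi a /ballP[ha /(ballS ha)[r Sa]].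
have [f fF af] := hF _ Sa; exists f => //.
rewrite (mk_shift _ _ _ r); apply: (le_trans (st_diff_bound _ _ _ f)).
by rewrite lerD2l ler_wpM2l.
Qed.

Let mk_fin phi psi : (mk L phi psi < +oo)%E.
Proof.
have [F hF] := net ltr01.
have [M FM] : exists M, forall f, f \in F -> 4 * cnorm f <= M.
  elim: (F) => [|f s [M IH]]; first by exists 0.
  exists (4 * cnorm f + `|M|) => g; rewrite inE => /orP[/eqP ->|/IH h].
    by rewrite lerDl.
  by have := cnorm_ge0 f; have := ler_norm M; lra.
apply: (@le_lt_trans _ _ (M + 4)%:E); last by rewrite ltry.
apply/mk_leP => a aL; have [f /FM fM h] := hF phi psi a aL; rewrite lee_fin.
apply: (le_trans h); rewrite mulr1 lerD2r.
apply: (le_trans (le_normcD _ _)); rewrite normcN.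
by have := st_bound phi f; have := st_bound psi f; lra.
Qed.

Let scale_ball b M : sa b -> (forall i, p i b <= M) -> 0 < M -> lip_ball L ((M^-1)%:C%C *: b).
Proof.
move=> hb bM M0; apply/ballP; split; first exact: saZ.
move=> i; rewrite (csnZr (hp i)) gtr0_norm ?invr_gt0 //.
by rewrite ler_pdivrMl // mulr1.
Qed.

Let diff_scale (phi psi : states A) b (M : R) : 0 < M ->
  normc (st phi b - st psi b) = M * normc (st phi ((M^-1)%:C%C *: b) - st psi ((M^-1)%:C%C *: b)).
Proof.
move=> M0; rewrite !stZ -mulrBr normcM normc_real gtr0_norm ?invr_gt0 //.
by rewrite mulrA divff ?mul1r // gt_eqF.
Qed.

Let mk_sep phi psi : mk L phi psi = 0%E -> phi = psi.
Proof.
move=> mk0; apply: states_eq => a.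
suff h b : sa b -> st phi b = st psi b.
  by rewrite (re_part_decomp a) (stD phi) (stD psi) (stZ phi 'i%C) (stZ psi 'i%C) !h //; exact: sa_re_part.
move=> hb; apply/eqP; rewrite -subr_eq0; apply/eqP/eq0_normc.
apply/eqP; rewrite eq_le; apply/andP; split; last by case: (_ - _) => u v; rewrite /= sqrtr_ge0.
apply/ler_addgt0Pr => e e0; rewrite add0r.
(* [st_diff_bound] multiplies the distance to [c] by 4; on [c] itself the states agree, since a
   multiple of [c] lies in the Lipschitz ball. *)
have e8 : 0 < e / 8 by lra.
have [c [hc bc [M cM]]] := pdense hb e8.
have M0 : 0 < `|M| + 1 by rewrite ltr_wpDl.
have cM' i : p i c <= `|M| + 1 by have := cM i; have := ler_norm M; lra.
have := mk_ub phi psi (scale_ball hc cM' M0); rewrite mk0 lee_fin => h.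
apply: (le_trans (st_diff_bound _ _ _ c)).
rewrite (diff_scale _ _ _ M0); nra.
Qed.

Let mkf (phi : states A) := filter_from [set e : R | 0 < e] (fun e => [set psi | (mk L phi psi < e%:E)%E]).

Let mkf_filter phi : Filter (mkf phi).
Proof.
apply: filter_from_filter; first by exists 1 => /=.
move=> e d /= e0 d0; exists (Num.min e d); first by rewrite /= lt_min e0.
move=> psi /= h; split; apply: (lt_le_trans h); rewrite lee_fin ge_min lexx //.
by rewrite orbT.
Qed.

Let mkf_ev phi a e : 0 < e -> mkf phi [set psi | normc (st phi a - st psi a) < e].
Proof.
have FF := mkf_filter phi.
have hs b d : sa b -> 0 < d -> mkf phi [set psi | normc (st phi b - st psi b) < d].
  move=> hb d0; have d8 : 0 < d / 8 by lra.
  have [c [hc bc [M cM]]] := pdense hb d8.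
  have M0 : 0 < `|M| + 1 by rewrite ltr_wpDl.
  have cM' i : p i c <= `|M| + 1 by have := cM i; have := ler_norm M; lra.
  exists (d / 2 / (`|M| + 1)); first by rewrite /= !divr_gt0.
  move=> psi /= h; have := le_lt_trans (mk_ub phi psi (scale_ball hc cM' M0)) h.
  rewrite lte_fin ltr_pdivlMr // mulrC -diff_scale // => h'.
  by apply: (le_lt_trans (st_diff_bound _ _ _ c)); lra.
move=> e0; have e2 : 0 < e / 2 by lra.
have h1 := hs _ _ (sa_re_part a) e2; have h2 := hs _ _ (sa_re_part (- 'i%C *: a)) e2.
apply: filterS2 h1 h2 => psi /= h1 h2.
rewrite (re_part_decomp a) (stD phi) (stD psi) (stZ phi 'i%C) (stZ psi 'i%C) opprD addrACA -mulrBr.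
by apply: (le_lt_trans (le_normcD _ _)); rewrite normcM normc_i mul1r; lra.
Qed.

Let st_cont a : continuous (fun psi : states A => (st psi a : R[i]^o)).
Proof.
move=> phi; apply: (@continuous_comp _ _ _ (fun psi : states A => \val psi : {ptws A -> R[i]^o}) (proj a)).
  exact: initial_continuous.
exact: proj_continuous.
Qed.

Let ev_nbhs (phi : states A) a e : 0 < e -> nbhs phi [set psi | normc (st phi a - st psi a) < e].
Proof.
move=> e0; have /cvgrPdist_lt/(_ e%:C%C) := @st_cont a phi.
rewrite ltcR => /(_ e0); apply: filterS => psi /=.
by rewrite ltcR.
Qed.

(** A small [mk] distance controls every evaluation, by density of the elements of finite seminorm;
    conversely, by [net], control of finitely many evaluations makes [mk] small. *)
Let mk_weak phi : nbhs phi = mkf phi.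
Proof.
have FF := mkf_filter phi.
apply/seteqP; split=> U.
  (* The topology is initial along the inclusion into the pointwise topology, itself a supremum of
     topologies induced by evaluations: [cvg_sup] leaves one evaluation at a time. *)
  case=> _ /= [] [W oW <- /= Wx sWU]; apply: (filterS sWU).
  have : (fun psi : states A => \val psi : {ptws A -> R[i]^o}) @ mkf phi --> \val phi.
    apply/cvg_sup => a V; case=> _ /= [] [Y oY <- /= Yp YV]; apply: (filterS YV).
    have : (fun psi : states A => (st psi a : R[i]^o)) @ mkf phi --> (st phi a : R[i]^o).
      apply/cvgrPdist_lt => eps; rewrite ltcE /= => /andP[/eqP ei er].
      apply: filterS (mkf_ev phi a er) => psi /= h.
      by rewrite ltcE /= ei eqxx.
    by apply; apply: open_nbhs_nbhs.
  by apply; exact: open_nbhs_nbhs.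
case=> e /= e0 eU; apply: (filterS eU).
(* The net contributes [4 * (e / 12)] and the evaluations on [F] at most [e / 3], so the supremum
   defining [mk] is at most [e / 3 * 2], strictly below [e]. *)
have e12 : 0 < e / 12 by lra.
have [F hF] := net e12.
have hs : nbhs phi [set psi | forall f, f \in F -> normc (st phi f - st psi f) < e / 3].
  elim: (F) => [|f s IH]; first by apply: filterS filterT.
  have e3 : 0 < e / 3 by lra.
  apply: filterS2 (ev_nbhs phi f e3) IH => psi /= h1 h2 g.
  by rewrite inE => /orP[/eqP ->|/h2].
apply: filterS hs => psi /= hpsi.
apply: (@le_lt_trans _ _ (e / 3 * 2)%:E); last by rewrite lte_fin; lra.
apply/mk_leP => a aL; have [f /hpsi fe h] := hF phi psi a aL.
by rewrite lee_fin; lra.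
Qed.

Let lsc : lower_semicontinuous (L : subspace [set a : normed A | sa a] -> \bar R).
Proof.
move=> x r rL; case: (pselect (sa x)) => [hx|hx]; last first.
  (* Points outside [sa] are isolated in the subspace topology, so a singleton is a
     neighbourhood. *)
  exists [set x : subspace [set a : normed A | sa a]] => [|y -> //].
  by rewrite /nbhs /= -nbhs_subspace_out.
have [i hi] : exists i, r < p i x.
  apply: contrapT => h; move: rL; rewrite hL // ltNge; apply/negP; rewrite negbK.
  apply/sup_lip_leP => i; rewrite lee_fin leNgt; apply/negP => ri; apply: h.
  by exists i.
exists [set y | sa y /\ r < p i y]; last first.
  move=> y /= [hy ry]; rewrite hL //; apply: lt_le_trans (sup_lip_ub p i y).
  by rewrite lte_fin.
rewrite /nbhs /= -nbhs_subspace_in //; apply/nbhs_normedP.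
have [C hC] := csn_bound (hp i).
exists ((p i x - r) / (`|C| + 1)).
  by apply: divr_gt0; [rewrite subr_gt0|apply: ltr_wpDl].
have C0 : 0 < `|C| + 1 by apply: ltr_wpDl.
move=> y; rewrite ltr_pdivlMr // => yx hy; split=> //.
have := csn_split (hp i) x y; have := hC (x - y); rewrite cnorm_distC.
have := ler_norm C; have := cnorm_ge0 (y - x); nra.
Qed.

Lemma sup_lip_norm : is_lip_norm L.
Proof.
have dom1 : dom L 1.
  split; first exact: sa1.
  rewrite hL; last exact: sa1.
  by apply: (@sup_lip_fin _ _ _ _ _ 0) => i; rewrite p1.
split=> //.
- by move=> a ha; rewrite hL //; exact: (sup_lip_ge0 i0).
- by move=> r a ha; rewrite !hL //; [rewrite (sup_lipZ i0) // normc_real|exact: saZ].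
- by move=> a b ha hb; rewrite !hL //; [exact: sup_lipD|exact: saD].
- move=> a ha U /nbhs_normedP[e e0 eU].
  have [b [hb ab [M bM]]] := pdense ha e0.
  exists b; split; last by apply: eU; rewrite cnorm_distC.
  by split=> //; rewrite hL //; exact: (sup_lip_fin bM).
- move=> a ha; rewrite hL // (sup_lip_eq0 i0) //; split; first exact: pker.
  by move=> [r ->] i; rewrite (csnZr (hp i)) p1 mulr0.
Qed.

End LipNormCriterion.

(** * Seminorms on the stages of a filtration *)

Section Elt.
Variables (R : realType) (A : cstarType R) (B : subcstar A).
Implicit Types x y : B.

Lemma eltD x y : elt (x + y) = elt x + elt y. Proof. by []. Qed.
Lemma eltZ (c : R[i]) x : elt (c *: x) = c *: elt x. Proof. by []. Qed.
Lemma eltM x y : elt (x * y) = elt x * elt y. Proof. by []. Qed.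
Lemma elt1 : elt (1 : B) = 1. Proof. by []. Qed.
Lemma elt_star x : elt (star x) = star (elt x). Proof. by []. Qed.
Lemma cnorm_elt x : cnorm x = cnorm (elt x). Proof. by []. Qed.

Lemma elt_inj : injective (@elt R A B). Proof. exact: val_inj. Qed.

Lemma elt_sa x : sa x <-> sa (elt x).
Proof. by split=> [h|h]; [rewrite /sa/= -elt_star h|apply: elt_inj]. Qed.

Lemma mkeltK a (h : B a) : elt (mkelt h) = a. Proof. by []. Qed.

Lemma subcstar_scalar (c : R[i]) : B (c *: 1). Proof. exact/subcstarZ/subcstar1. Qed.

Lemma subcstarN a : B a -> B (- a).
Proof. by move=> h; rewrite -scaleN1r; exact: subcstarZ. Qed.

Lemma subcstarB a b : B a -> B b -> B (a - b).
Proof. by move=> ha hb; exact/subcstarD/subcstarN. Qed.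

Lemma subcstar_re_part a : B a -> B (re_part a).
Proof. by move=> h; apply/subcstarZ/subcstarD => //; exact: subcstar_star. Qed.

Lemma subcstar_lim a : (forall e : R, 0 < e -> exists2 b, B b & cnorm (a - b) < e) -> B a.
Proof.
move=> h; apply: (@subcstar_closed _ _ B) => V /nbhs_normedP[e e0 eV].
have [b Bb ab] := h _ e0; exists b; split => //.
by apply: eV; rewrite cnorm_distC.
Qed.

End Elt.

Lemma stage_approx (R : realType) (A : cstarType R) (U : filtration A) (a : A) (e : R) :
  0 < e -> exists n b, U n b /\ cnorm (a - b) < e.
Proof.
move=> e0; have := @stage_dense _ _ U a [set b | cnorm (b - a) < e].
case; first by apply/nbhs_normedP; exists e.
by move=> b [[n Unb] ab]; exists n, b; rewrite cnorm_distC.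
Qed.

(** The interface shared by two families: the deviations [dev] from conditional expectations and the
    scaled distances [wdist] to the stages. In both, the last two fields reflect that the zeroth
    stage consists of scalars. *)
Record stage_seminorms (R : realType) (A : cstarType R) (U : filtration A)
    (p : nat -> A -> R) (K : R) : Prop := StageSeminorms {
  ssn_csn : forall m, cont_seminorm (p m);
  ssn_stage : forall m a, U m a -> p m a = 0;
  ssn_mul : forall m a b, p m (a * b) <= 2 * (cnorm a * p m b + cnorm b * p m a);
  ssn_ball : forall a, sa a -> p 0%N a <= 1 -> exists r : R, cnorm (a - r%:C%C *: 1) <= K;
  ssn_ker : forall a, sa a -> p 0%N a = 0 -> exists r : R, a = r%:C%C *: 1
}.

Section StageSeminorms.
Variables (R : realType) (A : cstarType R) (U : filtration A).
Variables (p : nat -> A -> R) (K : R).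
Hypothesis hp : stage_seminorms U p K.

(** The supremum runs over all [m], the terms with [m >= n] being 0 by [ssn_stage]; in this form the
    inclusion of a stage in the next one preserves the seminorm. *)
Definition stage_lip n (a : U n) : \bar R := sup_lip p (elt a).

Lemma ssn_bounded n a : U n a -> exists M : R, forall m, p m a <= M.
Proof.
move=> Ua; exists (\sum_(m < n) p m a) => m.
have p0 k : 0 <= p k a := csn_ge0 (ssn_csn hp k) a.
case: (ltnP m n) => mn.
  by rewrite (bigD1 (Ordinal mn)) //= lerDl sumr_ge0.
by rewrite (ssn_stage hp) ?sumr_ge0 //; exact: stage_le Ua.
Qed.

Let elt_csn n m : cont_seminorm (fun a : U n => p m (elt a)).
Proof.
have h := ssn_csn hp m; split.
- by move=> a; exact: csn_ge0.
- by move=> c a; exact: (csn_scale h).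
- by move=> a b; exact: (csn_add h).
- by have [C hC] := csn_bound h; exists C => a; exact: hC.
Qed.

Lemma stage_lip_fin n (a : U n) : (stage_lip a < +oo)%E.
Proof. by have [M hM] := ssn_bounded (eltP a); exact: sup_lip_fin hM. Qed.

Lemma stage_lip_seminorm n : seminorm (@stage_lip n).
Proof. exact: (sup_lip_seminorm 0%N (elt_csn n)). Qed.

Lemma stage_lip_leibniz n : quasi_leibniz (@stage_lip n) 2 0.
Proof.
apply: (sup_lip_leibniz (p := fun m (a : U n) => p m (elt a)) (elt_csn n)) => //.
move=> m a b; exact: (ssn_mul hp).
Qed.

Lemma stage_lip_ball n (a : U n) : lip_ball (@stage_lip n) a ->
  exists r : R, cnorm (a - r%:C%C *: 1) <= K.
Proof.
move=> [ha La]; apply: (ssn_ball hp); first exact/elt_sa.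
by rewrite -lee_fin; apply: le_trans La; exact: sup_lip_ub.
Qed.

Lemma stage_lip_diam n : (diam (@stage_lip n) <= (2 * K)%:E)%E.
Proof. by apply: diam_bound => a /stage_lip_ball. Qed.

Lemma stage_lip_norm n d : has_dim (U n) d -> is_lip_norm (@stage_lip n).
Proof.
move=> hd; apply: (@sup_lip_norm _ _ _ 0%N (fun m (a : U n) => p m (elt a)) (elt_csn n) _ _ _ _ _ [set x : U n | cnorm x <= K]) => //.
- by move=> m; rewrite elt1 (ssn_stage hp) //; exact: subcstar1.
- move=> a e ha e0; exists a; split=> //; first by rewrite subrr cnorm0.
  exact: ssn_bounded (eltP a).
- move=> a /elt_sa ha /(_ 0%N) /(ssn_ker hp ha)[r ar].
  by exists r; exact: elt_inj.
- exact: tb_ball hd.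
- by move=> a /elt_sa ha /(_ 0%N) /(ssn_ball hp ha)[r ar]; exists r.
Qed.

(** Only one half of the bridge estimate is left as a hypothesis: since inclusion preserves the
    seminorm, the unit ball of a stage is contained in that of the next. *)
Lemma stage_approximable (beta : nat -> R) :
  fin_dim_filtration U -> (forall n, 0 < beta n) -> cvgn (series beta) ->
  (forall n b, U n.+1 b -> sa b -> (forall m, p m b <= 1) ->
    exists a, [/\ U n a, sa a, forall m, p m a <= 1 & cnorm (a - b) <= beta n]) ->
  approximable stage_lip beta 2 0.
Proof.
move=> fd b0 bs hb; split => //.
- exact: stage_lip_seminorm.
- by move=> n; have [d hd] := fd n; exact: stage_lip_norm hd.
- exact: stage_lip_leibniz.
- by move=> n a; apply: subset_closure => /=; exact: stage_lip_fin.
- by move=> n c a b _ _; exact: stage_lip_fin.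
- by move=> n a b _ _; exact: stage_lip_fin.
- by move=> n a _; exact: stage_lip_fin.
- move=> n; rewrite /bridge_length /hausdorff ge_max; apply/andP; split.
    apply/ereal_supP => _ [_ [a [ha La] <-] <-]; apply: ereal_inf_le.
    exists 0%E; last by rewrite lee_fin ltW.
    exists (elt a); last by rewrite subrr cnorm0.
    by exists (stage_inclusion U n a) => //; split => //; apply/elt_sa; exact: (proj1 (elt_sa a) ha).
  apply/ereal_supP => _ [_ [b [/elt_sa hsb Lb] <-] <-]; apply: ereal_inf_le.
  have pb m : p m (elt b) <= 1.
    by rewrite -lee_fin; apply: le_trans Lb; exact: (sup_lip_ub p m (elt b)).
  have [a [Ua ha pa ab]] := hb _ _ (eltP b) hsb pb.
  exists (cnorm (a - elt b))%:E; last by rewrite lee_fin.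
  exists a => //; exists (mkelt Ua) => //; split; first exact/elt_sa.
  by apply/sup_lip_leP => m; rewrite lee_fin.
Qed.

End StageSeminorms.

(** * Limits of conditional expectations *)

Section CondExp.
Variables (R : realType) (A B : cstarType R) (iota : B -> A) (f : A -> B).
Hypothesis hf : cond_exp iota f.

Lemma cond_exp0 : f 0 = 0.
Proof.
have h := cond_exp_linear hf 1 0 0; rewrite !scale1r addr0 in h.
by apply: (addrI (f 0)); rewrite -h addr0.
Qed.

Lemma cond_expZ c a : f (c *: a) = c *: f a.
Proof. by rewrite -[c *: a]addr0 (cond_exp_linear hf) cond_exp0 addr0. Qed.

Lemma cond_expD a b : f (a + b) = f a + f b.
Proof. by rewrite -[a]scale1r (cond_exp_linear hf) !scale1r. Qed.

Lemma cond_expB a b : f (a - b) = f a - f b.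
Proof. by rewrite -scaleN1r cond_expD cond_expZ scaleN1r. Qed.

(** Complete positivity, read on matrices of size 1. *)
Lemma cond_exp_pos a : exists b, f (star a * a) = star b * b.
Proof.
have [Y hY] := cond_exp_cp hf (const_mx a : 'M[A]_1).
exists (Y 0 0); move/matrixP/(_ 0 0): hY.
by rewrite !mxE !big_ord1 !mxE.
Qed.

(* [4 a = (1 + a) ^+ 2 - (1 - a) ^+ 2], and a positive map sends both squares
   to selfadjoint elements. *)
Lemma cond_exp_sa a : sa a -> sa (f a).
Proof.
move=> ha; have sq x : sa x -> sa (f (x * x)).
  by move=> hx; have [b] := cond_exp_pos x; rewrite hx => ->; exact: sa_starM.
have h1 := sq _ (saD (sa1 A) ha); have h2 := sq _ (saB (sa1 A) ha).
have -> : a = (2^-1 : R)%:C%C *: ((2^-1 : R)%:C%C *: ((1 + a) * (1 + a) - (1 - a) * (1 - a))).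
  rewrite mulrDl mulrBl !mul1r !mulrDr !mulrN !mulr1.
  rewrite (_ : 1 + a + (a + a * a) - (1 - a - (a - a * a)) = (a + a) + (a + a)).
    by rewrite !half_add.
  by rewrite !opprB (AC ((2*2)*(2*2)) ((((2*3)*(5*7))*(1*8))*(4*6))) /= !subrr !addr0.
by rewrite !cond_expZ cond_expB; apply/saZ/saZ/saB.
Qed.

Lemma cond_exp_star a : f (star a) = star (f a).
Proof.
rewrite (re_part_decomp a).
move: (sa_re_part a) (sa_re_part (- 'i%C *: a)); move: (re_part a) (re_part (- 'i%C *: a)) => b c hb hc.
have hfb := cond_exp_sa hb; have hfc := cond_exp_sa hc.
by rewrite starD starZ hb hc !cond_expD !cond_expZ starD starZ hfb hfc.
Qed.

End CondExp.

Section DenseExtension.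
Variables (R : realType) (A B : cstarType R).

Definition lipschitz (f : A -> B) : Prop :=
  exists C : R, forall a b, cnorm (f a - f b) <= C * cnorm (a - b).

Lemma lipschitz_gt0 f : lipschitz f ->
  exists2 C : R, 0 < C & forall a b, cnorm (f a - f b) <= C * cnorm (a - b).
Proof.
move=> [C hC]; exists (`|C| + 1); first by apply: ltr_wpDl.
move=> a b; apply: (le_trans (hC a b)); apply: ler_wpM2r => //.
by have := ler_norm C; lra.
Qed.

Variable D : set A.
Hypothesis dense : forall a (e : R), 0 < e -> exists2 x, D x & cnorm (a - x) < e.

Lemma dense_eq (f g : A -> B) : lipschitz f -> lipschitz g ->
  (forall x, D x -> f x = g x) -> forall a, f a = g a.
Proof.
move=> /lipschitz_gt0[C C0 hC] /lipschitz_gt0[C' C'0 hC'] fg a.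
apply: (@eq_cnorm_le _ _ _ _ (C + C')); first by lra.
move=> e e0; have [x Dx ax] := dense a e0.
apply: (le_trans (cnorm_dist_trans (f x) _ _)); rewrite [X in cnorm (X - g a)]fg // (cnorm_distC (g x)).
have := hC a x; have := hC' a x; nra.
Qed.

(** The single bound carries both the values on [D], at [a = x], and the approximation of [f a]
    elsewhere. *)
Lemma dense_extension (g : A -> B) :
  (forall x y, D x -> D y -> cnorm (g x - g y) <= cnorm (x - y)) ->
  exists f : A -> B, forall a x, D x -> cnorm (f a - g x) <= cnorm (a - x).
Proof.
move=> hg.
suff h a : exists l : B, forall x, D x -> cnorm (l - g x) <= cnorm (a - x).
  by have [f hf] := choice h; exists f.
have ap (k : nat) : exists x, D x /\ cnorm (a - x) < k.+1%:R^-1.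
  have k0 : 0 < k.+1%:R^-1 :> R by rewrite invr_gt0 ltr0n.
  have [x Dx ax] := dense a k0.
  by exists x.
have [x hx] := choice ap.
have small (e : R) : 0 < e -> exists N : nat, forall k, (N <= k)%N -> cnorm (a - x k) < e.
  move=> e0; have [N hN] := ltr_add_invr e0; rewrite add0r in hN.
  exists N => k Nk; apply: (lt_trans (hx k).2); apply: le_lt_trans hN.
  by rewrite lef_pV2 ?posrE ?ltr0n // ler_nat ltnS.
have [l hl] : exists l, forall e : R, 0 < e -> exists N, forall n, (N <= n)%N -> cnorm (g (x n) - l) < e.
  apply: cnorm_complete => e e0; have e2 : 0 < e / 2 by lra.
  have [N hN] := small _ e2; exists N => m n Nm Nn.
  apply: (le_lt_trans (hg _ _ (hx m).1 (hx n).1)).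
  apply: (le_lt_trans (cnorm_dist_trans a _ _)); rewrite cnorm_distC.
  by have := hN _ Nm; have := hN _ Nn; lra.
exists l => y Dy; apply/ler_addgt0Pr => e e0; have e2 : 0 < e / 2 by lra.
have [N hN] := small _ e2; have [M hM] := hl _ e2.
have h1 := hN _ (leq_maxl N M); have h2 := hM _ (leq_maxr N M).
set k := maxn N M in h1 h2.
apply: (le_trans (cnorm_dist_trans (g (x k)) _ _)); rewrite cnorm_distC.
have := hg _ _ (hx k).1 Dy; have := cnorm_dist_trans a (x k) y; rewrite (cnorm_distC (x k) a).
lra.
Qed.

End DenseExtension.

Section LimitExpectation.
Variables (R : realType) (A : cstarType R) (U : filtration A).
Variable E : forall n, U n.+1 -> U n.
Hypothesis hE : forall n, cond_exp (stage_inclusion U n) (@E n).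

Lemma Ecomp_lin m n (c : R[i]) (a b : U n) : Ecomp E m (c *: a + b) = c *: Ecomp E m a + Ecomp E m b.
Proof.
elim: n a b => [//|n IH] a b /=; case: ifP => // _.
by rewrite (cond_exp_linear (hE n)) IH.
Qed.

Lemma Ecomp_contr m n (a : U n) : cnorm (Ecomp E m a) <= cnorm (elt a).
Proof.
elim: n a => [//|n IH] a /=; case: ifP => // _.
by apply: (le_trans (IH _)); exact: (cond_exp_contractive (hE n)).
Qed.

Lemma Ecomp_star m n (a : U n) : Ecomp E m (star a) = star (Ecomp E m a).
Proof.
elim: n a => [//|n IH] a /=; case: ifP => // _.
by rewrite (cond_exp_star (hE n)) IH.
Qed.

Lemma Ecomp_id m n (a : U n) : (n <= m)%N -> Ecomp E m a = elt a.
Proof. by case: n a => [//|n] a /= ->. Qed.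

Lemma Ecomp_mem m n (a : U n) : U m (Ecomp E m a).
Proof.
elim: n a => [|n IH] a /=; first exact: stage_le (eltP a).
by case: ltnP => [nm|_ //]; exact: stage_le (eltP a).
Qed.

Lemma Ecomp_step m n (a : U n.+1) : (m <= n)%N -> Ecomp E m a = Ecomp E m (E a).
Proof. by rewrite /= leqNgt; case: ltnP. Qed.

Lemma Ecomp_incl m n (a : U n) : Ecomp E m (stage_inclusion U n a) = Ecomp E m a.
Proof.
by rewrite /=; case: ltnP => [nm|_]; [rewrite Ecomp_id // ltnW|rewrite (cond_exp_id (hE n))].
Qed.

(** Each [E] fixes the stage it maps onto, so viewing an element in a larger stage does not change
    the result. Hence the compositions define one function on the union of the stages. *)
Lemma Ecomp_elt m n k (a : U n) (b : U k) : elt a = elt b -> Ecomp E m a = Ecomp E m b.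
Proof.
wlog nk : n k a b / (n <= k)%N => [hw|].
  by case: (leqP n k) => [|/ltnW] nk ab; [exact: hw|apply/esym/hw].
elim: k nk b => [|k IH].
  by rewrite leqn0 => /eqP n0; subst n => b /elt_inj ->.
rewrite leq_eqVlt => /orP[/eqP n0|nk] b ab; first by subst n; rewrite (elt_inj ab).
have Ub : U k (elt b) by rewrite -ab; exact: stage_le (eltP a).
rewrite (IH nk (mkelt Ub) ab) -Ecomp_incl; congr (Ecomp E m _).
exact: elt_inj.
Qed.

Lemma Ecomp_pos m n (a : U n) : (m <= n)%N ->
  exists2 b, U m b & Ecomp E m (star a * a) = star b * b.
Proof.
elim: n a => [|n IH] a mn.
  exists (elt a); last by [].
  by move: mn; rewrite leqn0 => /eqP ->; exact: eltP.
rewrite /=; case: ltnP => [nm|mn'].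
  by exists (elt a) => //; exact: stage_le nm (eltP a).
by have [b ->] := cond_exp_pos (hE n) a; exact: IH.
Qed.

(** The bimodule property moves [x] through each expectation in turn, with 1 as right factor. The
    product is named [c] because [x] and [a] come with different stages. *)
Lemma Ecomp_mul m n (a c : U n) x : (m <= n)%N -> U m x -> elt c = x * elt a ->
  Ecomp E m c = x * Ecomp E m a.
Proof.
elim: n a c => [//|n IH] a c mn Ux h /=; case: ltnP => // nm.
have Ux' := stage_le nm Ux; apply: IH => //.
have -> : c = stage_inclusion U n (mkelt Ux') * a * stage_inclusion U n 1.
  by apply: elt_inj; rewrite h !eltM /= mulr1.
by rewrite (cond_exp_bimod (hE n)) mulr1.
Qed.

Let D : set A := [set a | exists n, U n a].

Let dense a (e : R) : 0 < e -> exists2 x, D x & cnorm (a - x) < e.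
Proof. by move=> /(stage_approx U a)[n [b [Ub ab]]]; exists b => //; exists n. Qed.

Let P_ex m : exists f : A -> A, forall a n (x : U n), cnorm (f a - Ecomp E m x) <= cnorm (a - elt x).
Proof.
(* [g] glues the compositions of all stages; the value 0 off their union is a placeholder, replaced
   by the extension. *)
have g_ex a : exists l, forall n (x : U n), elt x = a -> l = Ecomp E m x.
  have [[n Ua]|h] := pselect (D a).
    by exists (Ecomp E m (mkelt Ua)) => k x xa; apply: Ecomp_elt.
  by exists 0 => k x xa; exfalso; apply: h; exists k; rewrite -xa; exact: eltP.
have [g hg] := choice g_ex.
have gE n (x : U n) : g (elt x) = Ecomp E m x by exact: hg.
have [|f hf] := @dense_extension _ _ _ D dense g; last first.
  by exists f => a n x; rewrite -gE; apply: hf; exists n; exact: eltP.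
move=> x y [n Ux] [k Uy].
pose x' := mkelt (stage_le (leq_maxl n k) Ux); pose y' := mkelt (stage_le (leq_maxr n k) Uy).
rewrite -[x]/(elt x') -[y]/(elt y') !gE.
have -> : Ecomp E m x' - Ecomp E m y' = Ecomp E m (- 1 *: y' + x').
  by rewrite Ecomp_lin scaleN1r addrC.
have -> : elt x' - elt y' = elt (- 1 *: y' + x') by rewrite scaleN1r eltD addrC.
exact: Ecomp_contr.
Qed.

(** The bound in [limE_spec] determines this map, since the union of the stages is dense. *)
Definition limE m : A -> A := projT1 (cid (P_ex m)).

Lemma limE_spec m a n (x : U n) : cnorm (limE m a - Ecomp E m x) <= cnorm (a - elt x).
Proof. by rewrite /limE; case: cid => f /= hf; exact: hf. Qed.

Lemma limE_elt m n (x : U n) : limE m (elt x) = Ecomp E m x.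
Proof.
apply/eqP; rewrite -subr_eq0; apply/eqP/cnorm0_eq0/eqP; rewrite eq_le cnorm_ge0 andbT.
by have := limE_spec m (elt x) x; rewrite subrr cnorm0.
Qed.

Lemma limE_lip m a b : cnorm (limE m a - limE m b) <= cnorm (a - b).
Proof.
apply/ler_addgt0Pr => e e0; have e4 : 0 < e / 4 by lra.
have [x [n Ux] ax] := dense a e4; have [y [k Uy] bx] := dense b e4.
have hx := limE_spec m a (mkelt Ux); have hy := limE_spec m b (mkelt Uy).
pose x' := mkelt (stage_le (leq_maxl n k) Ux); pose y' := mkelt (stage_le (leq_maxr n k) Uy).
have hxy : cnorm (Ecomp E m x' - Ecomp E m y') <= cnorm (x - y).
  have -> : Ecomp E m x' - Ecomp E m y' = Ecomp E m (- 1 *: y' + x').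
    by rewrite Ecomp_lin scaleN1r addrC.
  have -> : x - y = elt (- 1 *: y' + x') by rewrite scaleN1r eltD addrC.
  exact: Ecomp_contr.
have ex : Ecomp E m (mkelt Ux) = Ecomp E m x' by exact: Ecomp_elt.
have ey : Ecomp E m (mkelt Uy) = Ecomp E m y' by exact: Ecomp_elt.
rewrite ex /= in hx; rewrite ey /= in hy.
apply: (le_trans (cnorm_dist_trans (Ecomp E m x') _ _)).
have := cnorm_dist_trans (Ecomp E m y') (Ecomp E m x') (limE m b); rewrite (cnorm_distC (Ecomp E m y')).
have := cnorm_dist_trans a x y; have := cnorm_dist_trans b a y; rewrite (cnorm_distC x a).
lra.
Qed.

Lemma limE_lipschitz m : lipschitz (limE m).
Proof. by exists 1 => a b; rewrite mul1r limE_lip. Qed.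

Lemma limE_mem m a : U m (limE m a).
Proof.
apply: subcstar_lim => e e0; have [x [n Ux] ax] := dense a e0.
exists (Ecomp E m (mkelt Ux)); first exact: Ecomp_mem.
exact: le_lt_trans (limE_spec m a (mkelt Ux)) ax.
Qed.

Lemma limE_id m a : U m a -> limE m a = a.
Proof. by move=> Ua; rewrite -(mkeltK Ua) limE_elt Ecomp_id. Qed.

Let lip_lin (f : A -> A) c b : lipschitz f -> lipschitz (fun a => f (c *: a + b)).
Proof.
move=> /lipschitz_gt0[C C0 hC]; exists (C * normc c) => x y.
apply: (le_trans (hC _ _)).
by rewrite opprD addrACA subrr addr0 -scalerBr cnormZ mulrA.
Qed.

Let lip_post (f : A -> A) c b : lipschitz f -> lipschitz (fun a => c *: f a + b).
Proof.
move=> [C hC]; exists (normc c * C) => x y.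
rewrite opprD addrACA subrr addr0 -scalerBr cnormZ -mulrA; apply: ler_wpM2l => //.
by case: (c) => u v; rewrite /= sqrtr_ge0.
Qed.

Lemma limE_linear m c a b : limE m (c *: a + b) = c *: limE m a + limE m b.
Proof.
(* Density is used in one variable at a time: first in [a], for [y] in a stage, then in [b]. *)
have step1 y : D y -> forall a, limE m (c *: a + y) = c *: limE m a + limE m y.
  move=> [k Uy]; apply: (@dense_eq _ _ _ D dense).
  - exact/lip_lin/limE_lipschitz.
  - exact/lip_post/limE_lipschitz.
  move=> x [n Ux].
  pose x' := mkelt (stage_le (leq_maxl n k) Ux); pose y' := mkelt (stage_le (leq_maxr n k) Uy).
  rewrite -[x]/(elt x') -[y]/(elt y') -eltZ -eltD !limE_elt; exact: Ecomp_lin.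
move: b; apply: (@dense_eq _ _ _ D dense).
- exists 1 => x y; rewrite mul1r; apply: (le_trans (limE_lip _ _ _)).
  by rewrite opprD addrACA subrr add0r.
- exists 1 => x y; rewrite mul1r opprD addrACA subrr add0r; exact: limE_lip.
- by move=> y Dy; exact: step1.
Qed.

Lemma limEB m a b : limE m (a - b) = limE m a - limE m b.
Proof.
have := limE_linear m (-1) b a; rewrite !scaleN1r (addrC (- b)) => ->; exact: addrC.
Qed.

Lemma limE0 m : limE m 0 = 0.
Proof. by have := limEB m 0 0; rewrite !subrr. Qed.

Lemma limED m a b : limE m (a + b) = limE m a + limE m b.
Proof. by rewrite -[a]scale1r limE_linear !scale1r. Qed.

Lemma limEZ m c a : limE m (c *: a) = c *: limE m a.
Proof. by rewrite -[c *: a]addr0 limE_linear limE0 addr0. Qed.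

Lemma limE_contr m a : cnorm (limE m a) <= cnorm a.
Proof. by have := limE_lip m a 0; rewrite limE0 !subr0. Qed.

Lemma limE_star m a : limE m (star a) = star (limE m a).
Proof.
have [C C0 hC] := lipschitz_gt0 (limE_lipschitz m).
move: a; apply: (@dense_eq _ _ _ D dense).
- by exists C => a b; apply: (le_trans (hC _ _)); rewrite -starB cnorm_starE.
- by exists C => a b; rewrite -starB cnorm_starE.
- by move=> x [n Ux]; rewrite -(mkeltK Ux) -elt_star !limE_elt Ecomp_star.
Qed.

Lemma limE_sa m a : sa a -> sa (limE m a).
Proof. by rewrite /sa/= -limE_star => ->. Qed.

Lemma limE_mul m x a : U m x -> limE m (x * a) = x * limE m a.
Proof.
move=> Ux; move: a; apply: (@dense_eq _ _ _ D dense).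
- exists (cnorm x) => a b; apply: (le_trans (limE_lip _ _ _)).
  by rewrite -mulrBr cnormM.
- exists (cnorm x) => a b; rewrite -mulrBr; apply: (le_trans (cnormM _ _)).
  by rewrite ler_wpM2l // limE_lip.
move=> a [n Ua].
have Ua' := stage_le (leq_maxl n m) Ua; have Ux' := stage_le (leq_maxr n m) Ux.
have Uxa : U (maxn n m) (x * a) by exact: subcstarM.
rewrite -(mkeltK Uxa) -[a in RHS](mkeltK Ua') !limE_elt.
by apply: Ecomp_mul => //; exact: leq_maxr.
Qed.

Lemma limE_tower m n a : (m <= n)%N -> limE m (limE n a) = limE m a.
Proof.
move=> mn; move: a; apply: (@dense_eq _ _ _ D dense).
- exists 1 => a b; rewrite mul1r; apply: (le_trans (limE_lip _ _ _)); exact: limE_lip.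
- exact: limE_lipschitz.
move=> a [k Ua]; rewrite -(mkeltK Ua); move: (mkelt Ua) => {Ua} x; elim: k x => [|k IH] x.
  by rewrite (limE_elt n) Ecomp_id.
rewrite (limE_elt n); have [kn|nk] := ltnP k n; first by rewrite Ecomp_id.
rewrite Ecomp_step // -(limE_elt n) IH !limE_elt Ecomp_step //.
exact: leq_trans nk.
Qed.

(** For [x] in a stage the projection is a finite composition, and each expectation keeps the form
    [star x * x]. Raising [x] to the stage [maxn n m] covers [n < m]. *)
Lemma limE_pos m n (x : U n) : exists2 b, U m b & limE m (elt (star x * x)) = star b * b.
Proof.
have Ux := stage_le (leq_maxl n m) (eltP x).
have [b Ub hb] := Ecomp_pos (mkelt Ux) (leq_maxr n m).
exists b => //; rewrite -hb limE_elt; exact: Ecomp_elt.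
Qed.

End LimitExpectation.

Lemma sa_scalarP (R : realType) (A : cstarType R) (c : R[i]) :
  sa (c *: 1 : A) -> exists r : R, c *: 1 = r%:C%C *: 1 :> A.
Proof. by move=> /re_part_sa <-; exists (complex.Re c); exact: re_part_scalar. Qed.

Lemma summable_small (R : realType) (beta : nat -> R) : cvgn (series beta) ->
  forall e : R, 0 < e -> exists N, forall n, (N <= n)%N -> `|beta n| < e.
Proof.
move=> /cvg_series_cvg_0/cvgrPdist_lt h e /h [N _ hN].
by exists N => n /hN /=; rewrite sub0r normrN.
Qed.

Section LimitSeminorm.
Variables (R : realType) (A : cstarType R) (U : filtration A) (beta : nat -> R).
Variable E : forall n, U n.+1 -> U n.
Hypothesis hU : af_filtration U.
Hypothesis beta_gt0 : forall j, 0 < beta j.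
Hypothesis beta_sum : cvgn (series beta).
Hypothesis hE : forall n, cond_exp (stage_inclusion U n) (@E n).

Let P := limE hE.

Definition dev m (a : A) : R := cnorm (a - P m a) / beta m.

Lemma dev_le m a x : dev m a <= x <-> cnorm (a - P m a) <= x * beta m.
Proof. by rewrite /dev ler_pdivrMr. Qed.

Lemma dev_csn m : cont_seminorm (dev m).
Proof.
have b0 : 0 <= (beta m)^-1 by rewrite invr_ge0 ltW.
split.
- by move=> a; rewrite mulr_ge0.
- by move=> c a; rewrite /dev /P limEZ -scalerBr cnormZ mulrA.
- move=> a b; rewrite /dev /P limED opprD addrACA -mulrDl.
  by apply: ler_wpM2r => //; exact: cnormD.
exists (2 * (beta m)^-1) => a; rewrite /dev mulrAC; apply: ler_wpM2r => //.
by apply: (le_trans (cnormB _ _)); have := limE_contr hE m a; rewrite /P; lra.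
Qed.

(* [ab - P (ab) = a (b - P b) + (a - P a) (P b) - P ((a - P a) b)], because
   [P ((P a) b) = (P a) (P b)]. *)
Lemma dev_mul m a b : dev m (a * b) <= 2 * (cnorm a * dev m b + cnorm b * dev m a).
Proof.
have -> : 2 * (cnorm a * dev m b + cnorm b * dev m a) =
    2 * (cnorm a * cnorm (b - P m b) + cnorm b * cnorm (a - P m a)) / beta m.
  by rewrite /dev !mulrA -mulrDl mulrA.
rewrite /dev; apply: ler_wpM2r; first by rewrite invr_ge0 ltW.
have -> : a * b - P m (a * b) = (a * (b - P m b) + (a - P m a) * P m b) - P m ((a - P m a) * b).
  rewrite mulrBl (mulrBl b) /P (limEB hE m (a * b)) (limE_mul hE b (limE_mem hE m a)).
  by rewrite mulrBr opprB (AC (2*2*2) ((1*6)*(2*3)*(4*5))) /= !addNr !addr0.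
have h1 := cnormM a (b - P m b); have h2 := cnormM (a - P m a) (P m b).
have h3 := limE_contr hE m ((a - P m a) * b); have h4 := cnormM (a - P m a) b.
have h5 : cnorm (a - P m a) * cnorm (P m b) <= cnorm (a - P m a) * cnorm b.
  by apply: ler_wpM2l => //; exact: (limE_contr hE).
apply: (le_trans (cnormB _ _)).
have := cnormD (a * (b - P m b)) ((a - P m a) * P m b).
have : 0 <= cnorm a * cnorm (b - P m b) by rewrite mulr_ge0.
move: h3; rewrite -/P; lra.
Qed.

Lemma dev_stage m a : U m a -> dev m a = 0.
Proof. by move=> Ua; rewrite /dev /P limE_id // subrr cnorm0 mul0r. Qed.

(** For [m <= n] the projections commute, so [P n a - P m (P n a)] is the image of [a - P m a] under
    the contraction [P n]; for [m > n] it is 0. Thus [P n] preserves unit balls, which gives the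
    bridges, the lifts and the tunnels. *)
Lemma dev_limE m n a : dev m (P n a) <= dev m a.
Proof.
rewrite /dev; apply: ler_wpM2r; first by rewrite invr_ge0 ltW.
have [mn|nm] := leqP m n.
  rewrite /P limE_tower // -(limE_id hE (stage_le mn (limE_mem hE m a))) -limEB.
  by rewrite (limE_id hE (stage_le mn (limE_mem hE m a))); exact: limE_contr.
rewrite [P m _](limE_id hE) ?subrr ?cnorm0 //.
exact: stage_le (ltnW nm) (limE_mem hE n a).
Qed.

Lemma limE0_scalar a : sa a -> exists r : R, P 0 a = r%:C%C *: 1.
Proof.
move=> ha; have [c hc] := (hU.2 _).1 (limE_mem hE 0 a).
by have := limE_sa hE 0 ha; rewrite /P hc => /sa_scalarP.
Qed.

(** The radius is [beta 0%N] because [P 0 a] is a real scalar at distance [dev 0 a * beta 0] from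
    [a]. *)
Lemma dev_ssn : stage_seminorms U dev (beta 0%N).
Proof.
split; [exact: dev_csn|exact: dev_stage|exact: dev_mul| |].
  move=> a /limE0_scalar[r ar] /dev_le; rewrite mul1r ar => h.
  by exists r.
move=> a /limE0_scalar[r ar] da; exists r; rewrite -ar.
apply/eqP; rewrite -subr_eq0; apply/eqP/cnorm0_eq0.
by move/eqP: da; rewrite mulf_eq0 invr_eq0 (gt_eqF (beta_gt0 _)) orbF => /eqP.
Qed.

Lemma L_betaE : L_beta beta E = @stage_lip R A U dev.
Proof.
apply: functional_extensionality_dep => n; apply/funext => a.
apply/eqP; rewrite eq_le; apply/andP; split; last first.
  apply/sup_lip_leP => m; rewrite lee_fin; case: (ltnP m n) => mn.
    rewrite /dev /P limE_elt.
    exact: (le_bigmax 0 (fun m : 'I_n => cnorm (elt a - Ecomp E m a) / beta m) (Ordinal mn)).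
  (* The default 0 of the finite maximum covers the vanishing terms, and with them the case
     [n = 0]. *)
  by rewrite dev_stage ?bigmax_ge_id //; exact: stage_le (eltP a).
rewrite /L_beta; elim/big_ind: _ => [|x y hx hy|m _].
- by apply: (sup_lip_ge0 0%N); exact: dev_csn.
- by rewrite maxEle; case: ifP.
- apply: le_trans (sup_lip_ub dev m (elt a)).
  by rewrite /dev /P limE_elt.
Qed.

Lemma dev_approximable : approximable (@stage_lip R A U dev) beta 2 0.
Proof.
apply: (stage_approximable dev_ssn hU.1 beta_gt0 beta_sum).
move=> n b Ub hb db; exists (P n b); split.
- exact: limE_mem.
- exact: limE_sa.
- by move=> m; apply: le_trans (dev_limE m n b) (db m).
- by rewrite cnorm_distC; have /dev_le := db n; rewrite mul1r.
Qed.

Lemma dev_tb : totally_bounded [set a | (forall m, dev m a <= 1) /\ cnorm a <= beta 0%N].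
Proof.
apply: tb_near => e e0; have [N hN] := summable_small beta_sum e0.
have [d hd] := hU.1 N.
exists ((@elt R A (U N)) @` [set x : U N | cnorm x <= beta 0%N]).
  by apply: tb_map; [move=> x y; exact: lexx|exact: tb_ball hd].
move=> a /= [da na]; exists (P N a).
  exists (mkelt (limE_mem hE N a)) => //=.
  by rewrite cnorm_elt; apply: le_trans na; exact: limE_contr.
have /dev_le := da N; rewrite mul1r => /le_trans; apply; apply: ltW.
by apply: le_lt_trans (hN _ (leqnn N)); exact: ler_norm.
Qed.

Lemma sa_approx a (e : R) : sa a -> 0 < e -> exists n b, [/\ U n b, sa b & cnorm (a - b) < e].
Proof.
move=> ha e0; have [n [b [Ub ab]]] := stage_approx U a e0.
exists n, (re_part b); split; [exact: subcstar_re_part|exact: sa_re_part|].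
exact: le_lt_trans (re_part_dist _ ha) ab.
Qed.

Lemma dev_lip_norm (L : A -> \bar R) : (forall a, sa a -> L a = sup_lip dev a) -> is_lip_norm L.
Proof.
move=> hL; apply: (sup_lip_norm 0%N dev_csn hL _ _ _ dev_tb).
- by move=> m; apply: dev_stage; exact: subcstar1.
- move=> a e ha e0; have [n [b [Ub hb ab]]] := sa_approx ha e0.
  by exists b; split=> //; exact: (ssn_bounded dev_ssn Ub).
- by move=> a ha /(_ 0%N); exact: (ssn_ker dev_ssn).
- move=> a ha da; have [r ar] := ssn_ball dev_ssn ha (da 0%N).
  exists r; split=> // m; apply: (le_trans (csnB (dev_csn m) _ _)).
  by rewrite (csnZr (dev_csn m)) (dev_stage (subcstar1 (U m))) mulr0 addr0.
Qed.

Lemma dev_leibniz (L : A -> \bar R) :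
  (forall a, sa a -> L a = sup_lip dev a) -> quasi_leibniz L 2 0.
Proof. by move=> hL; apply: (sup_lip_leibniz dev_csn hL); exact: dev_mul. Qed.

End LimitSeminorm.

(** * The limit Lip-norm *)

Lemma eventually_bounded (R : realType) (f : nat -> R) (N : nat) (M : R) :
  (forall n, 0 <= f n) -> (forall n, (N <= n)%N -> f n <= M) ->
  exists C : R, forall n, f n <= C.
Proof.
move=> f0 fM; exists (\sum_(i < N) f i + `|M|) => n; case: (ltnP n N) => nN.
  rewrite (bigD1 (Ordinal nN)) //= -addrA lerDl addr_ge0 //; exact: sumr_ge0.
apply: (le_trans (fM _ nN)); apply: (le_trans (ler_norm _)).
by rewrite lerDr sumr_ge0.
Qed.

Lemma summable_cauchy (R : realType) (beta : nat -> R) (C : R) : (forall n, 0 < beta n) ->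
  cvgn (series beta) -> 0 <= C -> forall e : R, 0 < e -> exists N, forall n k, (N <= n)%N ->
    C * (series beta (n + k)%N - series beta n) < e.
Proof.
move=> b0 bs C0 e e0; have C1 : 0 < C + 1 by lra.
have e1 : 0 < e / (C + 1) / 2 by rewrite !divr_gt0.
move: bs => /cvgrPdist_lt/(_ _ e1)[N _ hN]; exists N => n k Nn.
have h1 := hN _ Nn; have h2 := hN _ (leq_trans Nn (leq_addr k n)).
move: h1 h2; rewrite /= !ltr_norml => /andP[h1 h2] /andP[h3 h4].
set x := series beta (n + k)%N in h3 h4 *; set y := series beta n in h1 h2 *.
have h : x - y < e / (C + 1) by lra.
have [xy|xy] := lerP (x - y) 0.
  by apply: le_lt_trans e0; rewrite mulr_ge0_le0.
rewrite ltr_pdivlMr // in h; nra.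
Qed.

Section ConvergentSequences.
Variables (R : realType) (A : cstarType R) (U : filtration A).
Implicit Types (d s t : dseq U) (x y : A).

(* [d] is the sequence [(x_n, x_(n+1))] for some [x_n] in [U n] tending to [x]. *)
Definition conv d x : Prop := (forall n, (d n.+1).1 = (d n).2) /\
  forall e : R, 0 < e -> exists N, forall n, (N <= n)%N -> cnorm (elt (d n).1 - x) < e.

Lemma conv_uniq d x y : conv d x -> conv d y -> x = y.
Proof.
move=> [_ hx] [_ hy]; apply: (@eq_cnorm_le _ _ _ _ 2) => // e e0.
have [N hN] := hx _ e0; have [M hM] := hy _ e0.
have := hN _ (leq_maxl N M); have := hM _ (leq_maxr N M).
have := cnorm_dist_trans (elt (d (maxn N M)).1) x y; rewrite (cnorm_distC x (elt _)); lra.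
Qed.

Lemma conv_linear (c : R[i]) d d' x x' : conv d x -> conv d' x' ->
  conv (fun n => c *: d n + d' n) (c *: x + x').
Proof.
move=> [cd hx] [cd' hx']; split=> [n /=|e e0]; first by rewrite cd cd'.
have c1 : 0 < normc c + 1 by case: (c) => u v; rewrite /= ltr_wpDl ?sqrtr_ge0.
have e1 : 0 < e / (normc c + 1) / 2 by rewrite !divr_gt0.
have e2 : 0 < e / 2 by lra.
have [N hN] := hx _ e1; have [M hM] := hx' _ e2.
exists (maxn N M) => n; rewrite geq_max => /andP[Nn Mn].
rewrite -[elt _]/(c *: elt (d n).1 + elt (d' n).1) opprD addrACA -scalerBr.
apply: (le_lt_trans (cnormD _ _)); rewrite cnormZ.
have := hM _ Mn; have := hN _ Nn; have := cnorm_ge0 (elt (d n).1 - x).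
set y := cnorm _; set z := cnorm _ => y0 h1 h2.
rewrite -ltr_pdivrMr // in h1.
have : y * (normc c + 1) < e / 2.
  by move: h1; rewrite ltr_pdivrMr // mulrAC ltr_pdivlMr.
have : 0 <= y by [].
nra.
Qed.

Lemma conv_mul d d' x x' : conv d x -> conv d' x' -> conv (fun n => d n * d' n) (x * x').
Proof.
move=> [cd hx] [cd' hx']; split=> [n /=|e e0]; first by rewrite cd cd'.
have x1 : 0 < cnorm x + 1 by have := cnorm_ge0 x; lra.
have x'1 : 0 < cnorm x' + 1 by have := cnorm_ge0 x'; lra.
have e1 : 0 < e / (cnorm x' + 1) / 2 by rewrite !divr_gt0.
have e2 : 0 < e / (cnorm x + 1) / 2 by rewrite !divr_gt0.
have [N hN] := hx _ e1; have [M hM] := hx' _ e2; have [K hK] := hx' _ ltr01.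
exists (maxn N (maxn M K)) => n; rewrite !geq_max => /and3P[Nn Mn Kn].
rewrite -[elt _]/(elt (d n).1 * elt (d' n).1).
set a := elt (d n).1; set b := elt (d' n).1.
have -> : a * b - x * x' = (a - x) * b + x * (b - x').
  by rewrite mulrBl mulrBr addrA subrK.
have h1 : cnorm (a - x) < e / (cnorm x' + 1) / 2 := hN _ Nn.
have h2 : cnorm (b - x') < e / (cnorm x + 1) / 2 := hM _ Mn.
have h3 : cnorm (b - x') < 1 := hK _ Kn.
clearbody a b.
apply: (le_lt_trans (cnormD _ _)).
have bx : cnorm b <= cnorm x' + 1 by have := cnorm_split b x'; lra.
have k1 : cnorm ((a - x) * b) < e / 2.
  apply: (le_lt_trans (cnormM _ _)).
  apply: (le_lt_trans (ler_wpM2l (cnorm_ge0 _) bx)).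
  by move: h1; rewrite mulrAC ltr_pdivlMr.
have k2 : cnorm (x * (b - x')) <= e / 2.
  apply: (le_trans (cnormM _ _)); move: h2; rewrite mulrAC ltr_pdivlMr //.
  have := cnorm_ge0 (b - x'); nra.
lra.
Qed.

Lemma conv_star d x : conv d x -> conv (fun n => dstar (d n)) (star x).
Proof.
move=> [cd hx]; split=> [n /=|e /hx[N hN]]; first by rewrite cd.
by exists N => n /hN h; rewrite -[elt _]/(star (elt (d n).1)) -starB cnorm_starE.
Qed.

Lemma conv_evt d x : (forall n, (d n.+1).1 = (d n).2) ->
  (exists N, forall n, (N <= n)%N -> elt (d n).1 = x) -> conv d x.
Proof.
move=> cd [N hN]; split => // e e0; exists N => n /hN ->.
by rewrite subrr cnorm0.
Qed.

Lemma conv_one : conv (fun n => 1) 1.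
Proof. by apply: conv_evt => //; exists 0%N. Qed.

Lemma emb_elt n k (a : U n) : (n <= k)%N -> elt (emb k a) = elt a.
Proof. by rewrite /emb; case: {-}_ / idP. Qed.

Lemma psi_seq_compat n (a : U n) k : (psi_seq a k.+1).1 = (psi_seq a k).2.
Proof. by []. Qed.

Lemma conv_psi n (a : U n) : conv (psi_seq a) (elt a).
Proof. by apply: conv_evt => //; exists n => k nk; rewrite /psi_seq /= emb_elt. Qed.

Lemma dnorm_ge0 n (p : U n * U n.+1) : 0 <= dnorm p.
Proof. by rewrite /dnorm le_max cnorm_ge0. Qed.

Lemma dnorm_small d x (e : R) : conv d x -> 0 < e ->
  exists N, forall n, (N <= n)%N -> dnorm (d n) <= cnorm x + e.
Proof.
move=> [cd hx] /hx[N hN]; exists N => n Nn.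
rewrite /dnorm -cd ge_max; apply/andP; split; rewrite cnorm_elt.
  by have := hN _ Nn; have := cnorm_split (elt (d n).1) x; lra.
by have := hN _ (leqW Nn); have := cnorm_split (elt (d n.+1).1) x; lra.
Qed.

Lemma conv_bounded d x : conv d x -> dbounded d.
Proof.
move=> /dnorm_small/(_ ltr01)[N hN].
by have [C hC] := eventually_bounded (fun n => dnorm_ge0 (d n)) hN; exists C.
Qed.

Lemma supnorm_le d (C : R) : (forall n, dnorm (d n) <= C) -> supnorm d <= C.
Proof.
move=> h; apply: ge_sup; first by exists (dnorm (d 0%N)), 0%N.
by move=> _ [n _ <-].
Qed.

Lemma dnorm_le_supnorm d n : dbounded d -> dnorm (d n) <= supnorm d.
Proof.
move=> [C hC]; apply: ub_le_sup; last by exists n.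
by exists C => _ [k _ <-].
Qed.

Lemma cnorm_le_supnorm d x : conv d x -> cnorm x <= supnorm d.
Proof.
move=> hd; apply/ler_addgt0Pr => e e0; have [N hN] := hd.2 _ e0.
have := hN _ (leqnn N); have := cnorm_split x (elt (d N).1); rewrite (cnorm_distC x).
have : cnorm (elt (d N).1) <= dnorm (d N) by rewrite /dnorm le_max cnorm_elt lexx.
have := dnorm_le_supnorm N (conv_bounded hd); lra.
Qed.

Lemma supnorm_ge0 d : 0 <= supnorm d.
Proof.
have [hb|hb] := pselect (dbounded d).
  exact: le_trans (dnorm_ge0 (d 0%N)) (dnorm_le_supnorm 0%N hb).
(* For an unbounded sequence [sup] takes its default value 0. *)
rewrite /supnorm sup_out // => -[_ [C hC]]; apply: hb; exists C => n.
by apply: hC; exists n.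
Qed.

Variables (p : nat -> A -> R) (K : R) (beta : nat -> R).
Hypothesis hp : stage_seminorms U p K.
Hypothesis beta_gt0 : forall n, 0 < beta n.
Hypothesis beta_sum : cvgn (series beta).
Let L := @stage_lip R A U p.

Lemma lip_pairP n (q : U n * U n.+1) (M : R) : (lip_pair L beta q <= M%:E)%E <->
  [/\ forall m, p m (elt q.1) <= M, forall m, p m (elt q.2) <= M
    & cnorm (elt q.1 - elt q.2) <= M * (2 * beta n)].
Proof.
have b2 : 0 < 2 * beta n by rewrite mulr_gt0.
rewrite /lip_pair !ge_max lee_fin ler_pdivrMr //; split.
  move=> /andP[/andP[h1 h2] h3]; split => // m; rewrite -lee_fin.
    by apply: le_trans h1; exact: sup_lip_ub.
  by apply: le_trans h2; exact: sup_lip_ub.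
move=> [h1 h2 h3]; rewrite h3 andbT; apply/andP.
by split; apply/sup_lip_leP => m; rewrite lee_fin.
Qed.

Lemma S0P d (M : R) : (S0 L beta d <= M%:E)%E <-> forall n, (lip_pair L beta (d n) <= M%:E)%E.
Proof.
split=> [/ereal_supP h n|h]; first by apply: h; exists n.
by apply/ereal_supP => _ [n _ <-].
Qed.

(** Finite [S0] bounds the gap between consecutive terms by a multiple of [beta n], so summability
    makes the sequence Cauchy. *)
Lemma compat_S0_conv d : (forall n, (d n.+1).1 = (d n).2) -> (S0 L beta d < +oo)%E ->
  exists x, conv d x.
Proof.
move=> cd Sd.
have [M SM] : exists M : R, (S0 L beta d <= M%:E)%E.
  case: (S0 L beta d) Sd => [r _|//|_]; first by exists r.
  by exists 0; exact: leNye.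
have hM n : cnorm (elt (d n).1 - elt (d n.+1).1) <= `|M| * 2 * beta n.
  have /S0P/(_ n)/lip_pairP[_ _ h] := SM; rewrite cd; apply: (le_trans h).
  rewrite mulrA; apply: ler_wpM2r; first exact: ltW.
  by apply: ler_wpM2r => //; exact: ler_norm.
have M0 : 0 <= `|M| * 2 by rewrite mulr_ge0.
have hk n k : cnorm (elt (d (n + k)%N).1 - elt (d n).1) <=
    `|M| * 2 * (series beta (n + k)%N - series beta n).
  elim: k => [|k IH]; first by rewrite addn0 !subrr mulr0 cnorm0.
  rewrite addnS; apply: (le_trans (cnorm_dist_trans (elt (d (n + k)%N).1) _ _)).
  rewrite cnorm_distC (_ : series beta (n + k).+1 = series beta (n + k)%N + beta (n + k)%N).
    by have := hM (n + k)%N; lra.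
  by rewrite /series /= big_nat_recr.
have [x hx] : exists l, forall e : R, 0 < e -> exists N, forall n, (N <= n)%N ->
    cnorm (elt (d n).1 - l) < e.
  apply: cnorm_complete => e e0; have e2 : 0 < e / 2 by lra.
  have [N hN] := summable_cauchy beta_gt0 beta_sum M0 e2.
  exists N => m n Nm Nn; apply: (le_lt_trans (cnorm_dist_trans (elt (d N).1) _ _)).
  rewrite (cnorm_distC (elt (d N).1)).
  have := hN _ (m - N)%N (leqnn N); have := hN _ (n - N)%N (leqnn N).
  by have := hk N (m - N)%N; have := hk N (n - N)%N; rewrite !subnKC //; lra.
by exists x; split.
Qed.

Lemma Sfrak0_conv d : Sfrak0 L beta d -> exists x, conv d x.
Proof.
move=> [_ [[[_ cr] Sr] [[_ ci] Si]]].
have [x hx] := compat_S0_conv cr Sr; have [y hy] := compat_S0_conv ci Si.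
exists ('i%C *: y + x); have := conv_linear 'i%C hy hx.
congr conv; apply: functional_extensionality_dep => n.
rewrite half_iC halfC scalerA mulrA mulrN mulii opprK mul1r -scalerDr.
have -> : d n - dstar (d n) + (d n + dstar (d n)) = d n + d n.
  by rewrite (AC (2*2) ((1*3)*(2*4))) /= addNr addr0.
by apply: injective_projections; exact: half_add.
Qed.

(** Uniform limits of convergent sequences converge. Together with [conv_G0], this makes [G0] the
    set of convergent sequences, and the quotient by [I0] amounts to taking limits in [A]. *)
Lemma G0_conv d : G0 L beta d -> exists x, conv d x.
Proof.
move=> [bd hd].
have ap (e : R) : 0 < e -> exists s x, conv s x /\ forall n, dnorm (d n - s n) < e.
  move=> e0; have [s Ss ds] := hd _ e0; have [x hx] := Sfrak0_conv Ss.
  exists s, x; split => // n; apply: le_lt_trans ds.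
  apply: (@dnorm_le_supnorm (fun n => d n - s n)).
  have [C hC] := bd; have [C' hC'] := conv_bounded hx; exists (C + C') => k.
  have := hC k; have := hC' k; rewrite /dnorm !ge_max => /andP[h1 h2] /andP[h3 h4].
  by apply/andP; split; apply: (le_trans (cnormB _ _)); lra.
have cd n : (d n.+1).1 = (d n).2.
  apply: (@eq_cnorm_le _ _ _ _ 2) => // e e0; have [s [x [[cs _] ds]]] := ap _ e0.
  have h1 : cnorm ((d n.+1).1 - (s n.+1).1) < e.
    by have := ds n.+1; rewrite /dnorm gt_max => /andP[].
  have h2 : cnorm ((s n.+1).1 - (d n).2) < e.
    by rewrite cs cnorm_distC; have := ds n; rewrite /dnorm gt_max => /andP[].
  by apply: (le_trans (cnorm_dist_trans (s n.+1).1 _ _)); lra.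
have [x hx] : exists l, forall e : R, 0 < e -> exists N, forall n, (N <= n)%N ->
    cnorm (elt (d n).1 - l) < e.
  apply: cnorm_complete => e e0; have e4 : 0 < e / 4 by lra.
  have [s [x [[_ hs] ds]]] := ap _ e4; have [N hN] := hs _ e4.
  have hd' n : (N <= n)%N -> cnorm (elt (d n).1 - x) < e / 2.
    move=> /hN h; apply: (le_lt_trans (cnorm_dist_trans (elt (s n).1) _ _)).
    have : cnorm (elt (d n).1 - elt (s n).1) < e / 4.
      by have := ds n; rewrite /dnorm gt_max => /andP[].
    lra.
  exists N => m n Nm Nn; apply: (le_lt_trans (cnorm_dist_trans x _ _)).
  by rewrite (cnorm_distC x); have := hd' _ Nm; have := hd' _ Nn; lra.
by exists x; split.
Qed.

(** Eventually constant sequences lie in [Sfrak0] whatever their initial terms: stage elements have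
    finite seminorm, and only finitely many pairs have distinct coordinates. They are uniformly
    dense among convergent sequences. *)
Let evt d a := (forall n, (d n.+1).1 = (d n).2) /\
  exists N, U N a /\ forall n, (N <= n)%N -> elt (d n).1 = a.

Let evt_L0 d a : evt d a -> (forall n, dstar (d n) = d n) -> L0 L beta d.
Proof.
move=> [cd [N [Ua hN]]] sd.
split; first by split => //; split => //; apply: (@conv_bounded _ a); apply: conv_evt => //; exists N.
have [M hM] := ssn_bounded hp Ua.
have pm n m : exists C : R, 0 <= C /\ (lip_pair L beta (d n) <= C%:E)%E.
  have [C1 hC1] := ssn_bounded hp (eltP (d n).1); have [C2 hC2] := ssn_bounded hp (eltP (d n).2).
  set z := cnorm (elt (d n).1 - elt (d n).2) / (2 * beta n).
  have z0 : 0 <= z by rewrite divr_ge0 // mulr_ge0 // ltW.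
  exists (`|C1| + `|C2| + z); split; first by rewrite !addr_ge0.
  have := ler_norm C1; have := ler_norm C2; have := normr_ge0 C1; have := normr_ge0 C2 => a1 a2 a3 a4.
  apply/lip_pairP; split=> [k|k|]; [have := hC1 k; lra|have := hC2 k; lra|].
  rewrite -ler_pdivrMr ?mulr_gt0 // -/z; lra.
have /choice[C hC] : forall n, exists C : R, 0 <= C /\ (lip_pair L beta (d n) <= C%:E)%E.
  by move=> n; exact: pm.
pose C' n : R := if (n < N)%N then C n else `|M|.
have [D hD] : exists D : R, forall n, C' n <= D.
  apply: (@eventually_bounded _ _ N `|M|) => n; rewrite /C'.
    by case: ifP => // _; exact: (hC n).1.
  by rewrite ltnNge => ->.
apply: (@le_lt_trans _ _ D%:E); last exact: ltry.
apply/S0P => n; have := hD n; rewrite /C'; case: ltnP => [_ CD|Nn MD].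
  by apply: le_trans (hC n).2 _; rewrite lee_fin.
have e1 : elt (d n).1 = a by exact: hN.
have e2 : elt (d n).2 = a by rewrite -cd; apply: hN; exact: leqW.
have := ler_norm M => MM.
apply/lip_pairP; rewrite e1 e2; split=> [k|k|]; [have := hM k; lra|have := hM k; lra|].
rewrite subrr cnorm0 mulr_ge0 ?(le_trans _ MD) // mulr_ge0 // ltW //.
Qed.

Let evt_lin (c : R[i]) d d' a a' : evt d a -> evt d' a' -> evt (fun n => c *: d n + d' n) (c *: a + a').
Proof.
move=> [cd [N [Ua hN]]] [cd' [N' [Ua' hN']]]; split=> [n /=|]; first by rewrite cd cd'.
exists (maxn N N'); split.
  apply: subcstarD; [apply: subcstarZ|]; apply: stage_le Ua || apply: stage_le Ua'.
    exact: leq_maxl.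
  exact: leq_maxr.
by move=> n; rewrite geq_max => /andP[Nn Nn']; rewrite -[elt _]/(c *: elt (d n).1 + elt (d' n).1) hN // hN'.
Qed.

Let evt_star d a : evt d a -> evt (fun n => dstar (d n)) (star a).
Proof.
move=> [cd [N [Ua hN]]]; split=> [n /=|]; first by rewrite cd.
exists N; split; first exact: subcstar_star.
by move=> n Nn; rewrite -[elt _]/(star (elt (d n).1)) hN.
Qed.

Let evt_Sfrak0 d a : evt d a -> Sfrak0 L beta d.
Proof.
move=> ed; split.
  by apply: (@conv_bounded _ a); case: ed => cd [N [_ hN]]; apply: conv_evt => //; exists N.
have e0 : evt (fun=> 0) 0.
  by split => //; exists 0%N; split => //; exact: (eltP (0 : U 0%N)).
have es := evt_star ed; split.
  have e1 := evt_lin 2^-1 (evt_lin 1 ed es) e0.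
  apply: (@evt_L0 _ (2^-1 *: (1 *: a + star a) + 0)).
    move: e1; congr evt; apply: functional_extensionality_dep => n.
    by rewrite scale1r addr0.
  by move=> n; rewrite halfC; apply: injective_projections; exact: sa_re_part.
have e1 := evt_lin (2 * 'i%C)^-1 (evt_lin (-1) es ed) e0.
apply: (@evt_L0 _ ((2 * 'i%C)^-1 *: (-1 *: star a + a) + 0)).
  move: e1; congr evt; apply: functional_extensionality_dep => n.
  by rewrite scaleN1r addr0 addrC.
move=> n.
have sc (B : cstarType R) (b : B) : star ((2 * 'i%C)^-1 *: (b - star b)) = (2 * 'i%C)^-1 *: (b - star b).
  rewrite half_iC starZ starB starK -opprB scalerN -scaleNr; congr (_ *: _).
  by apply/eqP; rewrite eq_complex /=; apply/andP; split; apply/eqP; lra.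
by apply: injective_projections; exact: sc.
Qed.

Lemma conv_G0 d x : conv d x -> G0 L beta d.
Proof.
move=> hd; split; first exact: conv_bounded hd.
move=> e e0; have e4 : 0 < e / 4 by lra.
have [cd hx] := hd; have [N hN] := hx _ e4.
(* The sequence frozen at its term of index [N]; later terms of [d] stay within [e / 2] of that
   term. *)
pose s : dseq U := fun n => if (n < N)%N then d n else psi_seq (d N).1 n.
have es : evt s (elt (d N).1).
  split=> [n|]; last first.
    exists N; split; first exact: eltP.
    by move=> n Nn; rewrite /s ltnNge Nn /= emb_elt.
  rewrite /s; case: (ltngtP n.+1 N) => [nN|nN|nN].
  - exact: cd.
  - exact: psi_seq_compat.
  - by rewrite -cd; apply: elt_inj; rewrite /= emb_elt ?nN.
exists s; first exact: evt_Sfrak0 es.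
apply: (@le_lt_trans _ _ (e / 2)); last by lra.
apply: supnorm_le => n; rewrite /s; case: ltnP => nN.
  by rewrite subrr /dnorm /= !cnorm0 maxxx; lra.
have h k : (N <= k)%N -> cnorm (elt (d k).1 - elt (d N).1) <= e / 2.
  move=> /hN h1; have := hN _ (leqnn N).
  by have := cnorm_dist_trans x (elt (d k).1) (elt (d N).1); rewrite (cnorm_distC x); lra.
rewrite /dnorm ge_max; apply/andP; split.
  by rewrite -[cnorm _]/(cnorm (elt (d n).1 - elt (emb n (d N).1))) emb_elt // h.
rewrite -[cnorm _]/(cnorm (elt (d n).2 - elt (emb n.+1 (d N).1))) -cd.
by rewrite emb_elt ?h // leqW.
Qed.

Lemma I0P d : I0 L beta d <-> conv d 0.
Proof.
split.
  move=> [/G0_conv[x [cd _]] /cvgrPdist_lt h]; split => // e /h[N _ hN]; exists N => n /hN /=.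
  rewrite sub0r normrN ger0_norm ?dnorm_ge0 // subr0 /dnorm gt_max => /andP[h1 _].
  exact: h1.
move=> hd; split; first exact: conv_G0 hd.
apply/cvgrPdist_lt => e e0; have e2 : 0 < e / 2 by lra.
have [N hN] := dnorm_small hd e2; exists N => // n /hN.
rewrite cnorm0 sub0r normrN ger0_norm ?dnorm_ge0 // /=; lra.
Qed.

Lemma quotient_norm d x : conv d x ->
  inf [set supnorm (fun n => d n + i n) | i in I0 L beta] = cnorm x.
Proof.
move=> hd; apply/eqP; rewrite eq_le; apply/andP; split; last first.
  apply: lb_le_inf.
    exists (supnorm (fun n => d n + 0)), (fun n => 0) => //; apply/I0P/conv_evt => //.
    by exists 0%N.
  move=> _ [i /I0P hi <-]; apply: cnorm_le_supnorm.
  have := conv_linear 1 hd hi; rewrite scale1r addr0.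
  by congr conv; apply: functional_extensionality_dep => n; rewrite scale1r.
apply/ler_addgt0Pr => e e0; have [N hN] := dnorm_small hd e0.
have [cd _] := hd.
(* Cancels the terms of [d] of index below [N]. Each coordinate tests the index of its own term, not
   of the pair, so that [i] remains compatible. *)
pose i : dseq U := fun n => (if (n < N)%N then - (d n).1 else 0, if (n.+1 < N)%N then - (d n).2 else 0).
have ci : conv i 0.
  apply: conv_evt; first by move=> n; rewrite /i /= cd.
  by exists N => n Nn; rewrite /i /= ltnNge Nn.
apply: (@le_trans _ _ (supnorm (fun n => d n + i n))).
  apply: ge_inf; last by exists i => //; exact/I0P.
  by exists 0 => _ [j _ <-]; exact: supnorm_ge0.
apply: supnorm_le => n; rewrite /dnorm /i /= ge_max.
have xe : 0 <= cnorm x + e by have := cnorm_ge0 x; lra.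
apply/andP; split.
  case: ltnP => nN; first by rewrite subrr cnorm0.
  by rewrite addr0; apply: le_trans (hN _ nN); rewrite /dnorm le_max lexx.
case: ltnP => nN; first by rewrite subrr cnorm0.
rewrite addr0 -cd; apply: le_trans (hN _ nN); rewrite /dnorm le_max lexx //.
Qed.

(* The seminorm of [x] is attained: [S0 d <= sup_lip p x] for some lift [d]. *)
Hypothesis surj : forall x, exists2 d, conv d x &
  sa x -> dsa d /\ (S0 L beta d <= sup_lip p x)%E.

(** The model of the quotient is [A] itself, with [q] the limit (0 when there is none) and [psi] the
    identity. *)
Lemma limit_lip_norm_exists : exists Linf : A -> \bar R, limit_lip_norm L beta Linf.
Proof.
pose q d : A := xget 0 [set x | conv d x].
have qE d x : conv d x -> q d = x.
  by move=> hd; rewrite /q; case: xgetP => [y _ hy|/(_ x)//]; exact: conv_uniq hd.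
exists (L_tau L beta q), A, q, id; split => //.
- split.
  + by move=> c d d' /G0_conv[x hx] /G0_conv[y hy]; rewrite (qE _ _ (conv_linear c hx hy)) (qE _ _ hx) (qE _ _ hy).
  + exact/qE/conv_one.
  + by move=> d d' /G0_conv[x hx] /G0_conv[y hy]; rewrite (qE _ _ (conv_mul hx hy)) (qE _ _ hx) (qE _ _ hy).
  + by move=> d /G0_conv[x hx]; rewrite (qE _ _ (conv_star hx)) (qE _ _ hx).
  + by move=> x; have [d hd _] := surj x; exists d; [exact: conv_G0 hd|exact: qE].
  + move=> d /G0_conv[x hx]; rewrite (qE _ _ hx); split=> [x0|/I0P h]; last exact: conv_uniq hx h.
    by apply/I0P; rewrite -x0.
  + by move=> d /G0_conv[x hx]; rewrite (quotient_norm hx) (qE _ _ hx).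
- by exists id.
- by move=> n a; rewrite (qE _ _ (conv_psi a)).
Qed.

Lemma limit_lip_normE Linf : limit_lip_norm L beta Linf ->
  forall a, sa a -> Linf a = sup_lip p a.
Proof.
move=> [F [q [psi [hq hpsi bpsi psiE LE]]]] a ha; rewrite LE //.
have qB d d' x x' : conv d x -> conv d' x' -> cnorm (q d - q d') = cnorm (x - x').
  move=> hd hd'; have h := conv_linear (-1) hd' hd.
  have -> : q d - q d' = q (fun n => -1 *: d' n + d n).
    by rewrite (quo_linear hq) ?scaleN1r 1?addrC //; apply: conv_G0; [exact: hd'|exact: hd].
  by rewrite (quo_norm hq (conv_G0 h)) (quotient_norm h) scaleN1r addrC.
(* Replace [d] by [psi_seq] of one of its late terms, where [q] is known: by [qB] the map [q] is
   isometric for the norm of limits, and [psi] is contractive. *)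
have qE d x : conv d x -> q d = psi x.
  move=> hd; apply: (@eq_cnorm_le _ _ _ _ 2) => // e e0.
  have [N hN] := hd.2 _ e0; have h := hN _ (leqnn N).
  apply: (le_trans (cnorm_dist_trans (psi (elt (d N).1)) _ _)).
  rewrite -(star_homB hpsi) {1}psiE (qB _ _ _ _ hd (conv_psi _)).
  by have := star_hom_contractive hpsi (elt (d N).1 - x); rewrite (cnorm_distC x); lra.
apply/eqP; rewrite eq_le; apply/andP; split.
  have [d hd /(_ ha)[sd Sd]] := surj a.
  apply: ereal_inf_le; exists (S0 L beta d) => //; exists d => //.
  by split; [exact: conv_G0 hd|split => //; exact: qE].
apply: le_ereal_inf_tmp => _ [d [/G0_conv[x hd] [_ qd]] <-].
have {qd} xa : x = a by apply: (bij_inj bpsi); rewrite -(qE _ _ hd).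
subst x; apply/sup_lip_leP => m.
have [Sd|Sd] := ltP (S0 L beta d) +oo%E; last by apply: le_trans Sd; exact: leey.
have : (0 <= S0 L beta d)%E.
  apply: (@le_trans _ _ (lip_pair L beta (d 0%N))); last by apply: ereal_sup_ubound; exists 0%N.
  by rewrite le_max; apply/orP; right; apply: divr_ge0 => //; rewrite mulr_ge0 // ltW.
case E: (S0 L beta d) Sd => [M|//|//] _ _.
have /S0P SM : (S0 L beta d <= M%:E)%E by rewrite E.
(* [p m] is at most [M] on the terms of the lift and is continuous, so the bound passes to their
   limit. *)
rewrite lee_fin; apply/ler_addgt0Pr => e e0.
have [C hC] := csn_bound (ssn_csn hp m).
have C1 : 0 < `|C| + 1 by apply: ltr_wpDl.
have [N hN] := hd.2 _ (divr_gt0 e0 C1); have := hN _ (leqnn N).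
rewrite ltr_pdivlMr // => h; have /lip_pairP[/(_ m) pM _ _] := SM N.
have := csn_split (ssn_csn hp m) a (elt (d N).1); have := hC (a - elt (d N).1).
rewrite (cnorm_distC a); have := ler_norm C; have := cnorm_ge0 (elt (d N).1 - a); nra.
Qed.

End ConvergentSequences.

Section LimitOfStages.
Variables (R : realType) (A : cstarType R) (U : filtration A) (beta : nat -> R).
Variable E : forall n, U n.+1 -> U n.
Hypothesis hU : af_filtration U.
Hypothesis beta_gt0 : forall j, 0 < beta j.
Hypothesis beta_sum : cvgn (series beta).
Hypothesis hE : forall n, cond_exp (stage_inclusion U n) (@E n).

Let dev := dev beta hE.
Let L := @stage_lip R A U dev.

Lemma limE_surj x : exists2 d : dseq U, conv d x &
  sa x -> dsa d /\ (S0 L beta d <= sup_lip dev x)%E.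
Proof.
pose d : dseq U := fun n => (mkelt (limE_mem hE n x), mkelt (limE_mem hE n.+1 x)).
have hd : conv d x.
  split=> // e e0; have e2 : 0 < e / 2 by lra.
  have [n [y [Uy xy]]] := stage_approx U x e2.
  exists n => k nk /=; rewrite cnorm_distC; apply: (le_lt_trans (cnorm_dist_trans y _ _)).
  rewrite -{2}(limE_id hE (stage_le nk Uy)).
  by have := limE_lip hE k y x; rewrite (cnorm_distC y); lra.
exists d => // hx; split.
  split; first exact: conv_bounded hd.
  by move=> n; apply: injective_projections; apply: elt_inj; exact: (limE_sa hE _ hx).
apply/ereal_supP => _ [n _ <-]; rewrite /lip_pair !ge_max /=; apply/andP; split.
  by apply/andP; split; apply/sup_lip_leP => m; apply: le_trans (sup_lip_ub dev m x);
    rewrite lee_fin; exact: dev_limE.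
apply: le_trans (sup_lip_ub dev n x); rewrite lee_fin ler_pdivrMr ?mulr_gt0 //.
have /(dev_le beta_gt0 hE) := lexx (dev n x).
(* The later projection fixes [limE hE n x], so the gap is a contraction applied to
   [limE hE n x - x], whose norm [dev n x * beta n] is half of what is allowed. *)
have -> : limE hE n x - limE hE n.+1 x = limE hE n.+1 (limE hE n x - x).
  by rewrite limEB (limE_id hE (stage_incr (limE_mem hE n x))).
have := limE_contr hE n.+1 (limE hE n x - x); rewrite (cnorm_distC _ x).
have : 0 <= dev n x * beta n by apply: mulr_ge0; [exact: csn_ge0 (dev_csn beta_gt0 hE n) x|exact: ltW].
rewrite mulrCA; lra.
Qed.

Lemma dev_limit_exists : exists Linf : A -> \bar R, limit_lip_norm L beta Linf.
Proof.
exact: (limit_lip_norm_exists (dev_ssn hU beta_gt0 hE) beta_gt0 beta_sum limE_surj).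
Qed.

Lemma dev_limitE Linf : limit_lip_norm L beta Linf ->
  forall a, sa a -> Linf a = sup_lip dev a.
Proof.
exact: (limit_lip_normE (dev_ssn hU beta_gt0 hE) beta_gt0 beta_sum limE_surj).
Qed.

End LimitOfStages.

(** * Tunnels *)

Section DirectSum.
Variables (R : realType) (B1 B2 : cstarType R).

Let pstar (x : B1 * B2) : B1 * B2 := (star x.1, star x.2).
Let pnorm (x : B1 * B2) : R := Num.max (cnorm x.1) (cnorm x.2).

Let pstarK : involutive pstar.
Proof. by case=> a b; rewrite /pstar /= !starK. Qed.
Let pstarD : {morph pstar : a b / a + b}.
Proof. by move=> x y; apply: injective_projections; exact: starD. Qed.
Let pstarZ (c : R[i]) a : pstar (c *: a) = conjc c *: pstar a.
Proof. by apply: injective_projections; exact: starZ. Qed.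
Let pstarM a b : pstar (a * b) = pstar b * pstar a.
Proof. by apply: injective_projections; exact: starM. Qed.
Let pnormD a b : pnorm (a + b) <= pnorm a + pnorm b.
Proof.
rewrite /pnorm ge_max; apply/andP; split; apply: (le_trans (cnormD _ _));
  by apply: lerD; rewrite le_max lexx ?orbT.
Qed.
Let pnormZ (c : R[i]) a : pnorm (c *: a) = normc c * pnorm a.
Proof.
rewrite /pnorm maxr_pMr; last by case: c => u v; rewrite /= sqrtr_ge0.
by congr Num.max; exact: cnormZ.
Qed.
Let pnorm0_eq0 a : pnorm a = 0 -> a = 0.
Proof.
move=> a0; have : pnorm a <= 0 by rewrite a0.
rewrite /pnorm ge_max => /andP[h1 h2].
by apply: injective_projections; apply: cnorm0_eq0; apply/eqP; rewrite eq_le cnorm_ge0 andbT.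
Qed.
Let pnormM a b : pnorm (a * b) <= pnorm a * pnorm b.
Proof.
rewrite /pnorm ge_max; apply/andP; split; apply: (le_trans (cnormM _ _));
  by apply: ler_pM => //; rewrite le_max lexx ?orbT.
Qed.
Let pnorm_star a : pnorm (pstar a * a) = pnorm a ^+ 2.
Proof.
rewrite /pnorm /= !cnorm_star; apply/eqP; rewrite eq_le; apply/andP; split.
  by rewrite ge_max !ler_pXn2r ?nnegrE ?le_max ?cnorm_ge0 ?lexx ?orbT.
have [h|h] := leP (cnorm a.1) (cnorm a.2); first by rewrite le_max lexx orbT.
by rewrite le_max lexx.
Qed.

Let pnorm_complete (u : nat -> B1 * B2) :
  (forall e : R, 0 < e -> exists N, forall m n, (N <= m)%N -> (N <= n)%N ->
     pnorm (u m - u n) < e) ->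
  exists l, forall e : R, 0 < e -> exists N, forall n, (N <= n)%N ->
     pnorm (u n - l) < e.
Proof.
move=> hu.
have [l1 h1] : exists l, forall e : R, 0 < e -> exists N, forall n, (N <= n)%N -> cnorm ((u n).1 - l) < e.
  apply: cnorm_complete => e /hu[N hN]; exists N => m n Nm Nn.
  by have := hN _ _ Nm Nn; rewrite /pnorm gt_max => /andP[].
have [l2 h2] : exists l, forall e : R, 0 < e -> exists N, forall n, (N <= n)%N -> cnorm ((u n).2 - l) < e.
  apply: cnorm_complete => e /hu[N hN]; exists N => m n Nm Nn.
  by have := hN _ _ Nm Nn; rewrite /pnorm gt_max => /andP[].
exists (l1, l2) => e e0; have [N hN] := h1 _ e0; have [M hM] := h2 _ e0.
exists (maxn N M) => n; rewrite geq_max => /andP[/hN k1 /hM k2].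
by rewrite /pnorm gt_max; apply/andP.
Qed.

HB.instance Definition _ := Algebra_isCStar.Build R (B1 * B2)%type
  pstarK pstarD pstarZ pstarM pnormD pnormZ pnorm0_eq0 pnormM pnorm_star
  pnorm_complete.

Definition direct_sum : cstarType R := (B1 * B2)%type.

Implicit Types x y : direct_sum.

Lemma direct_sum_norm x : cnorm x = Num.max (cnorm x.1) (cnorm x.2).
Proof. by []. Qed.

Lemma cnorm_fst x : cnorm x.1 <= cnorm x.
Proof. by rewrite direct_sum_norm le_max lexx. Qed.

Lemma cnorm_snd x : cnorm x.2 <= cnorm x.
Proof. by rewrite direct_sum_norm le_max lexx orbT. Qed.

Lemma direct_sum_sa x : sa x <-> sa x.1 /\ sa x.2.
Proof.
by split=> [h|[h1 h2]]; [split; [exact: (congr1 fst h)|exact: (congr1 snd h)]|apply: injective_projections].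
Qed.

Lemma fst_star_hom : star_hom (fst : direct_sum -> B1).
Proof. by split. Qed.

Lemma snd_star_hom : star_hom (snd : direct_sum -> B2).
Proof. by split. Qed.

Lemma tb_prod (S1 : set B1) (S2 : set B2) : totally_bounded S1 -> totally_bounded S2 ->
  totally_bounded ([set x | S1 x.1 /\ S2 x.2] : set direct_sum).
Proof.
move=> t1 t2 e e0; have [F hF] := t1 _ e0; have [G hG] := t2 _ e0.
exists [seq (f, g) : direct_sum | f <- F, g <- G] => x [/hF[f fF xf] /hG[g gG xg]].
exists ((f, g) : direct_sum); first by apply/allpairsP; exists (f, g).
by rewrite direct_sum_norm ge_max; apply/andP.
Qed.

End DirectSum.

(** * States carried along maps that are positive on the stages *)

Section StatesOfDense.
Variables (R : realType) (A D : cstarType R) (U : filtration A) (T : A -> D) (mu : states D).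
Hypothesis T_lin : forall c a b, T (c *: a + b) = c *: T a + T b.
Hypothesis T1 : T 1 = 1.
Hypothesis T_contr : forall a, cnorm (T a) <= cnorm a.
Hypothesis T_pos : forall n (x : U n), exists y, T (elt (star x * x)) = star y * y.

Lemma ge0_closed (z : R[i]) :
  (forall e : R, 0 < e -> exists2 w : R[i], 0 <= w & normc (z - w) <= e) -> 0 <= z.
Proof.
case: z => u v h; rewrite lecE /=; apply/andP; split.
  have v0 : `|v| <= 0.
    apply/ler_addgt0Pr => e /h[[u' v']]; rewrite lecE /= => /andP[/eqP -> _].
    rewrite oppr0 addr0 add0r; apply: le_trans.
    by rewrite -sqrtr_sqr ler_sqrt ?lerDr ?sqr_ge0 // addr_ge0 ?sqr_ge0.
  by rewrite -normr_eq0 eq_le v0 normr_ge0.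
rewrite -oppr_le0; apply/ler_addgt0Pr => e /h[[u' v']]; rewrite lecE /= => /andP[_ u'0] k.
rewrite add0r; have : `|u - u'| <= e.
  apply: le_trans k; rewrite -sqrtr_sqr ler_sqrt ?lerDl ?sqr_ge0 //.
  by rewrite addr_ge0 ?sqr_ge0.
by rewrite ler_norml => /andP[+ _]; lra.
Qed.

Let TB a b : T (a - b) = T a - T b.
Proof. by have := T_lin (-1) b a; rewrite !scaleN1r (addrC (- b)) (addrC (- T b)). Qed.

Let pos a : 0 <= st mu (T (star a * a)).
Proof.
apply: ge0_closed => e e0; set k := cnorm a.
have k0 : 0 <= k := cnorm_ge0 a.
have K0 : 0 < 4 * k + 2 by lra.
(* [st_bound] contributes a factor 2, and [star a * a - star x * x] has norm at most
   [(2 * k + 1) * e'] once [cnorm x <= k + 1]; hence [4 * k + 2]. *)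
pose e' := Num.min 1 (e / (4 * k + 2)).
have e'0 : 0 < e' by rewrite /e' lt_min ltr01 divr_gt0.
have [n [x [Ux ax]]] := stage_approx U a e'0.
have [y hy] := T_pos (mkelt Ux).
exists (st mu (T (star x * x))).
  by rewrite -[star x * x]/(elt (star (mkelt Ux) * mkelt Ux)) hy st_pos.
rewrite -stB -TB; apply: (le_trans (st_bound _ _)).
apply: (@le_trans _ _ (2 * cnorm (star a * a - star x * x))).
  by apply: ler_wpM2l => //; exact: T_contr.
have -> : star a * a - star x * x = star a * (a - x) + star (a - x) * x.
  by rewrite starB mulrBl mulrBr addrA subrK.
have h1 := cnormM (star a) (a - x); have h2 := cnormM (star (a - x)) x.
rewrite !cnorm_starE in h1 h2.
have h3 := cnormD (star a * (a - x)) (star (a - x) * x).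
have xk : cnorm x <= k + e'.
  by have := cnorm_split x a; rewrite (cnorm_distC x) -/k; lra.
have e1 : e' <= 1 by rewrite /e' ge_min lexx.
have e2 : e' * (4 * k + 2) <= e by rewrite -ler_pdivlMr // /e' ge_min lexx orbT.
have d0 := cnorm_ge0 (a - x).
rewrite -/k in h1; move: h1 h2 h3 ax d0 xk.
set d := cnorm (a - x); set X := cnorm x; move=> h1 h2 h3 ax d0 xk.
clearbody d X k e'.
have : d * X <= d * (k + 1) by apply: ler_wpM2l => //; lra.
nra.
Qed.

Let lin : scalar (fun a => st mu (T a)).
Proof. by move=> c a b /=; rewrite T_lin st_lin. Qed.

Let one : st mu (T 1) = 1.
Proof. by rewrite T1 st1. Qed.

Definition dense_state : states A := state_of lin pos one.

End StatesOfDense.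

Section StateExistence.
Variables (R : realType) (A : cstarType R) (U : filtration A) (beta : nat -> R).
Variable E : forall n, U n.+1 -> U n.
Hypothesis hU : af_filtration U.
Hypothesis hE : forall n, cond_exp (stage_inclusion U n) (@E n).

Lemma scalar_inj (c c' : R[i]) : c *: 1 = c' *: 1 :> A -> c = c'.
Proof.
move=> h; apply/eqP; rewrite -subr_eq0; apply/eqP/eq0_normc.
have := cnormZ (c - c') (1 : A); rewrite cnorm1 mulr1 scalerBl h subrr cnorm0.
by move=> <-.
Qed.

Lemma scalars_state : exists phi : states (U 0), True.
Proof.
have /choice[f hf] : forall a : U 0, exists c : R[i], elt a = c *: 1.
  by move=> a; exact: (hU.2 _).1 (eltP a).
have fl : scalar f.
  move=> c a b; apply: scalar_inj.
  by rewrite -hf eltD eltZ !hf scalerA -scalerDl.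
have f1 : f 1 = 1 by apply: scalar_inj; rewrite -hf elt1 scale1r.
have fp (a : U 0) : 0 <= f (star a * a).
  have -> : f (star a * a) = f a * (f a)^*%C.
    apply: scalar_inj; rewrite -hf eltM elt_star hf starZ star1.
    by rewrite -scalerAl mul1r scalerA mulrC.
  exact: mulcJ_ge0.
by exists (state_of fl fp f1).
Qed.

(** The coefficient of 1 is a state of the zeroth stage, and the projection onto that stage carries
    it to [A]. *)
Lemma state_exists : exists phi : states A, True.
Proof.
have [mu _] := scalars_state.
pose T a : U 0 := mkelt (limE_mem hE 0 a).
have h1 c a b : T (c *: a + b) = c *: T a + T b.
  by apply: elt_inj; exact: limE_linear.
have h2 : T 1 = 1 by apply: elt_inj; exact: (limE_id hE (subcstar1 (U 0))).
have h3 a : cnorm (T a) <= cnorm a by exact: limE_contr.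
have h4 n (x : U n) : exists y, T (elt (star x * x)) = star y * y.
  have [b Ub hb] := limE_pos hE 0 x.
  by exists (mkelt Ub); apply: elt_inj.
by exists (dense_state mu h1 h2 h3 h4).
Qed.

End StateExistence.

Section Propinquity.
Variables (R : realType).

Lemma mk_ge0 (A : cstarType R) (L : A -> \bar R) (hL : is_lip_norm L) (phi psi : states A) :
  (0 <= mk L phi psi)%E.
Proof.
have b0 : lip_ball L 0.
  split; first exact: sa0.
  have -> : L 0 = 0%E by apply/(lip_ker hL (sa0 A)); exists 0; rewrite scale0r.
  exact: lee01.
apply: le_trans (mk_ub phi psi b0).
by rewrite !st0 subrr normc0.
Qed.

Lemma mk_refl (A : cstarType R) (L : A -> \bar R) (phi : states A) : (mk L phi phi <= 0)%E.
Proof. by apply/mk_leP => a _; rewrite subrr normc0. Qed.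

(** [Y] is a subset of all states, so one of the two directed distances is at most 0 by
    [mk_refl]. *)
Lemma hausdorff_mk_le (A : cstarType R) (L : A -> \bar R) (Y : set (states A)) (r : R) :
  0 <= r -> (forall phi, exists2 psi, Y psi & (mk L phi psi <= r%:E)%E) ->
  (hausdorff (mk L) setT Y <= r%:E)%E.
Proof.
move=> r0 h; rewrite /hausdorff ge_max; apply/andP; split.
  apply/ereal_supP => _ [phi _ <-]; have [psi Ypsi hpsi] := h phi.
  by apply: ereal_inf_le; exists (mk L phi psi) => //; exists psi.
apply/ereal_supP => _ [psi _ <-]; apply: ereal_inf_le; exists (mk L psi psi).
  by exists psi.
by apply: (le_trans (mk_refl _ _)); rewrite lee_fin.
Qed.

(** Pulled back to a tunnel, [phi] keeps the supremum in the Hausdorff distance from being empty. *)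
Lemma propinquity_ge0 (C D : R) (A1 A2 : cstarType R) (L1 : A1 -> \bar R) (L2 : A2 -> \bar R)
  (phi : states A2) : (0 <= propinquity C D L1 L2)%E.
Proof.
apply: le_ereal_inf_tmp => _ [t ->]; rewrite /extent le_max; apply/orP; left.
rewrite /hausdorff le_max; apply/orP; left.
apply: le_trans (ereal_sup_ubound _); last first.
  by exists (pull_state (tun_pi2_hom t) phi).
apply: le_ereal_inf_tmp => _ [psi _ <-].
exact/mk_ge0/tun_lip_norm.
Qed.

End Propinquity.

Section Tunnels.
Variables (R : realType) (A : cstarType R) (U : filtration A) (beta : nat -> R).
Variable E : forall n, U n.+1 -> U n.
Hypothesis hU : af_filtration U.
Hypothesis beta_gt0 : forall j, 0 < beta j.
Hypothesis beta_sum : cvgn (series beta).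
Hypothesis hE : forall n, cond_exp (stage_inclusion U n) (@E n).
Variable Linf : A -> \bar R.
Let dev := dev beta hE.
Hypothesis LinfE : forall a, sa a -> Linf a = sup_lip dev a.
Variable n : nat.
Let D : cstarType R := direct_sum (U n) A.
Let dssn := dev_ssn hU beta_gt0 hE.

(** Listing the three kinds of terms as one family lets [sup_lip_norm] and [sup_lip_leibniz] apply
    to the tunnel unchanged. *)
Definition tunnel_seminorm (i : option (nat + nat)) (d : D) : R :=
  match i with
  | None => cnorm (elt d.1 - d.2) / beta n
  | Some (inl m) => dev m (elt d.1)
  | Some (inr m) => dev m d.2
  end.

Let tlip : D -> \bar R := sup_lip tunnel_seminorm.

Let t_csn i : cont_seminorm (tunnel_seminorm i).
Proof.
have b0 : 0 <= (beta n)^-1 by rewrite invr_ge0 ltW.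
case: i => [[m|m]|].
- have h := ssn_csn dssn m; split.
  + by move=> d; exact: (csn_ge0 h).
  + by move=> c d; exact: (csn_scale h).
  + by move=> d d'; exact: (csn_add h).
  have [C hC] := csn_bound h; exists `|C| => d; apply: (le_trans (hC _)).
  exact: le_trans (ler_wpM2r (cnorm_ge0 _) (ler_norm C)) (ler_wpM2l (normr_ge0 C) (cnorm_fst d)).
- have h := ssn_csn dssn m; split.
  + by move=> d; exact: (csn_ge0 h).
  + by move=> c d; exact: (csn_scale h).
  + by move=> d d'; exact: (csn_add h).
  have [C hC] := csn_bound h; exists `|C| => d; apply: (le_trans (hC _)).
  exact: le_trans (ler_wpM2r (cnorm_ge0 _) (ler_norm C)) (ler_wpM2l (normr_ge0 C) (cnorm_snd d)).
split.
- by move=> d; apply: mulr_ge0.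
- by move=> c d; rewrite /tunnel_seminorm /= -scalerBr cnormZ mulrA.
- move=> d d'; rewrite /tunnel_seminorm /= opprD addrACA -mulrDl.
  by apply: ler_wpM2r => //; exact: cnormD.
exists (2 * (beta n)^-1) => d; rewrite /tunnel_seminorm mulrAC; apply: ler_wpM2r => //.
apply: (le_trans (cnormB _ _)).
by have := cnorm_fst d; have := cnorm_snd d; rewrite (cnorm_elt d.1); lra.
Qed.

Let t_mul i (d d' : D) : tunnel_seminorm i (d * d') <=
  2 * (cnorm d * tunnel_seminorm i d' + cnorm d' * tunnel_seminorm i d).
Proof.
have mono (x y u v p q : R) : x <= u -> y <= v -> 0 <= p -> 0 <= q ->
    2 * (x * p + y * q) <= 2 * (u * p + v * q).
  by move=> xu yv p0 q0; rewrite ler_pM2l //; apply: lerD; exact: ler_wpM2r.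
have b0 : 0 <= (beta n)^-1 by rewrite invr_ge0 ltW.
case: i => [[m|m]|] /=.
- apply: (le_trans (ssn_mul dssn m _ _)).
  by apply: mono; [exact: (cnorm_fst d)|exact: (cnorm_fst d')| |]; exact: (csn_ge0 (ssn_csn dssn m)).
- apply: (le_trans (ssn_mul dssn m _ _)).
  by apply: mono; [exact: (cnorm_snd d)|exact: (cnorm_snd d')| |]; exact: (csn_ge0 (ssn_csn dssn m)).
rewrite !mulrA -mulrDl mulrA; apply: ler_wpM2r => //.
set a := elt d.1; set a' := elt d'.1; set b := d.2; set b' := d'.2.
have -> : a * a' - b * b' = a * (a' - b') + (a - b) * b'.
  by rewrite mulrBr mulrBl addrA subrK.
have h1 := cnormM a (a' - b'); have h2 := cnormM (a - b) b'.
have h3 := cnormD (a * (a' - b')) ((a - b) * b').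
have h4 : cnorm a * cnorm (a' - b') <= cnorm d * cnorm (a' - b').
  by apply: ler_wpM2r => //; exact: cnorm_fst d.
have h5 : cnorm (a - b) * cnorm b' <= cnorm d' * cnorm (a - b).
  by rewrite mulrC; apply: ler_wpM2r => //; exact: cnorm_snd d'.
have h6 : 0 <= cnorm d * cnorm (a' - b') by rewrite mulr_ge0.
have h7 : 0 <= cnorm d' * cnorm (a - b) by rewrite mulr_ge0.
lra.
Qed.

Let t_one i : tunnel_seminorm i 1 = 0.
Proof.
case: i => [[m|m]|] /=; last by rewrite -[X in cnorm X]/(1 - 1 : A) subrr cnorm0 mul0r.
  exact: (dev_stage beta hE (subcstar1 (U m))).
exact: (dev_stage beta hE (subcstar1 (U m))).
Qed.

Let t_dist (d : D) : tunnel_seminorm None d <= 1 -> cnorm (elt d.1 - d.2) <= beta n.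
Proof. by rewrite /= ler_pdivrMr // mul1r. Qed.

Lemma tunnel_lip_norm : is_lip_norm tlip.
Proof.
have [k hk] := hU.1 n.
(* In the unit ball [d.2] is within [beta 0%N] of a scalar and [d.1] within [beta n] of [d.2];
   subtracting that scalar from both leaves [d.1] in a ball of radius [beta 0%N + beta n]. *)
apply: (sup_lip_norm None t_csn (fun _ _ => erefl) t_one _ _
  (tb_prod (tb_ball (beta 0%N + beta n) hk) (dev_tb hU beta_gt0 beta_sum hE))).
- move=> d e /direct_sum_sa[h1 h2] e0.
  have [m [b [Ub hb db]]] := sa_approx U h2 e0.
  exists ((d.1, b) : D); split.
  + exact/direct_sum_sa.
  + by rewrite direct_sum_norm /= subrr cnorm0 gt_max e0.
  have [M hM] := ssn_bounded dssn (eltP d.1); have [M' hM'] := ssn_bounded dssn Ub.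
  exists (`|M| + `|M'| + tunnel_seminorm None ((d.1, b) : D)).
  have := csn_ge0 (t_csn None) ((d.1, b) : D); have := ler_norm M; have := ler_norm M'.
  have := normr_ge0 M; have := normr_ge0 M' => a1 a2 a3 a4 a5.
  case=> [[j|j]|].
  + by have : tunnel_seminorm (Some (inl j)) ((d.1, b) : D) <= M := hM j; lra.
  + by have : tunnel_seminorm (Some (inr j)) ((d.1, b) : D) <= M' := hM' j; lra.
  + lra.
- move=> d /direct_sum_sa[h1 h2] h.
  have [r hr] := ssn_ker dssn h2 (h (Some (inr 0%N))).
  exists r; apply: injective_projections; last exact: hr.
  apply: elt_inj; rewrite eltZ elt1 -hr; apply/eqP; rewrite -subr_eq0; apply/eqP/cnorm0_eq0.
  have /eqP := h None; rewrite /= mulf_eq0 invr_eq0 (gt_eqF (beta_gt0 _)) orbF.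
  by move=> /eqP.
- move=> d /direct_sum_sa[h1 h2] h.
  have [r hr] := ssn_ball dssn h2 (h (Some (inr 0%N))).
  have ab := t_dist (h None).
  exists r; split.
    suff : cnorm (elt d.1 - r%:C%C *: 1) <= beta 0%N + beta n by [].
    by apply: (le_trans (cnorm_dist_trans d.2 _ _)); lra.
  split; last exact: hr.
  move=> m; apply: (le_trans (csnB (ssn_csn dssn m) _ _)).
  rewrite (csnZr (ssn_csn dssn m)) (ssn_stage dssn (subcstar1 (U m))) mulr0 addr0.
  exact: (h (Some (inr m))).
Qed.

Let t_quotient1 (a : U n) : sa a ->
  @stage_lip R A U dev n a = ereal_inf [set tlip d | d in [set d : D | sa d /\ d.1 = a]].
Proof.
move=> ha; apply/eqP; rewrite eq_le; apply/andP; split.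
  apply: le_ereal_inf_tmp => _ [d [_ <-] <-]; apply/sup_lip_leP => m.
  exact: (sup_lip_ub tunnel_seminorm (Some (inl m)) d).
apply: ereal_inf_le; exists (tlip ((a, elt a) : D)).
  exists ((a, elt a) : D) => //; split => //.
  by apply/direct_sum_sa; split => //; exact/elt_sa.
apply/sup_lip_leP => -[[m|m]|]; try exact: (sup_lip_ub dev m (elt a)).
rewrite /= subrr cnorm0 mul0r; exact: (sup_lip_ge0 0%N (ssn_csn dssn)).
Qed.

(** In the lift of [b] by its projection to the stage, the bridge term is exactly [dev n b], and
    [dev_limE] bounds the terms of the first coordinate. *)
Let t_quotient2 (b : A) : sa b ->
  Linf b = ereal_inf [set tlip d | d in [set d : D | sa d /\ d.2 = b]].
Proof.
move=> hb; rewrite LinfE //; apply/eqP; rewrite eq_le; apply/andP; split.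
  apply: le_ereal_inf_tmp => _ [d [_ <-] <-]; apply/sup_lip_leP => m.
  exact: (sup_lip_ub tunnel_seminorm (Some (inr m)) d).
pose d : D := (mkelt (limE_mem hE n b), b).
apply: ereal_inf_le; exists (tlip d).
  exists d => //; split => //; apply/direct_sum_sa; split => //.
  by apply/elt_sa; exact: limE_sa.
apply/sup_lip_leP => -[[m|m]|]; last first.
- by rewrite /= cnorm_distC; exact: (sup_lip_ub dev n b).
- exact: (sup_lip_ub dev m b).
by apply: le_trans (sup_lip_ub dev m b); rewrite lee_fin; exact: dev_limE.
Qed.

Definition stage_tunnel : tunnel 2 0 (@stage_lip R A U dev n) Linf :=
  @Tunnel R 2 0 (U n) _ A _ D tlip fst snd tunnel_lip_norm
    (sup_lip_leibniz t_csn (fun _ _ => erefl) t_mul)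
    (fst_star_hom (U n) A) (snd_star_hom (U n) A)
    (fun a => ex_intro _ ((a, 0) : D) erefl) (fun b => ex_intro _ ((0, b) : D) erefl)
    t_quotient1 t_quotient2.

Let near_state (mu nu : states D) (T : D -> D) :
  (forall d, st nu d = st mu (T d)) ->
  (forall d, sa d -> sa (T d)) -> (forall d, cnorm (d - T d) <= cnorm (elt d.1 - d.2)) ->
  (mk tlip mu nu <= (beta n)%:E)%E.
Proof.
move=> nuE Tsa dT; apply/mk_leP => d [hd Ld]; rewrite lee_fin nuE -stB.
apply: (le_trans (st_sa_bound _ (saB hd (Tsa _ hd)))); apply: (le_trans (dT d)).
apply: t_dist; rewrite -lee_fin; apply: le_trans Ld.
exact: (sup_lip_ub tunnel_seminorm None d).
Qed.

(* A state [mu] of the direct sum is close to [mu (a, a)] and to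
   [mu (limE n b, b)], which are pulled back from [U n] and from [A]. *)
Lemma stage_tunnel_extent : (extent stage_tunnel <= (beta n)%:E)%E.
Proof.
rewrite /extent ge_max; apply/andP; split; apply: hausdorff_mk_le; try exact: ltW; move=> mu.
  pose h (a : U n) : D := (a, elt a).
  have hh : star_hom h by split.
  exists (pull_state (fst_star_hom (U n) A) (pull_state hh mu)).
    by exists (pull_state hh mu).
  apply: (near_state (T := fun d => h d.1)) => //.
    by move=> d /direct_sum_sa[h1 h2]; exact: star_hom_sa.
  move=> d; rewrite direct_sum_norm /= subrr cnorm0 cnorm_distC ge_max lexx andbT.
  exact: cnorm_ge0.
(* [T] is not multiplicative, so [mu] is carried along it by [dense_state] instead of
   [pull_state]. *)
pose T (b : A) : D := (mkelt (limE_mem hE n b), b).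
have h1 c a b : T (c *: a + b) = c *: T a + T b.
  by apply: injective_projections => //; apply: elt_inj; exact: limE_linear.
have h2 : T 1 = 1.
  by apply: injective_projections => //; apply: elt_inj; exact: (limE_id hE (subcstar1 (U n))).
have h3 a : cnorm (T a) <= cnorm a.
  by rewrite direct_sum_norm ge_max lexx andbT; exact: limE_contr.
have h4 k (x : U k) : exists y, T (elt (star x * x)) = star y * y.
  have [b Ub hb] := limE_pos hE n x; exists ((mkelt Ub, elt x) : D).
  by apply: injective_projections => //; apply: elt_inj.
pose phi := dense_state mu h1 h2 h3 h4.
exists (pull_state (snd_star_hom (U n) A) phi); first by exists phi.
apply: (near_state (T := fun d => T d.2)) => //.
  move=> d /direct_sum_sa[k1 k2]; apply/direct_sum_sa; split => //.
  by apply/elt_sa; exact: limE_sa.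
move=> d; rewrite direct_sum_norm /= subrr cnorm0 ge_max cnorm_ge0 andbT.
rewrite -[cnorm _]/(cnorm (elt d.1 - limE hE n d.2)).
(* The projection fixes [d.1], so contractivity compares it with the projection of [d.2]. *)
rewrite -{1}(limE_id hE (eltP d.1)) -limEB; exact: limE_contr.
Qed.

Lemma propinquity_stage : (propinquity 2 0 (@stage_lip R A U dev n) Linf <= (beta n)%:E)%E.
Proof.
by apply: ereal_inf_le; exists (extent stage_tunnel); [exists stage_tunnel|exact: stage_tunnel_extent].
Qed.

End Tunnels.

(** * Approximability without conditional expectations *)

Section Distance.
Variables (R : realType) (A : cstarType R) (B : subcstar A).
Implicit Types a b : A.

Definition dist_to a : R := inf [set cnorm (a - b) | b in [set b | B b]].

Let has_lb a : has_lbound [set cnorm (a - b) | b in [set b | B b]].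
Proof. by exists 0 => _ [b _ <-]. Qed.

Let B0 : B 0.
Proof. by rewrite -(scale0r (1 : A)); exact: subcstar_scalar. Qed.

Lemma dist_to_le a b : B b -> dist_to a <= cnorm (a - b).
Proof. by move=> Bb; apply: ge_inf => //; exists b. Qed.

Lemma dist_to_ge0 a : 0 <= dist_to a.
Proof. by apply: lb_le_inf; [exists (cnorm (a - 0)), 0|move=> _ [b _ <-]]. Qed.

Lemma dist_to_near a (x : R) : dist_to a < x -> exists2 b, B b & cnorm (a - b) < x.
Proof.
move=> ax; have hi : has_inf [set cnorm (a - b) | b in [set b | B b]].
  by split => //; exists (cnorm (a - 0)), 0.
have e0 : 0 < x - dist_to a by lra.
have [_ [b Bb <-] h] := inf_adherent e0 hi.
exists b => //; move: h; rewrite -/(dist_to a); lra.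
Qed.

Lemma dist_to_mem a : B a -> dist_to a = 0.
Proof.
move=> Ba; apply/eqP; rewrite eq_le dist_to_ge0 andbT.
by have := dist_to_le a Ba; rewrite subrr cnorm0.
Qed.

Lemma dist_to_eq0 a : dist_to a = 0 -> B a.
Proof.
by move=> a0; apply: subcstar_lim => e e0; apply: dist_to_near; rewrite a0.
Qed.

Let scale_le (c : R[i]) a : dist_to (c *: a) <= normc c * dist_to a.
Proof.
have c0 : 0 <= normc c by case: c => u v; rewrite /= sqrtr_ge0.
apply/ler_addgt0Pr => e e0; have c1 : 0 < normc c + 1 by lra.
have e1 : 0 < e / (normc c + 1) by rewrite divr_gt0.
have [b Bb ab] : exists2 b, B b & cnorm (a - b) < dist_to a + e / (normc c + 1).
  by apply: dist_to_near; lra.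
apply: (le_trans (dist_to_le _ (subcstarZ c Bb))); rewrite -scalerBr cnormZ.
apply: (le_trans (ler_wpM2l c0 (ltW ab))); rewrite mulrDr lerD2l mulrCA ger_pMr //.
by rewrite ler_pdivrMr //; lra.
Qed.

Lemma dist_to_csn : cont_seminorm dist_to.
Proof.
split.
- exact: dist_to_ge0.
- move=> c a; apply/eqP; rewrite eq_le scale_le /=.
  have [->|c0] := eqVneq c 0; first by rewrite normc0 mul0r dist_to_ge0.
  have nc : 0 < normc c.
    rewrite lt_neqAle; apply/andP; split; last by case: (c) => u v; rewrite /= sqrtr_ge0.
    by rewrite eq_sym; apply: contra_neq c0; exact: eq0_normc.
  rewrite -ler_pdivlMl // -normcV -{1}(scale1r a) -(mulVf c0) -scalerA; exact: scale_le.
- move=> a b; apply/ler_addgt0Pr => e e0; have e2 : 0 < e / 2 by lra.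
  have [a' Ba aa] : exists2 a', B a' & cnorm (a - a') < dist_to a + e / 2 by apply: dist_to_near; lra.
  have [b' Bb bb] : exists2 b', B b' & cnorm (b - b') < dist_to b + e / 2 by apply: dist_to_near; lra.
  apply: (le_trans (dist_to_le _ (subcstarD Ba Bb))).
  by rewrite opprD addrACA; apply: (le_trans (cnormD _ _)); lra.
- by exists 1 => a; have := dist_to_le a B0; rewrite subr0 mul1r.
Qed.

(* A near best approximation [b] of [a] in [B] has norm at most [2 * cnorm a], up
   to an error. *)
Lemma dist_to_mul a a' : dist_to (a * a') <= 2 * (cnorm a * dist_to a' + cnorm a' * dist_to a).
Proof.
set d := dist_to a; set d' := dist_to a'.
have d0 : 0 <= d := dist_to_ge0 a.
have d'0 : 0 <= d' := dist_to_ge0 a'.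
have n0 := cnorm_ge0 a; have n'0 := cnorm_ge0 a'.
have d'n : d' <= cnorm a' by have := dist_to_le a' B0; rewrite subr0.
(* [K] collects the coefficients of [e] in [h1] and [h2], the final 1 standing for [e * e <= e]. *)
set K := cnorm a + d + 2 * cnorm a' + 1.
have K0 : 0 < K by rewrite /K; lra.
apply/ler_addgt0Pr => e' e'0; pose e := Num.min 1 (e' / K).
have e0 : 0 < e by rewrite /e lt_min ltr01 divr_gt0.
have e1 : e <= 1 by rewrite /e ge_min lexx.
have eK : e * K <= e' by rewrite -ler_pdivlMr // /e ge_min lexx orbT.
have [b Bb ab] : exists2 b, B b & cnorm (a - b) < d + e by apply: dist_to_near; rewrite -/d; lra.
have [b' Bb' ab'] : exists2 b, B b & cnorm (a' - b) < d' + e by apply: dist_to_near; rewrite -/d'; lra.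
apply: (le_trans (dist_to_le _ (subcstarM Bb Bb'))).
have -> : a * a' - b * b' = a * (a' - b') + (a - b) * b'.
  by rewrite mulrBr mulrBl addrA subrK.
apply: (le_trans (cnormD _ _)).
have h1 : cnorm (a * (a' - b')) <= cnorm a * (d' + e).
  by apply: (le_trans (cnormM _ _)); apply: ler_wpM2l => //; exact: ltW.
have h2 : cnorm ((a - b) * b') <= (d + e) * (2 * cnorm a' + e).
  apply: (le_trans (cnormM _ _)); apply: ler_pM => //; first exact: ltW.
  by have := cnorm_split b' a'; rewrite (cnorm_distC b'); lra.
have h3 : 0 <= cnorm a * d' by rewrite mulr_ge0.
have h4 : e * e <= e by rewrite ger_pMr.
rewrite /K in eK; nra.
Qed.

End Distance.

Section DistanceSeminorms.
Variables (R : realType) (A : cstarType R) (U : filtration A) (beta : nat -> R).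
Hypothesis hU : af_filtration U.
Hypothesis beta_gt0 : forall j, 0 < beta j.
Hypothesis beta_sum : cvgn (series beta).

(* The weights decay fast enough for an element of [U n.+1] of seminorm at most 1
   to be moved into the unit ball of [U n] at a cost of at most [beta n]. *)
Fixpoint weight n : R :=
  if n is n'.+1 then weight n' * (Num.min 1 (beta n) / 10) else Num.min 1 (beta 0%N) / 2.

Let minb n : 0 < Num.min 1 (beta n).
Proof. by rewrite lt_min ltr01 beta_gt0. Qed.

Let weight_gt0 n : 0 < weight n.
Proof.
elim: n => [|n IH] /=; first by rewrite divr_gt0.
by rewrite mulr_gt0 // divr_gt0.
Qed.

Let weightS n : weight n.+1 <= weight n.
Proof.
have h : Num.min 1 (beta n.+1) <= 1 by rewrite ge_min lexx.
by rewrite /= ger_pMr // ler_pdivrMr //; lra.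
Qed.

Let weight_le m n : (m <= n)%N -> weight n <= weight m.
Proof.
move=> /subnK <-; elim: (n - m)%N => [//|k IH]; rewrite addSn.
exact: le_trans (weightS _) IH.
Qed.

Let weight_le1 n : weight n <= 2^-1.
Proof.
apply: le_trans (weight_le (leq0n n)) _; rewrite /=.
by have : Num.min 1 (beta 0%N) <= 1; [rewrite ge_min lexx|lra].
Qed.

Definition wdist m (a : A) : R := dist_to (U m) a / weight m.

Let wdist_le m a x : wdist m a <= x <-> dist_to (U m) a <= x * weight m.
Proof. by rewrite /wdist ler_pdivrMr. Qed.

(** The factor 2 replaces a best approximation by a near best one; taking real parts makes the
    scalar real. *)
Let scalar_near a : sa a -> wdist 0 a <= 1 -> exists r : R, cnorm (a - r%:C%C *: 1) <= 2 * weight 0.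
Proof.
move=> ha /wdist_le; rewrite mul1r => h.
have [b Ub ab] : exists2 b, U 0 b & cnorm (a - b) < 2 * weight 0.
  by apply: dist_to_near; have := weight_gt0 0; lra.
have [c bc] := (hU.2 _).1 Ub; exists (complex.Re c).
rewrite -re_part_scalar -bc; apply: (le_trans (re_part_dist _ ha)); exact: ltW.
Qed.

Lemma wdist_ssn : stage_seminorms U wdist (2 * weight 0).
Proof.
have w0 m : 0 <= (weight m)^-1 by rewrite invr_ge0 ltW.
split.
- move=> m; have h := dist_to_csn (U m); split.
  + by move=> a; apply: mulr_ge0 => //; exact: dist_to_ge0.
  + by move=> c a; rewrite /wdist (csn_scale h) mulrA.
  + by move=> a b; rewrite /wdist -mulrDl; apply: ler_wpM2r => //; exact: (csn_add h).
  + have [C hC] := csn_bound h; exists (C / weight m) => a.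
    by rewrite /wdist mulrAC; apply: ler_wpM2r.
- by move=> m a Ua; rewrite /wdist dist_to_mem // mul0r.
- move=> m a b; have -> : 2 * (cnorm a * wdist m b + cnorm b * wdist m a) =
      2 * (cnorm a * dist_to (U m) b + cnorm b * dist_to (U m) a) / weight m.
    by rewrite /wdist !mulrA -mulrDl mulrA.
  by apply: ler_wpM2r => //; exact: dist_to_mul.
- exact: scalar_near.
move=> a ha /eqP; rewrite mulf_eq0 invr_eq0 (gt_eqF (weight_gt0 _)) orbF => /eqP/dist_to_eq0 Ua.
have [c ac] := (hU.2 _).1 Ua; move: ha; rewrite ac; exact: sa_scalarP.
Qed.

(** A near best approximant [a1] of [b] may leave the unit ball, but by a factor at most
    [1 + 2 * t], where [t] is a ratio of consecutive weights. Shrinking it by that factor towards a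
    nearby scalar, where all seminorms vanish, brings it back. *)
Let bridge n b : U n.+1 b -> sa b -> (forall m, wdist m b <= 1) ->
  exists a, [/\ U n a, sa a, forall m, wdist m a <= 1 & cnorm (a - b) <= beta n].
Proof.
move=> Ub hb db; have [r br] := scalar_near hb (db 0%N).
have Ur m : U m (r%:C%C *: 1) by exact: subcstar_scalar.
case: n Ub => [|n] Ub.
  (* The zeroth stage holds only scalars; the cost [2 * weight 0] is [Num.min 1 (beta 0%N)]. *)
  exists (r%:C%C *: 1); split => //; first exact: sa_scalar.
    by move=> m; rewrite (ssn_stage wdist_ssn).
  rewrite cnorm_distC; apply: (le_trans br); rewrite /= mulrC divfK //.
  by rewrite ge_min lexx orbT.
have wn := weight_gt0 n; have wn1 := weight_gt0 n.+1.
set w := weight n in wn; set v := weight n.+1 in wn1.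
have [a0 Ua0 ba0] : exists2 a, U n.+1 a & cnorm (b - a) < 2 * v.
  apply: dist_to_near; have /wdist_le := db n.+1; rewrite mul1r -/v; lra.
pose a1 := re_part a0.
have Ua1 : U n.+1 a1 by exact: subcstar_re_part.
have ba1 : cnorm (b - a1) <= 2 * v by apply: (le_trans (re_part_dist _ hb)); exact: ltW.
pose t := v / w; have t0 : 0 < t by rewrite divr_gt0.
pose s := (1 + 2 * t)^-1; have s0 : 0 < s by rewrite invr_gt0; lra.
have st : s * (1 + 2 * t) = 1 by rewrite mulVf //; lra.
pose a := r%:C%C *: 1 + s%:C%C *: (a1 - r%:C%C *: 1).
have Ua : U n.+1 a by apply: subcstarD => //; apply: subcstarZ; exact: subcstarB.
exists a; split => //.
- by apply: saD; [exact: sa_scalar|apply: saZ; apply: saB; [exact: sa_re_part|exact: sa_scalar]].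
- move=> m; have [mn|nm] := leqP m n; last by rewrite (ssn_stage wdist_ssn) //; exact: stage_le Ua.
  apply/wdist_le; rewrite mul1r; have h := dist_to_csn (U m).
  have wm : w <= weight m by exact: weight_le.
  apply: (le_trans (csn_add h _ _)); rewrite (dist_to_mem (Ur m)) add0r (csnZr h) gtr0_norm //.
  apply: (le_trans (ler_wpM2l (ltW s0) (csnB h _ _))); rewrite (dist_to_mem (Ur m)) addr0.
  have k1 : dist_to (U m) a1 <= 2 * v + weight m.
    apply: (le_trans (csn_split h _ b)); apply: lerD.
      apply: le_trans ba1; rewrite cnorm_distC -[leRHS](congr1 cnorm (subr0 _)).
      by apply: dist_to_le; rewrite -(scale0r (1 : A)); exact: subcstar_scalar.
    by have /wdist_le := db m; rewrite mul1r.
  have tw : t * w = v by rewrite /t divfK // gt_eqF.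
  have tm : v <= t * weight m by rewrite -tw; apply: ler_wpM2l => //; exact: ltW.
  apply: (le_trans (ler_wpM2l (ltW s0) k1)).
  have k2 : 2 * v + weight m <= (1 + 2 * t) * weight m by lra.
  by apply: (le_trans (ler_wpM2l (ltW s0) k2)); rewrite mulrA st mul1r.
have e1 : a - b = (1 - s)%:C%C *: (r%:C%C *: 1 - a1) + (a1 - b).
  rewrite rmorphB rmorph1 scalerBl scale1r /a -scalerN opprB.
  by rewrite addrA; congr (_ - _); rewrite addrAC subrK.
have s1 : 0 <= 1 - s by have : s * (1 + 2 * t) = 1 := st; nra.
have n1 : cnorm (r%:C%C *: 1 - a1) <= 2.
  apply: (le_trans (cnorm_dist_trans b _ _)); rewrite cnorm_distC.
  by have := weight_le1 0; have := weight_le1 n.+1; rewrite -/v; lra.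
rewrite e1; apply: (le_trans (cnormD _ _)); rewrite cnormZr ger0_norm // (cnorm_distC a1).
(* Indeed [1 - s = 2 * t * s]. As [2 * v <= t], the total displacement is at most [4 * t + t], and
   the divisor 10 in [weight] makes this at most half of [beta n.+1]. *)
have k3 : 1 - s <= 2 * t by nra.
have k4 : (1 - s) * cnorm (r%:C%C *: 1 - a1) <= 2 * t * 2 by apply: ler_pM.
have tb : t <= beta n.+1 / 10.
  rewrite /t /v /= -/w mulrC mulKf ?gt_eqF //.
  by apply: ler_wpM2r => //; rewrite ge_min lexx orbT.
have vt : v <= t * 2^-1.
  have tw : t * w = v by rewrite /t divfK // gt_eqF.
  by rewrite -tw; apply: ler_wpM2l; [exact: ltW|exact: weight_le1].
lra.
Qed.

Lemma af_approximable : exists L : forall n, U n -> \bar R, approximable L beta 2 0.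
Proof.
exists (@stage_lip R A U wdist).
exact: (stage_approximable wdist_ssn hU.1 beta_gt0 beta_sum bridge).
Qed.

End DistanceSeminorms.

(** * Dimensions, the scalar subalgebra and small weights *)

Section Dimension.
Variables (R : realType) (V : lmodType R[i]).

(** The change of coordinates is an injective matrix, so its rank is [d], and it has [d']
    columns. *)
Lemma has_dim_le d d' : has_dim V d -> has_dim V d' -> (d <= d')%N.
Proof.
move=> [f fl [g fK gK]] [f' fl' [g' fK' gK']].
have gl : linear g by move=> c u v; apply: (can_inj fK); rewrite gK fl !gK.
pose h v := f' (g v).
have hl : linear h by move=> c u v; rewrite /h gl fl'.
have hD u v : h (u + v) = h u + h v by have := hl 1 u v; rewrite !scale1r.
have h0 : h 0 = 0 by apply: (addrI (h 0)); rewrite -hD !addr0.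
have hZ c u : h (c *: u) = c *: h u by have := hl c u 0; rewrite h0 !addr0.
pose M := \matrix_(i < d) h (delta_mx 0 i).
have hM v : v *m M = h v.
  rewrite mulmx_sum_row [in RHS](row_sum_delta v).
  under eq_bigr do rewrite rowK -hZ.
  by elim/big_ind2: _ => // [x1 x2 y1 y2 -> ->]; rewrite hD.
have Mf : row_free M.
  apply: inj_row_free => v; rewrite hM -h0 => /(can_inj fK') /(can_inj gK) //.
by rewrite -(eqP Mf) rank_leq_col.
Qed.

Lemma has_dim_uniq d d' : has_dim V d -> has_dim V d' -> d = d'.
Proof.
by move=> h h'; apply/eqP; rewrite eqn_leq !has_dim_le.
Qed.

Lemma has_dim_gt0 d (v : V) : v != 0 -> has_dim V d -> (0 < d)%N.
Proof.
case: d => // v0 [f _ [g fK _]]; case/eqP: v0.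
by rewrite -(fK v) -(fK 0) (thinmx0 (f v)) (thinmx0 (f 0)).
Qed.

End Dimension.

Section Scalars.
Variables (R : realType) (A : cstarType R).

(** Intervals from [c - e] to [c + e] that meet pairwise share the supremum of their left ends. This
    yields the real and imaginary parts of a limit of scalars. *)
Lemma squeeze (P : R -> R -> Prop) : (exists c e, P c e) ->
  (forall c e c' e', P c e -> P c' e' -> c - e <= c' + e') ->
  exists r : R, forall c e, P c e -> `|r - c| <= e.
Proof.
move=> [c0 [e0 P0]] h; pose X := [set x : R | exists c e, P c e /\ x = c - e].
have X0 : X !=set0 by exists (c0 - e0), c0, e0.
exists (sup X) => c e Pce; rewrite ler_norml; apply/andP; split.
  have : c - e <= sup X; last by lra.
  by apply: ub_le_sup; [exists (c0 + e0) => _ [c' [e' [P' ->]]]; exact: h|exists c, e].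
have : sup X <= c + e; last by lra.
by apply: ge_sup => // _ [c' [e' [P' ->]]]; exact: h.
Qed.

Lemma normc_Re (z : R[i]) : `|complex.Re z| <= normc z.
Proof.
by case: z => u v /=; rewrite -sqrtr_sqr ler_sqrt ?lerDl ?sqr_ge0 // addr_ge0 ?sqr_ge0.
Qed.

Lemma normc_Im (z : R[i]) : `|complex.Im z| <= normc z.
Proof.
by case: z => u v /=; rewrite -sqrtr_sqr ler_sqrt ?lerDr ?sqr_ge0 // addr_ge0 ?sqr_ge0.
Qed.

Lemma normc_le_ReIm (z : R[i]) : normc z <= `|complex.Re z| + `|complex.Im z|.
Proof.
case: z => u v; rewrite [X in normc X](_ : _ = u%:C%C + 'i%C * v%:C%C).
  apply: (le_trans (le_normcD _ _)); rewrite normcM normc_i mul1r.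
  by rewrite !normc_real.
by apply/eqP; rewrite eq_complex /=; apply/andP; split; apply/eqP; lra.
Qed.

Let scalars : set A := [set a | exists c : R[i], a = c *: 1].

Let scalars_closed : closed [set a : normed A | scalars a].
Proof.
move=> a ha.
have near (e : R) : 0 < e -> exists c : R[i], cnorm (a - c *: 1) < e.
  move=> e0; have [|b [[c ->] ab]] := ha [set b | cnorm (b - a) < e].
    by apply/nbhs_normedP; exists e.
  by exists c; rewrite cnorm_distC.
pose P (part : R[i] -> R) u e := exists2 c : R[i], part c = u & cnorm (a - c *: 1) < e.
have dist c c' e e' : cnorm (a - c *: 1) < e -> cnorm (a - c' *: 1) < e' -> normc (c - c') <= e + e'.
  move=> h h'; have := cnormZ (c - c') (1 : A); rewrite cnorm1 mulr1 => <-.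
  rewrite scalerBl; apply: (le_trans (cnorm_dist_trans a _ _)); rewrite (cnorm_distC (c *: 1)); lra.
have [c0 h0] := near _ ltr01.
have [u hu] : exists r, forall c e, P (@complex.Re R) c e -> `|r - c| <= e.
  apply: squeeze; first by exists (complex.Re c0), 1, c0.
  move=> _ e _ e' [c <- h] [c' <- h']; have := dist _ _ _ _ h h'.
  have := normc_Re (c - c'); rewrite raddfB /= ler_norml => /andP[_]; lra.
have [v hv] : exists r, forall c e, P (@complex.Im R) c e -> `|r - c| <= e.
  apply: squeeze; first by exists (complex.Im c0), 1, c0.
  move=> _ e _ e' [c <- h] [c' <- h']; have := dist _ _ _ _ h h'.
  have := normc_Im (c - c'); rewrite raddfB /= ler_norml => /andP[_]; lra.
exists (u +i* v)%C; apply: (@eq_cnorm_le _ _ _ _ 3) => // e e0.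
have [c hc] := near _ e0.
apply: (le_trans (cnorm_dist_trans (c *: 1) _ _)); rewrite -scalerBl cnormZ cnorm1 mulr1.
have h1 : `|u - complex.Re c| <= e by apply: hu; exists c.
have h2 : `|v - complex.Im c| <= e by apply: hv; exists c.
have := normc_le_ReIm (c - (u +i* v)%C); rewrite !raddfB /=.
by rewrite (distrC (complex.Re c)) (distrC (complex.Im c)); lra.
Qed.

Definition scalar_subcstar : subcstar A.
Proof.
apply: (@SubCStar R A scalars) => //.
- by exists 1; rewrite scale1r.
- by move=> _ _ [c ->] [d ->]; exists (c + d); rewrite scalerDl.
- by move=> c _ [d ->]; exists (c * d); rewrite scalerA.
- by move=> _ _ [c ->] [d ->]; exists (c * d); rewrite -scalerAl mul1r scalerA.
- by move=> _ [c ->]; exists (c^*)%C; rewrite starZ star1.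
Defined.

Lemma scalar_subcstar_dim : has_dim scalar_subcstar 1.
Proof.
have /choice[f hf] : forall a : scalar_subcstar, exists c : R[i], elt a = c *: 1.
  by move=> a; exact: eltP a.
pose g (v : 'rV[R[i]]_1) : scalar_subcstar := v 0 0 *: 1.
exists (fun a => const_mx (f a)).
  move=> c a b; apply/matrixP => i j; rewrite !mxE; apply: (@scalar_inj R A).
  by rewrite -hf eltD eltZ !hf scalerA -scalerDl.
exists g => [a|v].
  by apply: elt_inj; rewrite /g eltZ mxE elt1 -hf.
apply/matrixP => i j; rewrite !mxE !ord1; apply: (@scalar_inj R A).
by rewrite -hf /g eltZ elt1.
Qed.

End Scalars.

Section PrependScalars.
Variables (R : realType) (A : cstarType R) (U : filtration A).

Let V n : subcstar A := if n is n'.+1 then U n' else scalar_subcstar A.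

Let V_incr n a : V n a -> V n.+1 a.
Proof. by case: n => [[c ->]|n]; [exact: subcstar_scalar|exact: stage_incr]. Qed.

Let V_dense (a : A) : closure [set b : normed A | exists n, V n b] a.
Proof.
move=> W /(@stage_dense _ _ U a)[b [[n Ub] Wb]].
by exists b; split => //; exists n.+1.
Qed.

(** [unital_AF] leaves the zeroth stage free, whereas [af_filtration] starts from the scalars: the
    given stages are shifted by one. *)
Definition prepend_scalars : filtration A := Filtration V_incr V_dense.

Lemma prepend_scalars_af : fin_dim_filtration U -> af_filtration prepend_scalars.
Proof.
by move=> h; split => // -[|n]; [exists 1%N; exact: scalar_subcstar_dim|exact: h].
Qed.

End PrependScalars.

Section SmallWeights.
Variable R : realType.

Lemma dominated_by_geometric (b : nat -> R) : (forall n, 0 < b n) ->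
  (forall n, b n <= 2^-1 ^+ n) -> cvgn (series b).
Proof.
move=> b0 bg; apply: (@series_le_cvg _ b (fun n => 2^-1 ^+ n)) => //.
  by move=> n; exact: ltW.
have h : `|2^-1 : R| < 1 by rewrite ger0_norm //; lra.
have := is_cvg_geometric_series (a := 1) h.
by congr (cvgn (series _)); apply/funext => n; rewrite /geometric /= mul1r.
Qed.

End SmallWeights.

Lemma approximable_af (R : realType) (A : cstarType R) (U : filtration A) :
  af_filtration U -> approximable_by U.
Proof.
move=> hU; pose b n : R := 2^-1 ^+ n.
have b0 n : 0 < b n by rewrite exprn_gt0.
have bs : cvgn (series b) by apply: dominated_by_geometric.
by have [L hL] := af_approximable hU b0 bs; exists L, b.
Qed.

Lemma approximable_af_dim (R : realType) (A : cstarType R) (U : filtration A) (k : R) :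
  af_filtration U -> 1 < k ->
  exists (L : forall n, U n -> \bar R) (beta : nat -> R), approximable L beta 2 0 /\
    forall j d, has_dim (U j) d -> beta j <= 1 / (d%:R `^ k).
Proof.
move=> hU k1; have /choice[d hd] := hU.1.
have d0 n : 1 <= (d n)%:R :> R.
  rewrite ler1n; apply: (has_dim_gt0 (v := 1 : U n)) (hd n); exact: oner_neq0.
have dk n : 1 <= (d n)%:R `^ k.
  rewrite -[leLHS]/((fun=> 1 : R) k) -(powR1 R); apply: ge0_ler_powR; rewrite ?nnegrE //; lra.
(* Dimensions are at least 1 because [1 != 0], so this division preserves the geometric bound that
   ensures summability. *)
pose b n : R := 2^-1 ^+ n / ((d n)%:R `^ k).
have p0 n : 0 <= (2^-1 : R) ^+ n by rewrite exprn_ge0.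
have p1 n : (2^-1 : R) ^+ n <= 1 by apply: exprn_ile1 => //; lra.
have b0 n : 0 < b n.
  by apply: divr_gt0; [rewrite exprn_gt0|apply: lt_le_trans (dk n)].
have bs : cvgn (series b).
  apply: dominated_by_geometric => // n.
  have dn := dk n; rewrite ler_pdivrMr; last by lra.
  by rewrite ler_peMr.
have [L hL] := af_approximable hU b0 bs; exists L, b; split => // j e hj.
(* The bound is claimed for every [e] with [has_dim], so uniqueness reduces it to the chosen
   dimension. *)
by rewrite (has_dim_uniq hj (hd j)); apply: ler_wpM2r.
Qed.

Theorem theorem3p4 (R : realType) :
  (forall (A : cstarType R) (U : filtration A) (beta : nat -> R)
      (E : forall n, U n.+1 -> U n),
    af_filtration U ->
    (forall j, 0 < beta j) -> cvgn (series beta) ->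
    (forall n, cond_exp (stage_inclusion U n) (E n)) ->
    [/\
      forall n, [/\ is_lip_norm (L_beta beta E n),
                    quasi_leibniz (L_beta beta E n) 2 0
                  & (diam (L_beta beta E n) <= (2 * beta 0%N)%:E)%E],
      approximable (L_beta beta E) beta 2 0,
      exists L : A -> \bar R, limit_lip_norm (L_beta beta E) beta L
    & forall L : A -> \bar R, limit_lip_norm (L_beta beta E) beta L ->
      [/\ is_lip_norm L /\ quasi_leibniz L 2 0,
          forall n (a : A), U n a -> sa a -> dom L a,
          propinquity 2 0 (L_beta beta E n) L @[n --> \oo] --> 0%E,
          forall n, (propinquity 2 0 (L_beta beta E n) L
                       <= 4%:E * \sum_(n <= j <oo) (beta j)%:E)%E
        & forall n (a : U n), sa a ->
          (L (elt a) <= (Num.max 1 (if n is n'.+1 then 2 * beta 0%N / beta n' else 0))%:E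
                          * L_beta beta E n a)%E]])
  /\ (forall A : cstarType R, unital_AF A ->
        exists U : filtration A, approximable_by U)
  /\ (forall (A : cstarType R) (U : filtration A), af_filtration U ->
        approximable_by U)
  /\ (forall (A : cstarType R) (U : filtration A) (k : R), af_filtration U -> 1 < k ->
        exists (L : forall n, U n -> \bar R) (beta : nat -> R),
          approximable L beta 2 0 /\
          forall j d, has_dim (U j) d -> beta j <= 1 / (d%:R `^ k)).

Proof.
split; last split; last split.
- move=> A U beta E hU b0 bs hE; rewrite (L_betaE b0 hE).
  have hp := dev_ssn hU b0 hE; split.
  + move=> n; have [d hd] := hU.1 n; split.
    * exact: stage_lip_norm hp _ _ hd.
    * exact: stage_lip_leibniz hp n.
    * exact: stage_lip_diam hp n.
  + exact: dev_approximable.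
  + exact: dev_limit_exists.
  move=> L /(dev_limitE hU b0 bs) LE.
  (* This state supplies the lower bound 0 of the squeeze. *)
  have [phi _] := state_exists hU hE.
  have pr n := propinquity_stage hU b0 bs LE n.
  (* [beta n], the bound from the tunnel, is the first term of the tail of the series. *)
  have sum_ge n : ((beta n)%:E <= \sum_(n <= j <oo) (beta j)%:E)%E.
    have h j : (n <= j)%N -> xpredT j -> (0 <= (beta j)%:E)%E by rewrite lee_fin ltW.
    by have := nneseries_lim_ge n.+1 h; rewrite big_nat1.
  split.
  + by split; [exact: dev_lip_norm LE|exact: dev_leibniz LE].
  + move=> n a Ua ha; split => //; rewrite LE //.
    exact: (stage_lip_fin hp (mkelt Ua)).
  + apply: (squeeze_cvge (f := cst 0%E) (h := fun n => (beta n)%:E)).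
    * by apply: nearW => n; rewrite propinquity_ge0 //= pr.
    * exact: cvg_cst.
    * by apply: cvg_EFin; [apply: nearW|exact: cvg_series_cvg_0 bs].
  + move=> n; apply: (le_trans (pr n)); apply: (le_trans (sum_ge n)).
    rewrite -[leLHS]mul1e; apply: lee_wpmul2r; last by rewrite lee_fin ler1n.
    by apply: nneseries_ge0 => j _ _; rewrite lee_fin ltW.
  (* On selfadjoint elements of the stage both seminorms are the same supremum, and the factor is at
     least 1. *)
  + move=> n a ha; rewrite LE; last exact/elt_sa.
    rewrite -[leLHS]mul1e; apply: lee_wpmul2r.
      exact: (sup_lip_ge0 0%N (dev_csn b0 hE)).
    by rewrite lee_fin le_max lexx.
- move=> A [U hU]; exists (prepend_scalars U); apply: approximable_af.
  exact: prepend_scalars_af.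
- by move=> A U; exact: approximable_af.
- by move=> A U k; exact: approximable_af_dim.
Qed.
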